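(* Let $G$ be a countable, discrete group with identity $e$. Then $G$ is amenable if and only if the following condition holds: whenever $\varphi:G\to\mathbb{R}$ is a symmetric function such that $\|e^{-t\varphi}\|_{B_2}\leq 1$ for every $t>0$, then $\varphi$ splits as $$\varphi(x)=\psi(x)+\|\xi\|^2+\langle\pi(x)\xi,\xi\rangle\qquad (x\in G),$$ where $\psi$ is a conditionally negative definite function on $G$ with $\psi(e)=0$, $\pi$ is an orthogonal representation of $G$ on some real Hilbert space $H$, and $\xi$ is a vector in $H$.
   Context: A function $\psi$ on $G$ is conditionally negative definite if the kernel $\hat\psi(x,y)=\psi(y^{-1}x)$ is, i.e. $\hat\psi$ is hermitian ($\hat\psi(y,x)=\overline{\hat\psi(x,y)}$) and $\sum_{i,j}c_i\overline{c_j}\hat\psi(x_i,x_j)\leq 0$ for all finite families $x_i\in G$, $c_i\in\mathbb{C}$ with $\sum_i c_i=0$. A function $\varphi$ on $G$ is symmetric if $\varphi(x^{-1})=\varphi(x)$ for all $x\in G$. A kernel $k:X\times X\to\mathbb{C}$ is a Schur multiplier if for every bounded operator $A=[a_{xy}]_{x,y\in X}$ on $\ell^2(X)$ the matrix $[k(x,y)a_{xy}]$ represents a bounded operator $m_k(A)$ on $\ell^2(X)$; then $\|k\|_S=\|m_k\|$. A function $\varphi:G\to\mathbb{C}$ is a Herz-Schur multiplier if $\hat\varphi(x,y)=\varphi(y^{-1}x)$ is a Schur multiplier on $G$, and $\|\varphi\|_{B_2}=\|\hat\varphi\|_S$. The inequality $\|\varphi\|_{B_2}\le 1$ includes the assertion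 that $\varphi$ is a Herz-Schur multiplier. $G$ is amenable if there is a left-invariant, finitely additive probability measure defined on all subsets of $G$. *)

(* Defs.v *)
From HB Require Import structures.
From mathcomp Require Import all_boot all_order all_algebra.
From mathcomp Require Import sesquilinear complex ring.
From mathcomp Require Import all_classical all_reals all_analysis.

Set Implicit Arguments.
Unset Strict Implicit.
Unset Printing Implicit Defensive.

Import Order.TTheory GRing.Theory Num.Theory.
Import numFieldNormedType.Exports.

Local Open Scope classical_set_scope.
Local Open Scope ring_scope.

(* The complex modulus as an element of R; the norm `|z| of R[i] is
   R[i]-valued. *)
Definition cmod (R : realType) (z : R[i]) : R := ComplexField.Normc.normc z.

Definition sqsum (R : realType) (X : choiceType) (f : X -> R[i]) : \bar R :=
  \esum_(x in [set: X]) (cmod (f x) ^+ 2)%:E.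

Definition square_summable (R : realType) (X : choiceType) : {pred X -> R[i]} :=
  fun f => `[< (sqsum f < +oo)%E >].

Section square_summable_theory.
Context (R : realType) (X : choiceType).
Implicit Types (f g : X -> R[i]) (z w : R[i]).

Lemma cmod_ge0 z : 0 <= cmod z.
Proof. by case: z => a b; exact: sqrtr_ge0. Qed.

Lemma cmod_sqr_ge0 z : 0 <= cmod z ^+ 2.
Proof. exact: sqr_ge0. Qed.

Lemma cmodD_sqr z w : cmod (z + w) ^+ 2 <= 2 * cmod z ^+ 2 + 2 * cmod w ^+ 2.
Proof.
have E (y : R[i]) : cmod y ^+ 2 = complex.Re y ^+ 2 + complex.Im y ^+ 2.
  by case: y => a b; rewrite /cmod /= sqr_sqrtr // addr_ge0 ?sqr_ge0.
rewrite !E; case: z w => [a b] [c d] /=.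
rewrite -subr_ge0.
suff -> : 2 * (a ^+ 2 + b ^+ 2) + 2 * (c ^+ 2 + d ^+ 2) -
    ((a + c) ^+ 2 + (b + d) ^+ 2) = (a - c) ^+ 2 + (b - d) ^+ 2.
  by rewrite addr_ge0 ?sqr_ge0.
by rewrite !sqrrD !sqrrN !mulrN; ring.
Qed.

Lemma esumZ_le (r : R) (a : X -> R) : 0 <= r -> (forall x, 0 <= a x) ->
  (\esum_(x in [set: X]) (r * a x)%:E <=
   r%:E * \esum_(x in [set: X]) (a x)%:E)%E.
Proof.
move=> r0 a0; apply: ge_ereal_sup => _ [A [finA _] <-].
under eq_fsbigr do rewrite EFinM.
rewrite -ge0_mule_fsumr; last by move=> x; rewrite lee_fin.
apply: lee_wpmul2l; first by rewrite lee_fin.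
by apply: ereal_sup_ubound; exists A.
Qed.

Lemma square_summable_submod_closed : submod_closed (@square_summable R X).
Proof.
split=> [|r f g /asboolP sf /asboolP sg]; apply/asboolP.
  rewrite /sqsum esum1 ?ltry // => x _.
  by rewrite /cmod ComplexField.Normc.normc0 expr0n.
have fin (u : X -> R[i]) : (sqsum u < +oo)%E -> sqsum u \is a fin_num.
  move=> su; rewrite ge0_fin_numE //; apply: esum_ge0 => x _.
  by rewrite lee_fin cmod_sqr_ge0.
have key (u : X -> R[i]) (c : R) : 0 <= c -> (sqsum u < +oo)%E ->
    (\esum_(x in [set: X]) (c * cmod (u x) ^+ 2)%:E < +oo)%E.
  move=> c0 /fin su; apply: le_lt_trans (esumZ_le c0 _) _.
    by move=> x; exact: cmod_sqr_ge0.
  by rewrite -/(sqsum u) -(fineK su) -EFinM ltry.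
have h x : ((cmod ((r *: f + g) x) ^+ 2)%:E <=
    (2 * cmod r ^+ 2 * cmod (f x) ^+ 2)%:E + (2 * cmod (g x) ^+ 2)%:E)%E.
  rewrite -EFinD lee_fin; apply: le_trans (cmodD_sqr _ _) _.
  by rewrite lerD2r /cmod ComplexField.Normc.normcM exprMn mulrA.
apply: le_lt_trans (le_esum (fun x _ => h x)) _.
have pos2 u (x : X) : 0 <= 2 * cmod (u x : R[i]) ^+ 2.
  exact: mulr_ge0 (ler0n _ 2) (cmod_sqr_ge0 _).
have posr : 0 <= 2 * cmod r ^+ 2.
  exact: mulr_ge0 (ler0n _ 2) (cmod_sqr_ge0 r).
rewrite esumD => [|x _|x _]; last 2 first.
- by rewrite lee_fin; exact: mulr_ge0 posr (cmod_sqr_ge0 _).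
- by rewrite lee_fin; exact: pos2.
by apply: lte_add_pinfty; apply: key => //; exact: ler0n.
Qed.

HB.instance Definition _ := GRing.isSubmodClosed.Build R[i] (X -> R[i])
  (@square_summable R X) square_summable_submod_closed.

Lemma square_summable_delta (y : X) :
  (fun x => ((x == y)%:R : R[i])) \in @square_summable R X.
Proof.
apply/asboolP; rewrite /sqsum.
have -> : \esum_(x in [set: X]) (cmod ((x == y)%:R : R[i]) ^+ 2)%:E =
    \esum_(x in [set y]) (1%R%:E : \bar R).
  rewrite [RHS]esum_mkcond; apply: eq_esum => x _.
  case: (eqVneq x y) => [->|/eqP nxy].
    by rewrite mem_set // /cmod ComplexField.Normc.normc1 expr1n.
  by rewrite memNset // /cmod ComplexField.Normc.normc0 expr0n.
by rewrite esum_set1 ?lee_fin ?ler01 ?ltry.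
Qed.

End square_summable_theory.

Section l2.
Context (R : realType) (X : choiceType).

Record l2 := L2 { l2fun :> X -> R[i] ; _ : l2fun \in @square_summable R X }.

HB.instance Definition _ := [isSub for l2fun].
HB.instance Definition _ := [Choice of l2 by <:].
HB.instance Definition _ := [SubChoice_isSubLmodule of l2 by <:].

Definition l2norm (f : l2) : R := Num.sqrt (fine (sqsum f)).

Definition l2delta (y : X) : l2 := L2 (square_summable_delta R y).

Implicit Types (A B : {linear l2 -> l2}) (a k : X -> X -> R[i]).

(* +oo when A is unbounded. *)
Definition opnorm A : \bar R :=
  ereal_sup [set (l2norm (A f))%:E | f in [set f : l2 | l2norm f <= 1]].

Definition bounded_op A : Prop := (opnorm A < +oo)%E.

(* The (x, y) entry <A delta_y, delta_x> of the matrix of A. *)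
Definition op_entry A (x y : X) : R[i] := A (l2delta y) x.

(* B = m_k(A): there is at most one such B, since a bounded operator is
   determined by its matrix. *)
Definition schur_product k A B : Prop :=
  bounded_op B /\ forall x y, op_entry B x y = k x y * op_entry A x y.

Definition schur_multiplier k : Prop :=
  forall A, bounded_op A -> exists B, schur_product k A B.

(* The operator norm of m_k on the bounded operators; only meaningful when k
   is a Schur multiplier. *)
Definition schur_norm k : \bar R :=
  ereal_sup [set r | exists A B,
    [/\ bounded_op A, (opnorm A <= 1)%E, schur_product k A B & r = opnorm B]].

End l2.

Section group_functions.
Context (R : realType) (G : groupType).

Definition left_kernel (phi : G -> R[i]) (x y : G) : R[i] :=
  phi (y^-1 * x)%g.

Definition herz_schur (phi : G -> R[i]) : Prop :=
  schur_multiplier (left_kernel phi).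

Definition B2norm (phi : G -> R[i]) : \bar R := schur_norm (left_kernel phi).

Definition B2norm_le1 (phi : G -> R[i]) : Prop :=
  herz_schur phi /\ (B2norm phi <= 1)%E.

(* In R[i], z <= 0 means that z is real and nonpositive. *)
Definition cond_neg_def_kernel (X : Type) (k : X -> X -> R[i]) : Prop :=
  (forall x y, k y x = conjc (k x y)) /\
  forall (n : nat) (x : 'I_n -> X) (c : 'I_n -> R[i]),
    \sum_(i < n) c i = 0 ->
    \sum_(i < n) \sum_(j < n) c i * conjc (c j) * k (x i) (x j) <= 0.

Definition cond_neg_def (psi : G -> R[i]) : Prop :=
  cond_neg_def_kernel (left_kernel psi).

Definition symmetric_fun (T : Type) (phi : G -> T) : Prop :=
  forall x, phi x^-1%g = phi x.

Definition amenable : Prop :=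
  exists mu : set G -> R,
    [/\ forall A, 0 <= mu A,
        mu [set: G] = 1,
        forall A B, A `&` B = set0 -> mu (A `|` B) = mu A + mu B
      & forall (g : G) A, mu [set (g * x)%g | x in A] = mu A].

End group_functions.

Arguments amenable R G : clear implicits.

Record realHilbertSpace (R : realType) := RealHilbertSpace {
  hilbert_sort :> completeNormedModType R;
  inner : {dot hilbert_sort for idfun};
  sqr_norm_inner : forall v : hilbert_sort, `|v| ^+ 2 = inner v v }.

Arguments inner {R} _.

Definition orthogonal_rep (R : realType) (G : groupType)
    (H : realHilbertSpace R) (pi : G -> {linear H -> H}) : Prop :=
  [/\ forall v, pi 1%g v = v,
      forall x y v, pi (x * y)%g v = pi x (pi y v)
    & forall x u v, inner H (pi x u) (pi x v) = inner H u v].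

(* Main.v *)
Require Import Defs.
From HB Require Import structures.
From mathcomp Require Import all_boot all_order all_algebra.
From mathcomp Require Import sesquilinear complex.
From mathcomp Require Import all_classical all_reals all_analysis.
From mathcomp Require Import ring lra.
Import Order.TTheory GRing.Theory Num.Theory.
Import numFieldNormedType.Exports.
Local Open Scope classical_set_scope.
Local Open Scope ring_scope.

Set Implicit Arguments.
Unset Strict Implicit.
Unset Printing Implicit Defensive.

(** Amenable groups have the splitting property because the exponentials of
    [- t phi], being contractive Schur multipliers, can be split on finite sets
    and differentiated at [t = 0]. A symmetric real matrix [m] that is a
    contractive Schur multiplier is a difference [a - b] of positive matrices
    with [a + b] equal to 1 on the diagonal [schur_jordan_decomposition]; this
    is a duality statement, and a finite-dimensional Hahn-Banach theorem
    [linear_below_sublinear] proves it. For [m = exp (- t K)], where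
    [K x y = phi (y^-1 x)], the matrix [(1 - m) / t - b / t = (1 - a) / t] is
    conditionally negative definite, [b / t] is positive, and its diagonal is
    half of [(1 - exp (- t phi 1)) / t]. A generalized limit along [t -> 0] and
    along finite sets that exhaust the group splits [K] itself into a
    conditionally negative definite kernel and a bounded positive one with
    diagonal [phi 1 / 2] [exp_section_limit]. Integrating the translates of the
    second kernel against the invariant mean makes it invariant
    [average_kernel], and the Gelfand-Naimark-Segal construction [real_gns]
    writes it as the coefficient of an orthogonal representation.

    Conversely, suppose that the group is not amenable. By Kesten's argument
    some finite symmetric [S] has a spectral gap: the l2-norm of the n-step
    distribution [P n] of its random walk decays exponentially
    [nonamenable_gap]. So there are [r > 1] and a positive function [eta] whose
    averages over [S] are at most [eta / r]: sum the translates of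
    [r ^ n P n] with summable coefficients. Relative to such an [eta] the kernel
    of the weight [w ^ 2 = r ^ n P n] has rows and columns of sum at most 1, so
    a Schur test shows that every function bounded by [w / 2] is a contractive
    Schur multiplier, although the sum of [w ^ 2] is [r ^ n], which is
    arbitrarily large [large_schur_weights]. If [f] is such a function, then
    [exp (- t (1 - f))] is a power series in [f] whose coefficients are positive
    and of sum 1, hence contractive; by hypothesis [1 - f] splits whenever [f]
    is symmetric.

    Random signs contradict this. The second difference of [f] along a group
    element turns a splitting of [1 - f] into a difference of two positive
    definite functions of bounded value at the identity [splitting_sdiff].
    Positive definite functions are bounded on the Riesz products
    [prod_y (1 + i a_y tau_y (y + y^-1))] by a multiple of their value at the
    identity as soon as the sum of the [tau_y ^ 2] is small [riesz_bound],
    because each factor is normal with norm the square root of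
    [1 + 4 tau_y ^ 2] at most. If [f] is built from the same signs [a_y] with
    coefficients [w y / 4], the average over the signs of its second differences
    on the imaginary part of the product is at least of the order of the sum of
    the [tau_y w y], that is of the l2-norm of [w] when [tau] is proportional to
    [w] [riesz_avg, splitting_fails], and so is not bounded. *)

(** * Generalized limits of bounded sequences *)
Definition bounded_seq (R : realType) (u : nat -> R) : Prop :=
  exists M : R, forall n, `|u n| <= M.

Lemma ultra_fmap (T S : Type) (f : T -> S) (U : set_system T) :
  UltraFilter U -> UltraFilter (f @ U).
Proof.
move=> UU; split; first exact: fmap_proper_filter.
move=> F PF UF; apply/seteqP; split=> [A FA|//].
have [//|UnA] := in_ultra_setVsetC (f @^-1` A) UU.
have FnA : F (~` A) by exact: UF.
by have [x []] := filter_ex (filterI FA FnA).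
Qed.

(** Along an ultrafilter finer than the Frechet filter every bounded sequence
    converges, by compactness of segments. *)
Lemma generalized_limit_exists (R : realType) : exists L : (nat -> R) -> R,
  [/\ forall u v, bounded_seq u -> bounded_seq v ->
        L (fun n => u n + v n) = L u + L v,
      forall c u, bounded_seq u -> L (fun n => c * u n) = c * L u,
      forall u, bounded_seq u -> (\forall n \near \oo, 0 <= u n) -> 0 <= L u
    & L (fun=> 1) = 1].
Proof.
have [U [UU sU]] := ultraFilterLemma (F := \oo : set_system nat) _.
have PU : ProperFilter U by exact: ultra_proper.
have cvgU (u : nat -> R) : bounded_seq u -> cvg (u @ U).
  move=> [M uM].
  have := @segment_compact R (- M) M; rewrite compact_ultra.
  move=> /(_ (u @ U) _) [||p [_ up]].
  - exact: ultra_fmap.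
  - by apply: (@filterE _ U) => n /=; rewrite in_itv /= -ler_norml.
  - by apply/cvg_ex; exists p.
exists (fun u => lim (u @ U)); split.
- move=> u v /cvgU cu /cvgU cv; apply: cvg_lim => //; exact: cvgD.
- move=> c u /cvgU cu; apply: cvg_lim => //; apply: cvgM => //; exact: cvg_cst.
- move=> u /cvgU cu u0; apply: limr_ge => //; exact: sU.
- apply: cvg_lim => //; exact: cvg_cst.
Qed.

Definition glim (R : realType) : (nat -> R) -> R :=
  projT1 (cid (generalized_limit_exists R)).

Section glim_theory.
Context (R : realType).
Implicit Types (u v : nat -> R) (c : R).

Lemma bounded_cst c : bounded_seq (fun=> c).
Proof. by exists `|c|. Qed.

Lemma boundedD u v : bounded_seq u -> bounded_seq v ->
  bounded_seq (fun n => u n + v n).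
Proof.
move=> [M uM] [N vN]; exists (M + N) => n.
by apply: le_trans (ler_normD _ _) _; apply: lerD.
Qed.

Lemma boundedZ c u : bounded_seq u -> bounded_seq (fun n => c * u n).
Proof.
by move=> [M uM]; exists (`|c| * M) => n; rewrite normrM ler_wpM2l.
Qed.

Lemma boundedN u : bounded_seq u -> bounded_seq (fun n => - u n).
Proof. by move=> [M uM]; exists M => n; rewrite normrN. Qed.

Lemma bounded_sum (I : Type) (s : seq I) (u : I -> nat -> R) :
  (forall i, bounded_seq (u i)) -> bounded_seq (fun n => \sum_(i <- s) u i n).
Proof.
move=> bu; elim: s => [|i s [M IH]].
  by exists 0 => n; rewrite big_nil normr0.
have [N uN] := bu i; exists (N + M) => n; rewrite big_cons.
by apply: le_trans (ler_normD _ _) _; apply: lerD.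
Qed.

Lemma glimD u v : bounded_seq u -> bounded_seq v ->
  glim (fun n => u n + v n) = glim u + glim v.
Proof. by rewrite /glim; case: cid => L /= [H *]; apply: H. Qed.

Lemma glimZ c u : bounded_seq u -> glim (fun n => c * u n) = c * glim u.
Proof. by rewrite /glim; case: cid => L /= [_ H *]; apply: H. Qed.

Lemma glim_ge0 u : bounded_seq u -> (\forall n \near \oo, 0 <= u n) ->
  0 <= glim u.
Proof. by rewrite /glim; case: cid => L /= [_ _ H _]; apply: H. Qed.

Lemma glim_cst c : glim (fun=> c) = c.
Proof.
transitivity (glim (fun n : nat => c * (fun=> 1) n)).
  by congr glim; apply/funext => n; rewrite mulr1.
rewrite glimZ; last exact: bounded_cst.
by rewrite /glim; case: cid => L /= [_ _ _ ->]; rewrite mulr1.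
Qed.

Lemma glimN u : bounded_seq u -> glim (fun n => - u n) = - glim u.
Proof.
move=> bu; rewrite -mulN1r -glimZ //; congr glim.
by apply/funext => n; rewrite mulN1r.
Qed.

Lemma glimB u v : bounded_seq u -> bounded_seq v ->
  glim (fun n => u n - v n) = glim u - glim v.
Proof. by move=> bu bv; rewrite glimD ?glimN //; exact: boundedN. Qed.

Lemma ler_glim u v : bounded_seq u -> bounded_seq v ->
  (\forall n \near \oo, u n <= v n) -> glim u <= glim v.
Proof.
move=> bu bv uv; rewrite -subr_ge0 -glimB //; apply: glim_ge0.
  by apply: boundedD => //; exact: boundedN.
by apply: filterS uv => n; rewrite subr_ge0.
Qed.

Lemma glim_le u c : bounded_seq u -> (\forall n \near \oo, u n <= c) ->
  glim u <= c.
Proof.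
by move=> bu uc; rewrite -[leRHS]glim_cst; apply: ler_glim => //;
  exact: bounded_cst.
Qed.

Lemma glim_ge u c : bounded_seq u -> (\forall n \near \oo, c <= u n) ->
  c <= glim u.
Proof.
by move=> bu uc; rewrite -[leLHS]glim_cst; apply: ler_glim => //;
  exact: bounded_cst.
Qed.

Lemma glim_cvg u c : bounded_seq u -> u @ \oo --> c -> glim u = c.
Proof.
move=> bu uc; apply/le_anti/andP; split; apply/ler_addgt0Pr => e e0.
  apply: glim_le => //; move/cvgrPdist_le: uc => /(_ _ e0).
  by apply: filterS => n; rewrite ler_distlC => /andP[].
rewrite -lerBlDr; apply: glim_ge => //; move/cvgrPdist_le: uc => /(_ _ e0).
by apply: filterS => n; rewrite ler_distlC => /andP[].
Qed.

Lemma glim_near u c : bounded_seq u -> (\forall n \near \oo, u n = c) ->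
  glim u = c.
Proof.
move=> bu uc; apply: glim_cvg => //; exact: cvg_near_cst.
Qed.

Lemma glim_sum (I : Type) (s : seq I) (u : I -> nat -> R) :
  (forall i, bounded_seq (u i)) ->
  glim (fun n => \sum_(i <- s) u i n) = \sum_(i <- s) glim (u i).
Proof.
move=> bu; elim: s => [|i s IH].
  rewrite big_nil -[RHS](glim_cst 0); congr glim.
  by apply/funext => n; rewrite big_nil.
rewrite big_cons -IH -glimD //; last exact: bounded_sum.
by congr (glim _); apply/funext => n; rewrite big_cons.
Qed.

End glim_theory.

(** * Positive semidefinite kernels and formal sums *)
Section formal_sums.
Context (R : realType).

Section any_type.
Context (T : Type).
Implicit Types (u v w : seq (R * T)) (L : T -> R) (k : T -> T -> R) (c : R).

(** A list of pairs stands for a finitely supported real measure on [T]; points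
    may be repeated. *)
Definition ev L u : R := \sum_(a <- u) a.1 * L a.2.

Definition fform k u v : R := ev (fun x => ev (k x) v) u.

Definition fscale c u : seq (R * T) := [seq (c * a.1, a.2) | a <- u].

Definition fsub u v := u ++ fscale (-1) v.

Definition psd k := forall u, 0 <= fform k u u.

Lemma ev_nil L : ev L [::] = 0. Proof. by rewrite /ev big_nil. Qed.

Lemma ev_cons L a u : ev L (a :: u) = a.1 * L a.2 + ev L u.
Proof. by rewrite /ev big_cons. Qed.

Lemma ev_cat L u v : ev L (u ++ v) = ev L u + ev L v.
Proof. by rewrite /ev big_cat. Qed.

Lemma ev_fscale L c u : ev L (fscale c u) = c * ev L u.
Proof.
rewrite /ev big_map mulr_sumr; apply: eq_bigr => a _ /=; exact: esym (mulrA _ _ _).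
Qed.

Lemma ev_fsub L u v : ev L (fsub u v) = ev L u - ev L v.
Proof. by rewrite /fsub ev_cat ev_fscale mulN1r. Qed.

Lemma evD L L' u : ev (fun x => L x + L' x) u = ev L u + ev L' u.
Proof.
by rewrite /ev -big_split; apply: eq_bigr => a _; rewrite mulrDr.
Qed.

Lemma evZ c L u : ev (fun x => c * L x) u = c * ev L u.
Proof. by rewrite /ev mulr_sumr; apply: eq_bigr => a _; ring. Qed.

Lemma evB L L' u : ev (fun x => L x - L' x) u = ev L u - ev L' u.
Proof.
by rewrite /ev -sumrB; apply: eq_bigr => a _; rewrite mulrBr.
Qed.

Lemma ev_sum (I : Type) (s : seq I) (F : I -> T -> R) u :
  ev (fun x => \sum_(i <- s) F i x) u = \sum_(i <- s) ev (F i) u.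
Proof.
by rewrite /ev exchange_big; apply: eq_bigr => a _; rewrite mulr_sumr.
Qed.

Lemma eq_ev L L' : L =1 L' -> ev L =1 ev L'.
Proof. by move=> e u; apply: eq_bigr => a _; rewrite e. Qed.

Lemma eq_fform k k' : k =2 k' -> fform k =2 fform k'.
Proof. by move=> e u v; apply: eq_ev => x; apply: eq_ev => y. Qed.

Lemma fform_catl k u v w : fform k (u ++ v) w = fform k u w + fform k v w.
Proof. exact: ev_cat. Qed.

Lemma fform_scalel k c u v : fform k (fscale c u) v = c * fform k u v.
Proof. exact: ev_fscale. Qed.

Lemma fform_subl k u v w : fform k (fsub u v) w = fform k u w - fform k v w.
Proof. exact: ev_fsub. Qed.

Lemma fform_catr k u v w : fform k w (u ++ v) = fform k w u + fform k w v.
Proof. by rewrite /fform -evD; apply: eq_ev => x; rewrite ev_cat. Qed.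

Lemma fform_scaler k c u v : fform k v (fscale c u) = c * fform k v u.
Proof. by rewrite /fform -evZ; apply: eq_ev => x; rewrite ev_fscale. Qed.

Lemma fform_subr k u v w : fform k w (fsub u v) = fform k w u - fform k w v.
Proof. by rewrite /fform -evB; apply: eq_ev => x; rewrite ev_fsub. Qed.

Lemma fformE k u v :
  fform k u v = \sum_(a <- u) \sum_(b <- v) a.1 * b.1 * k a.2 b.2.
Proof.
rewrite /fform /ev; apply: eq_bigr => a _; rewrite mulr_sumr.
by apply: eq_bigr => b _; rewrite mulrA.
Qed.

Lemma fform_sym k : (forall x y, k x y = k y x) ->
  forall u v, fform k u v = fform k v u.
Proof.
move=> ks u v; rewrite !fformE exchange_big; apply: eq_bigr => a _.
by apply: eq_bigr => b _; rewrite ks [a.1 * _]mulrC.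
Qed.

Lemma fformDk k k' u v :
  fform (fun x y => k x y + k' x y) u v = fform k u v + fform k' u v.
Proof. by rewrite /fform -evD; apply: eq_ev => x; rewrite evD. Qed.

Lemma fformBk k k' u v :
  fform (fun x y => k x y - k' x y) u v = fform k u v - fform k' u v.
Proof. by rewrite /fform -evB; apply: eq_ev => x; rewrite evB. Qed.

Lemma fformZk c k u v :
  fform (fun x y => c * k x y) u v = c * fform k u v.
Proof. by rewrite /fform -evZ; apply: eq_ev => x; rewrite evZ. Qed.

Lemma fform_cstk c u v :
  fform (fun _ _ => c) u v = c * ev (fun=> 1) u * ev (fun=> 1) v.
Proof.
rewrite fformE /ev -mulrA big_distrlr mulr_sumr; apply: eq_bigr => a _.
by rewrite mulr_sumr; apply: eq_bigr => b _ /=; ring.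
Qed.

Lemma fform_parallelogram k u v :
  fform k (u ++ v) (u ++ v) + fform k (fsub u v) (fsub u v) =
  2 * (fform k u u + fform k v v).
Proof. by rewrite !(fform_catl, fform_catr, fform_subl, fform_subr); ring. Qed.

Lemma fform_cat_le k u v : psd k ->
  fform k (u ++ v) (u ++ v) <= 2 * (fform k u u + fform k v v).
Proof. by move=> kp; rewrite -fform_parallelogram lerDl. Qed.

(** The case where the form vanishes on [v] is separate: the quadratic
    polynomial in the coefficients is then tested far away. *)
Lemma fform_CauchySchwarz k u v : psd k -> (forall x y, k x y = k y x) ->
  fform k u v ^+ 2 <= fform k u u * fform k v v.
Proof.
move=> kp ks; have uv : fform k v u = fform k u v by exact: fform_sym.
have h (s t : R) :
    0 <= s ^+ 2 * fform k u u + 2 * s * t * fform k u v + t ^+ 2 * fform k v v.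
  have := kp (fscale s u ++ fscale t v).
  rewrite !(fform_catl, fform_catr, fform_scalel, fform_scaler) uv.
  by congr (0 <= _); ring.
have [v0|v0] := eqVneq (fform k v v) 0.
  have := h (fform k u v) (- (fform k u u + 1)).
  have := kp u; move: v0; set a := fform k u u; set b := fform k u v => -> a0 hh.
  by have := sqr_ge0 b; nra.
have vp : 0 < fform k v v by rewrite lt_neqAle eq_sym v0 kp.
rewrite -subr_ge0 -(pmulr_rge0 _ vp).
by apply: le_trans (h (fform k v v) (- fform k u v)) _; rewrite le_eqVlt;
  apply/orP; left; apply/eqP; ring.
Qed.

End any_type.

Section push.
Context (T S : Type).
Implicit Types (h : T -> S).

Definition fpush h (u : seq (R * T)) : seq (R * S) :=
  [seq (a.1, h a.2) | a <- u].

Lemma ev_fpush h L u : ev L (fpush h u) = ev (fun x => L (h x)) u.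
Proof. by rewrite /ev big_map. Qed.

Lemma fform_fpush h h' k u v :
  fform k (fpush h u) (fpush h' v) = fform (fun x y => k (h x) (h' y)) u v.
Proof. by rewrite /fform ev_fpush; apply: eq_ev => x; rewrite ev_fpush. Qed.

End push.

(** Grouping equal points shows that the form is the squared l2-norm on [A] of
    the measure. *)
Lemma psd_diag (T : eqType) (A : pred T) :
  psd (fun x y : T => ((x == y) && A x)%:R : R).
Proof.
move=> u; set s := undup [seq a.2 | a <- u].
have -> : fform (fun x y : T => ((x == y) && A x)%:R : R) u u =
    \sum_(x <- s | A x) ev (fun y => (x == y)%:R) u ^+ 2.
  have us (F : T -> R) y : y \in s -> \sum_(x <- s) (x == y)%:R * F x = F y.
    move=> ys; rewrite (bigD1_seq y) ?undup_uniq //= eqxx mul1r big1 ?addr0 //.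
    by move=> i /negPf->; rewrite mul0r.
  rewrite fformE.
  transitivity (\sum_(a <- u) \sum_(b <- u) \sum_(x <- s)
      (x == a.2)%:R * ((A x)%:R * (a.1 * b.1 * (x == b.2)%:R))).
    rewrite !big_seq; apply: eq_bigr => a au; apply: eq_bigr => b _.
    rewrite (us (fun x => (A x)%:R * (a.1 * b.1 * (x == b.2)%:R))).
      by case: (A a.2); case: (a.2 == b.2); rewrite /= ?(mul1r, mul0r, mulr1, mulr0).
    by rewrite mem_undup map_f.
  under eq_bigr do rewrite exchange_big.
  rewrite exchange_big [RHS]big_mkcond; apply: eq_bigr => x _ /=.
  rewrite /ev expr2 big_distrlr /=.
  have [Ax|Ax] := boolP (A x).
    by apply: eq_bigr => a _; apply: eq_bigr => b _; rewrite mul1r; ring.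
  by rewrite big1 // => a _; rewrite big1 // => b _; rewrite mul0r mulr0.
by apply: sumr_ge0 => x _; exact: sqr_ge0.
Qed.

End formal_sums.

(** * The real Hilbert space of a positive semidefinite kernel *)
Section rkhs_def.
Context (R : realType) (T : choiceType) (k : T -> T -> R).

(** The Hilbert space of the kernel is realized as the space of the functions
    that are bounded, as linear functionals on formal sums, for the seminorm of
    the kernel. With the dual norm this space is complete, and there is neither
    a quotient nor a completion to form. *)
Definition fbounded : {pred T -> R} := fun F =>
  `[< exists C, forall u : seq (R * T), fform k u u <= 1 -> `|ev F u| <= C >].

Lemma fbounded_submod_closed : submod_closed fbounded.
Proof.
split=> [|r F F' /asboolP[C FC] /asboolP[D FD]]; apply/asboolP.
  exists 0 => u _; rewrite /ev big1 ?normr0 // => a _.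
  by rewrite /GRing.zero /= mulr0.
exists (`|r| * C + D) => u ku.
have -> : ev (r *: F + F') u = r * ev F u + ev F' u by rewrite -evZ -evD.
apply: le_trans (ler_normD _ _) _; rewrite normrM.
by apply: lerD; [apply: ler_wpM2l => //; exact: FC|exact: FD].
Qed.

HB.instance Definition _ := GRing.isSubmodClosed.Build R (T -> R)
  fbounded fbounded_submod_closed.

Record rkhs := RKHS { rk_fun :> T -> R ; _ : rk_fun \in fbounded }.

HB.instance Definition _ := [isSub for rk_fun].
HB.instance Definition _ := [Choice of rkhs by <:].
HB.instance Definition _ := [SubChoice_isSubLmodule of rkhs by <:].

Implicit Types (F : rkhs) (u : seq (R * T)).

Definition rk_norm F : R :=
  sup [set `|ev F u| | u in [set u | fform k u u <= 1]].

Lemma rk_norm_has_sup F :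
  has_sup [set `|ev F u| | u in [set u | fform k u u <= 1]].
Proof.
split; first by exists `|ev F [::]|, [::] => //=; rewrite /fform ev_nil.
have /asboolP[C FC] := valP F.
by exists C => _ [u ku <-]; exact: FC.
Qed.

Lemma rk_norm_ub F u : fform k u u <= 1 -> `|ev F u| <= rk_norm F.
Proof.
by move=> ku; apply: ub_le_sup; [case: (rk_norm_has_sup F)|exists u].
Qed.

Lemma rk_norm_le F c : (forall u, fform k u u <= 1 -> `|ev F u| <= c) ->
  rk_norm F <= c.
Proof.
move=> Fc; apply: ge_sup; first by case: (rk_norm_has_sup F).
by move=> _ [u ku <-]; exact: Fc.
Qed.

Lemma rk_norm_ge0 F : 0 <= rk_norm F.
Proof.
apply: le_trans (normr_ge0 (ev F [::])) (rk_norm_ub _ _).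
by rewrite /fform ev_nil.
Qed.

Lemma ev_rkD F F' u : ev (F + F') u = ev F u + ev F' u.
Proof. by rewrite -evD. Qed.

Lemma ev_rkZ c F u : ev (c *: F) u = c * ev F u.
Proof. by rewrite -evZ. Qed.

Lemma rk_normD F F' : rk_norm (F + F') <= rk_norm F + rk_norm F'.
Proof.
apply: rk_norm_le => u ku; rewrite ev_rkD.
by apply: le_trans (ler_normD _ _) _; apply: lerD; exact: rk_norm_ub.
Qed.

Lemma rk_normZ_le c F : rk_norm (c *: F) <= `|c| * rk_norm F.
Proof.
apply: rk_norm_le => u ku; rewrite ev_rkZ normrM.
by apply: ler_wpM2l => //; exact: rk_norm_ub.
Qed.

Lemma rk_normZ c F : rk_norm (c *: F) = `|c| * rk_norm F.
Proof.
apply/le_anti/andP; split; first exact: rk_normZ_le.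
have [->|c0] := eqVneq c 0; first by rewrite normr0 mul0r rk_norm_ge0.
rewrite -ler_pdivlMl ?normr_gt0 // -normfV -[in leLHS](scalerK c0 F).
exact: rk_normZ_le.
Qed.

(* Any point mass, suitably scaled, lies in the unit ball of the form. *)
Lemma point_small x : exists2 s : R, 0 < s & fform k [:: (s, x)] [:: (s, x)] <= 1.
Proof.
pose s := (Num.max 1 (k x x))^-1.
have m1 : 1 <= Num.max 1 (k x x) by rewrite le_max lexx.
have s0 : 0 < s by rewrite invr_gt0 (lt_le_trans ltr01).
exists s => //; rewrite fformE !big_seq1 /=.
have s1 : s <= 1 by rewrite invf_le1 // (lt_le_trans ltr01).
have : s * k x x <= 1.
  by rewrite /s mulrC ler_pdivrMr ?mul1r ?le_max ?lexx ?orbT // (lt_le_trans ltr01).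
by move: s0 s1; nra.
Qed.

Lemma rk_point x : exists2 s : R, 0 < s & forall F, s * `|F x| <= rk_norm F.
Proof.
have [s s0 sx] := point_small x; exists s => // F.
have := rk_norm_ub F sx.
by rewrite /ev big_seq1 /= normrM (gtr0_norm s0).
Qed.

Lemma rk_norm0_eq0 F : rk_norm F = 0 -> F = 0.
Proof.
move=> F0; apply/val_inj/funext => x /=.
have [s s0 /(_ F)] := rk_point x; rewrite F0 pmulr_rle0 // normr_le0.
by move=> /eqP.
Qed.

HB.instance Definition _ := Lmodule_isNormed.Build R rkhs
  rk_normD rk_normZ rk_norm0_eq0.

Lemma rk_normE F : `|F| = rk_norm F. Proof. by []. Qed.

(** Point evaluations are continuous, so a Cauchy filter has a pointwise limit,
    and the bounds that define the norm pass to it. *)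
Lemma rkhs_complete (U : set_system rkhs) : ProperFilter U -> cauchy U -> cvg U.
Proof.
move=> PU cU.
have cUx x : cvg ((fun F : rkhs => F x) @ U).
  apply: R_complete; apply/cauchy_ballP => e e0.
  have [s s0 sx] := rk_point x.
  have /cauchy_ballP /(_ (s * e)) := cU.
  rewrite mulr_gt0 // => /(_ isT) [[A B] [/= UA UB] AB].
  exists ((fun F : rkhs => F x) @` A, (fun F : rkhs => F x) @` B).
    by split; [apply: filterS UA|apply: filterS UB] => F ?; exists F.
  move=> [_ _] [/= [F AF <-] [F' BF' <-]].
  have := AB (F, F') (conj AF BF'); rewrite /= -!ball_normE /=.
  rewrite -[ltLHS]/(rk_norm _) => FF'.
  by have := le_lt_trans (sx (F - F')) FF'; rewrite ltr_pM2l.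
pose f x := lim ((fun F : rkhs => F x) @ U).
have cUev u : (fun F : rkhs => ev F u) @ U --> ev f u.
  elim: u => [|a u IH].
    rewrite ev_nil (_ : (fun _ => _) = fun=> 0); first exact: cvg_cst.
    by apply/funext => F; rewrite ev_nil.
  rewrite ev_cons (_ : (fun _ => _) = fun F : rkhs => a.1 * F a.2 + ev F u).
    by apply: cvgD IH; apply: cvgM; [exact: cvg_cst|exact: cUx].
  by apply/funext => F; rewrite ev_cons.
have near_f (e : R) : 0 < e -> \forall F \near U,
    forall u, fform k u u <= 1 -> `|ev (F : rkhs) u - ev f u| <= e.
  move=> e0; have /cauchy_ballP /(_ e e0) [[A B] [/= UA UB] AB] := cU.
  apply: filterS UA => F AF u ku.
  have cd : (fun F' : rkhs => `|ev F u - ev F' u|) @ U --> `|ev F u - ev f u|.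
    by apply: cvg_norm; apply: cvgB; [exact: cvg_cst|exact: cUev].
  rewrite -(cvg_lim _ cd) //; apply: limr_le; first by apply/cvg_ex; exists (`|ev F u - ev f u|).
  apply: filterS UB => F' BF'; have := AB (F, F') (conj AF BF').
  rewrite /= -ball_normE /= => /ltW; apply: le_trans.
  by rewrite -evB; exact: (@rk_norm_ub (F - F')).
have bf : f \in fbounded.
  have [F nF] := filter_ex (near_f 1 ltr01).
  apply/asboolP; exists (rk_norm F + 1) => u ku.
  rewrite -[ev f u](subrK (ev F u)) addrC; apply: le_trans (ler_normD _ _) _.
  by apply: lerD; [exact: rk_norm_ub|rewrite distrC; exact: nF].
apply/cvg_ex; exists (RKHS bf); apply/cvgrPdist_le => e e0.
apply: filterS (near_f e e0) => F nF; rewrite distrC; apply: rk_norm_le => u ku.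
by have := nF u ku; rewrite -evB.
Qed.

HB.instance Definition _ := Uniform_isComplete.Build rkhs rkhs_complete.

End rkhs_def.

Section jordan_von_neumann.
Context (R : realType) (V : normedModType R).
Hypothesis parallelogram : forall x y : V,
  `|x + y| ^+ 2 + `|x - y| ^+ 2 = 2 * (`|x| ^+ 2 + `|y| ^+ 2).

Definition polar (x y : V) : R := (`|x + y| ^+ 2 - `|x - y| ^+ 2) / 4.

Lemma polarC x y : polar x y = polar y x.
Proof. by rewrite /polar [x + y]addrC distrC. Qed.

Lemma polarNl x y : polar (- x) y = - polar x y.
Proof.
rewrite /polar -[`|- x + y|]normrN opprD opprK -[`|- x - y|]normrN opprD !opprK.
by ring.
Qed.

Lemma polarDl x y z : polar (x + y) z = polar x z + polar y z.
Proof.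
have h a b c : polar (a + b) c + polar (a - b) c = 2 * polar a c.
  have := parallelogram (a + c) b; have := parallelogram (a - c) b.
  rewrite /polar (addrAC a c b) (addrAC a (- c) b) (addrAC a c) (addrAC a (- c)).
  by lra.
have := h x y z; have := h y x z; rewrite (addrC y x) -(opprB x y) polarNl; lra.
Qed.

Lemma polar_bound x y : `|polar x y| <= `|x| * `|y|.
Proof.
have h (u v w : R) : `|u - v| <= w -> w <= u + v -> 0 <= u -> 0 <= v ->
    (u - v) ^+ 2 <= w ^+ 2 <= (u + v) ^+ 2.
  move=> uvw wuv u0 v0; apply/andP; split.
    by rewrite -[leLHS]real_normK ?num_real // lerXn2r ?nnegrE // (le_trans _ uvw).
  by rewrite lerXn2r ?nnegrE ?addr_ge0 // (le_trans _ uvw).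
have h1 : `| `|x| - `|y| | <= `|x + y|.
  by have := ler_dist_dist x (- y); rewrite normrN opprK.
have /andP[] := h _ _ _ h1 (ler_normD x y) (normr_ge0 _) (normr_ge0 _).
have /andP[] := h _ _ _ (ler_dist_dist x y) (ler_normB x y)
  (normr_ge0 _) (normr_ge0 _).
rewrite /polar ler_norml; set a := `|x|; set b := `|y|; set p := `|x + y| ^+ 2.
by set q := `|x - y| ^+ 2; lra.
Qed.

Lemma polarxx x : polar x x = `|x| ^+ 2.
Proof.
rewrite /polar subrr normr0 -mulr2n -scaler_nat normrZ exprMn.
by rewrite (ger0_norm (ler0n _ 2)) expr0n subr0; lra.
Qed.

End jordan_von_neumann.

(** The deviation [h t - t h 1] is additive and vanishes on the integers, so it
    is bounded by its values on the unit interval; being additive and bounded,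
    it vanishes. *)
Lemma additive_bounded_linear (R : realType) (h : R -> R) (C : R) :
  (forall s t, h (s + t) = h s + h t) -> (forall t, `|h t| <= C * `|t|) ->
  forall t, h t = t * h 1.
Proof.
move=> hD hC t.
pose d s := h s - s * h 1.
have dD s s' : d (s + s') = d s + d s' by rewrite /d hD; ring.
have d1 : d 1 = 0 by rewrite /d mul1r subrr.
have dM n s : d (n%:R * s) = n%:R * d s.
  elim: n => [|n IH]; last by rewrite -natr1 !mulrDl !mul1r dD IH.
  by have := dD 0 0; rewrite !mul0r addr0; lra.
have dN s : d (- s) = - d s.
  by have := dD s (- s); rewrite subrr; have := dM 0 s; rewrite !mul0r; lra.
have dz (z : int) : d z%:~R = 0.
  case: z => n; last rewrite NegzE rmorphN /= dN; rewrite -[_%:~R]mulr1 dM d1.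
    by rewrite mulr0.
  by rewrite mulr0 oppr0.
pose D := `|C| + `|h 1|.
have dle s : `|s| <= 1 -> `|d s| <= D.
  move=> s1; apply: le_trans (ler_normB _ _) _; rewrite normrM; apply: lerD.
    apply: le_trans (hC s) _; apply: le_trans (ler_norm _) _.
    by rewrite normrM normr_id ler_piMr.
  by rewrite ler_piMl.
have dn n s : n%:R * `|d s| <= D.
  have -> : n%:R * `|d s| = `|d (n%:R * s - (Num.floor (n%:R * s))%:~R)|.
    by rewrite dD dN dz oppr0 addr0 dM normrM normr_nat.
  apply: dle; have /andP[a b] := floor_itv (n%:R * s).
  rewrite ger0_norm ?subr_ge0 // lerBlDl; apply: le_trans (ltW b) _.
  by rewrite intrD addrC.
have d0 : d t = 0.
  apply/eqP; rewrite -normr_le0 leNgt; apply/negP => dt0.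
  have := dn (Num.bound (D / `|d t|)) t; apply/negP; rewrite -ltNge.
  rewrite -ltr_pdivrMr //; apply: archi_boundP.
  by rewrite divr_ge0 // addr_ge0.
by move: d0; rewrite /d; lra.
Qed.

Lemma le_of_le_addMeps (R : realType) (a b N : R) : 0 <= N ->
  (forall e, 0 < e -> a <= b + N * e) -> a <= b.
Proof.
move=> N0 h; apply/ler_addgt0Pr => e e0.
have N1 : 0 < N + 1 by rewrite ltr_wpDl.
apply: le_trans (h (e / (N + 1)) _) _; first by rewrite divr_gt0.
by rewrite lerD2l mulrCA ger_pMr // ler_pdivrMr // mul1r lerDl.
Qed.

Section rkhs_hilbert.
Context (R : realType) (T : choiceType) (k : T -> T -> R).
Hypotheses (kpos : psd k) (ksym : forall x y, k x y = k y x).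
Implicit Types (F : rkhs k) (u v : seq (R * T)).

Lemma rk_ev_le F u : ev F u ^+ 2 <= `|F| ^+ 2 * fform k u u.
Proof.
apply: (@le_of_le_addMeps _ _ _ (`|F| ^+ 2)); first exact: sqr_ge0.
move=> e e0; rewrite -mulrDr; set c := fform k u u.
have c0 : 0 < c + e by rewrite ltr_wpDl // kpos.
pose s := (Num.sqrt (c + e))^-1.
have s0 : 0 < s by rewrite invr_gt0 sqrtr_gt0.
have s2 : s ^+ 2 * (c + e) = 1.
  by rewrite exprVn sqr_sqrtr ?ltW // mulVf // gt_eqF.
have su : fform k (fscale s u) (fscale s u) <= 1.
  rewrite fform_scalel fform_scaler mulrA -expr2 -/c -s2.
  by rewrite ler_wpM2l ?sqr_ge0 // lerDl ltW.
have := rk_norm_ub F su; rewrite ev_fscale normrM (gtr0_norm s0) -rk_normE => h.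
have : (s * `|ev F u|) ^+ 2 <= `|F| ^+ 2.
  by rewrite lerXn2r ?nnegrE // mulr_ge0 // ltW.
rewrite exprMn real_normK ?num_real // => h2.
have := ler_wpM2r (ltW c0) h2.
by rewrite mulrAC s2 mul1r.
Qed.

Lemma rk_ev_amgm F u : ev F u <= `|F| ^+ 2 + fform k u u / 4.
Proof.
have := rk_ev_le F u; have := kpos u; have := sqr_ge0 `|F|.
set p := ev F u; set q := `|F| ^+ 2; set r := fform k u u => q0 r0 pqr.
rewrite leNgt; apply/negP => h.
by have := sqr_ge0 (q - r / 4); nra.
Qed.

Lemma rk_norm_le_ev F c : (forall u, fform k u u <= 1 -> ev F u <= c) -> `|F| <= c.
Proof.
move=> h; apply: rk_norm_le => u u1; rewrite ler_norml h // andbT.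
rewrite lerNl -mulN1r -ev_fscale; apply: h.
by rewrite fform_scalel fform_scaler mulrA mulN1r opprK mul1r.
Qed.

(** The opposite inequality follows by applying this one to the sum and the
    difference, so the dual norm is Euclidean because the seminorm of the kernel
    is. *)
Lemma rk_parallelogram_le F F' :
  `|F + F'| ^+ 2 + `|F - F'| ^+ 2 <= 2 * (`|F| ^+ 2 + `|F'| ^+ 2).
Proof.
(* Test F + F' and F - F' against nearly optimal u and v of the unit ball and
   regroup: a (F + F')(u) + b (F - F')(v) = F (a u + b v) + F' (a u - b v). *)
set a := `|F + F'|; set b := `|F - F'|; set P := `|F| ^+ 2 + `|F'| ^+ 2.
have [a0 b0] : 0 <= a /\ 0 <= b by rewrite /a /b !normr_ge0.
have key u v : fform k u u <= 1 -> fform k v v <= 1 ->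
    a * ev (F + F') u + b * ev (F - F') v <= P + (a ^+ 2 + b ^+ 2) / 2.
  move=> u1 v1.
  set x := fscale a u; set y := fscale b v.
  have -> : a * ev (F + F') u + b * ev (F - F') v =
      ev F (x ++ y) + ev F' (fsub x y).
    rewrite ev_fsub ev_cat !ev_fscale !ev_rkD -scaleN1r ev_rkZ; ring.
  have h1 := rk_ev_amgm F (x ++ y); have h2 := rk_ev_amgm F' (fsub x y).
  have h3 := fform_parallelogram k x y.
  have hx : fform k x x <= a ^+ 2.
    by rewrite fform_scalel fform_scaler mulrA -expr2 ler_piMr // sqr_ge0.
  have hy : fform k y y <= b ^+ 2.
    by rewrite fform_scalel fform_scaler mulrA -expr2 ler_piMr // sqr_ge0.
  by rewrite /P; lra.
suff : a * a + b * b <= P + (a ^+ 2 + b ^+ 2) / 2 by lra.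
have Z (c : R) F0 : 0 <= c -> c * `|F0| = `|c *: F0|.
  by move=> c0; rewrite normrZ ger0_norm.
rewrite -lerBrDr {2}/a Z //; apply: rk_norm_le_ev => u u1.
rewrite lerBrDr addrC -lerBrDr {2}/b Z //; apply: rk_norm_le_ev => v v1.
by rewrite !ev_rkZ lerBrDr addrC; exact: key.
Qed.

Lemma rk_parallelogram F F' :
  `|F + F'| ^+ 2 + `|F - F'| ^+ 2 = 2 * (`|F| ^+ 2 + `|F'| ^+ 2).
Proof.
apply/le_anti/andP; split; first exact: rk_parallelogram_le.
have := rk_parallelogram_le (F + F') (F - F').
have -> : F + F' + (F - F') = (2 : R) *: F.
  by rewrite addrACA subrr addr0 scaler_nat mulr2n.
have -> : F + F' - (F - F') = (2 : R) *: F'.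
  by rewrite opprB addrC addrA subrK scaler_nat mulr2n.
by rewrite !normrZ (ger0_norm (ler0n _ 2)) !exprMn; lra.
Qed.

(** The parallelogram law gives additivity, and the bound on [polar] turns it into
    homogeneity. *)
Lemma polar_linear F' : linear_for *%R (fun F => polar F F').
Proof.
move=> c F F0; rewrite polarDl; last exact: rk_parallelogram.
congr (_ + _).
rewrite -[in RHS](scale1r F).
apply: (additive_bounded_linear (h := fun c => polar (c *: F) F')
  (C := `|F| * `|F'|)).
  by move=> s t; rewrite scalerDl polarDl //; exact: rk_parallelogram.
move=> t; apply: le_trans (polar_bound _ _) _.
by rewrite normrZ; nra.
Qed.

Definition rk_inner (F F' : rkhs k) : R := polar F F'.

Lemma rk_inner_bilinear :
  bilinear_for (R := R) (U := rkhs k) (U' := rkhs k) *%R (idfun \; *%R) rk_inner.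
Proof.
split => F'; first exact: polar_linear.
by move=> c F F0; rewrite /rk_inner !(polarC F'); exact: polar_linear.
Qed.

Lemma rk_inner_hermitian F F' : rk_inner F F' = (-1) ^+ false * idfun (rk_inner F' F).
Proof. by rewrite expr0 mul1r /=; exact: polarC. Qed.

Lemma rk_inner_pos F : F != 0 -> 0 < rk_inner F F.
Proof. by move=> F0; rewrite /rk_inner polarxx exprn_gt0 // normr_gt0. Qed.

Definition rk_dot : {dot (rkhs k) for idfun} :=
  HB.pack rk_inner
   (bilinear_isBilinear.Build R (rkhs k) (rkhs k) R *%R (idfun \; *%R) rk_inner rk_inner_bilinear)
   (isHermitianSesquilinear.Build R (rkhs k) false idfun rk_inner rk_inner_hermitian)
   (isDotProduct.Build R (rkhs k) rk_inner rk_inner_pos).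

Lemma rk_norm_inner F : `|F| ^+ 2 = rk_dot F F.
Proof. by rewrite /= /rk_inner polarxx. Qed.

Definition rk_hilbert : realHilbertSpace R := RealHilbertSpace rk_norm_inner.

Definition rk_vec_fun u : T -> R := fun x => ev (k x) u.

Lemma rk_vec_bounded u : rk_vec_fun u \in fbounded k.
Proof.
apply/asboolP; exists (Num.sqrt (fform k u u)) => v v1.
rewrite -sqrtr_sqr ler_wsqrtr //.
apply: le_trans (fform_CauchySchwarz v u kpos ksym) _.
by rewrite ler_piMl // kpos.
Qed.

Definition rk_vec u : rkhs k := RKHS (rk_vec_bounded u).

Lemma ev_rk_vec u v : ev (rk_vec u) v = fform k v u. Proof. by []. Qed.

Lemma rk_vec_norm u : `|rk_vec u| ^+ 2 = fform k u u.
Proof.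
apply/le_anti/andP; split.
  rewrite -[leRHS]sqr_sqrtr ?kpos // lerXn2r ?nnegrE ?sqrtr_ge0 //.
  apply: rk_norm_le => v v1; rewrite -sqrtr_sqr ler_wsqrtr //.
  apply: le_trans (fform_CauchySchwarz v u kpos ksym) _.
  by rewrite ler_piMl // kpos.
have := rk_ev_le (rk_vec u) u; rewrite ev_rk_vec.
have [u0 _|u0] := leP (fform k u u) 0; first exact: le_trans (sqr_ge0 _).
by rewrite expr2 ler_pM2r.
Qed.

Lemma rk_vec_inner u v : rk_dot (rk_vec u) (rk_vec v) = fform k u v.
Proof.
rewrite /= /rk_inner /polar.
have -> : rk_vec u + rk_vec v = rk_vec (u ++ v).
  by apply/val_inj/funext => x /=; rewrite /rk_vec_fun ev_cat.
have -> : rk_vec u - rk_vec v = rk_vec (fsub u v).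
  by apply/val_inj/funext => x /=; rewrite /rk_vec_fun ev_fsub.
rewrite !rk_vec_norm !(fform_catl, fform_catr, fform_subl, fform_subr).
by rewrite (fform_sym ksym v u); field.
Qed.

End rkhs_hilbert.

(** * The real Gelfand-Naimark-Segal construction *)
Section gns.
Context (R : realType) (G : groupType) (b : G -> R).
Let k (x y : G) : R := b (y^-1 * x)%g.
Hypotheses (bpos : psd k) (bsym : forall x, b x^-1%g = b x).

Let ksym x y : k x y = k y x.
Proof. by rewrite /k -bsym invgM invgK. Qed.

Let kinv g x y : k (g * x)%g (g * y)%g = k x y.
Proof. by rewrite /k invgM -mulgA mulKg. Qed.

Let translate_bounded g (F : rkhs k) : (fun x => F (g^-1 * x)%g) \in fbounded k.
Proof.
apply/asboolP; exists `|F| => u u1.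
rewrite -(ev_fpush (fun x => g^-1 * x)%g F); apply: rk_norm_ub.
rewrite fform_fpush; apply: le_trans u1; rewrite le_eqVlt; apply/orP; left.
by apply/eqP/eq_fform => x y; exact: kinv.
Qed.

Let translate g (F : rkhs k) : rkhs k := RKHS (translate_bounded g F).

Let translate_linear g : linear (translate g).
Proof. by move=> c F F'; exact/val_inj. Qed.

Let pi (g : G) : {linear rkhs k -> rkhs k} :=
  HB.pack (translate g) (GRing.isLinear.Build R (rkhs k) (rkhs k) *:%R (translate g)
    (translate_linear g)).

Let translate_norm_le g F : `|pi g F| <= `|F|.
Proof.
apply: rk_norm_le => u u1.
rewrite -[ev _ _](ev_fpush (fun x => g^-1 * x)%g F); apply: rk_norm_ub.
rewrite fform_fpush; apply: le_trans u1; rewrite le_eqVlt; apply/orP; left.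
by apply/eqP/eq_fform => x y; exact: kinv.
Qed.

Let piM g g' F : pi (g * g')%g F = pi g (pi g' F).
Proof. by apply/val_inj/funext => x /=; rewrite invgM mulgA. Qed.

Let pi1 F : pi 1%g F = F.
Proof. by apply/val_inj/funext => x /=; rewrite invg1 mul1g. Qed.

Let pi_norm g F : `|pi g F| = `|F|.
Proof.
apply/le_anti/andP; split; first exact: translate_norm_le.
by rewrite -[in leLHS](pi1 F) -(mulVg g) piM translate_norm_le.
Qed.

(** Left translations preserve the kernel, so they act isometrically on the
    Hilbert space of the kernel; the cyclic vector is the point mass at the
    identity. *)
Lemma real_gns : exists (H : realHilbertSpace R) (pi : G -> {linear H -> H})
    (xi : H), orthogonal_rep pi /\ forall x, inner H (pi x xi) xi = b x.
Proof.
exists (rk_hilbert bpos), pi, (rk_vec bpos ksym [:: (1, 1%g)]); split.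
  split; [exact: pi1|exact: piM|].
  move=> g F F'; rewrite -[LHS]/(polar (pi g F) (pi g F')).
  by rewrite -[RHS]/(polar F F') /polar -linearD -linearB !pi_norm.
move=> x.
rewrite [X in inner _ X _](_ : _ = rk_vec bpos ksym [:: (1, x)]).
  rewrite /inner [LHS]rk_vec_inner fformE !big_seq1 /= /k invg1 mul1g; ring.
apply/val_inj/funext => y /=.
by rewrite /rk_vec_fun /ev !big_seq1 /= /k invg1 mul1g -bsym invgM invgK.
Qed.

End gns.

(** * Hahn-Banach in finite dimension *)
Section sublinear.
Context (R : realType) (V : vectType R).
Implicit Types (q : V -> R) (a u v : V).

Definition sublinear q : Prop :=
  (forall u v, q (u + v) <= q u + q v) /\
  (forall c v, 0 < c -> q (c *: v) <= c * q v).

Lemma sublinearZ q c v : sublinear q -> 0 < c -> q (c *: v) = c * q v.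
Proof.
move=> [_ qZ] c0; apply/le_anti/andP; split; first exact: qZ.
by rewrite -ler_pdivlMl // -[in leLHS](scalerK (lt0r_neq0 c0) v) qZ ?invr_gt0.
Qed.

Lemma sublinear0 q : sublinear q -> q 0 = 0.
Proof.
move=> sq; have := sublinearZ 0 sq (ltr0Sn R 1); rewrite scaler0; lra.
Qed.

Lemma sublinear_sym_ge0 q v : sublinear q -> 0 <= q v + q (- v).
Proof.
by move=> sq; rewrite -[leLHS](sublinear0 sq) -(subrr v); exact: sq.1.
Qed.

(** The infimum of [q (v + t a) - t q a] over [t >= 0] is sublinear in [v], lies
    below [q], and is at most [- q a] at [- a]. *)
Lemma sublinear_step q a : sublinear q -> exists q',
  [/\ sublinear q', forall v, q' v <= q v & q' a + q' (- a) <= 0].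
Proof.
move=> sq.
pose A v := [set q (v + t *: a) - t * q a | t in [set t : R | 0 <= t]].
have qta t : 0 <= t -> t * q a = q (t *: a).
  rewrite le_eqVlt => /predU1P[<-|t0]; last by rewrite sublinearZ.
  by rewrite mul0r scale0r sublinear0.
have lbA v : lbound (A v) (- q (- v)).
  move=> _ [t /= t0 <-]; rewrite lerBrDl qta //.
  have := sq.1 (v + t *: a) (- v); rewrite addrAC subrr add0r; lra.
have Av v t : 0 <= t -> inf (A v) <= q (v + t *: a) - t * q a.
  by move=> t0; apply: ge_inf; [exists (- q (- v)); exact: lbA|exists t].
have A0 v : (A v) !=set0.
  by exists (q (v + 0 *: a) - 0 * q a); exists 0 => //=.
have infle v c : (forall t, 0 <= t -> c <= q (v + t *: a) - t * q a) ->
    c <= inf (A v).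
  by move=> h; apply: lb_le_inf => // _ [t t0 <-]; exact: h.
exists (fun v => inf (A v)); split.
- split=> [u v|c v c0].
    rewrite -lerBlDr; apply: (infle) => t t0.
    rewrite lerBlDr -lerBlDl; apply: (infle) => s s0.
    rewrite lerBlDl; apply: le_trans (Av _ (t + s) (addr_ge0 t0 s0)) _.
    have := sq.1 (u + t *: a) (v + s *: a).
    by rewrite addrACA -scalerDl mulrDl; lra.
  rewrite -ler_pdivrMl //; apply: (infle) => t t0.
  rewrite ler_pdivrMl //; apply: le_trans (Av _ (c * t) _) _.
    by rewrite mulr_ge0 // ltW.
  by rewrite -scalerA -scalerDr sublinearZ // mulrBr mulrA.
- by move=> v; have := Av v 0 (lexx 0); rewrite scale0r addr0 mul0r subr0.
- have h1 := Av a 0 (lexx 0); have h2 := Av (- a) 1 ler01.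
  move: h1 h2; rewrite scale0r addr0 mul0r subr0 scale1r addNr sublinear0 //.
  lra.
Qed.

Lemma sublinear_steps q (l : seq V) : sublinear q -> exists q',
  [/\ sublinear q', forall v, q' v <= q v
    & forall a, a \in l -> q' a + q' (- a) <= 0].
Proof.
move=> sq; elim: l => [|a l [q1 [sq1 q1q q1l]]]; first by exists q.
have [q2 [sq2 q21 q2a]] := sublinear_step a sq1.
exists q2; split=> // [v|b]; first exact: le_trans (q21 v) (q1q v).
rewrite inE => /predU1P[->//|bl].
exact: le_trans (lerD (q21 b) (q21 (- b))) (q1l _ bl).
Qed.

(** Lowering a sublinear functional along one direction after the other makes
    it odd on a spanning family, hence linear. *)
Lemma linear_below_sublinear q : sublinear q ->
  exists L : V -> R, [/\ forall u v, L (u + v) = L u + L v,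
    forall c v, L (c *: v) = c * L v & forall v, L v <= q v].
Proof.
move=> sq; have [L [sL Lq Ll]] := sublinear_steps (vbasis fullv) sq.
have LZ a c : L a + L (- a) <= 0 -> L (c *: a) + L (- (c *: a)) <= 0.
  move=> La; have [c0|c0|->] := ltgtP c 0.
  - rewrite -scaleNr (_ : c *: a = (- c) *: (- a)).
      rewrite !(sublinearZ _ sL) ?oppr_gt0 // -mulrDr addrC.
      by rewrite pmulr_rle0 // oppr_gt0.
    by rewrite scaleNr scalerN opprK.
  - by rewrite -scalerN !(sublinearZ _ sL) // -mulrDr pmulr_rle0.
  - by rewrite scale0r oppr0 sublinear0 // addr0.
have Lodd v : L v + L (- v) <= 0.
  rewrite (coord_vbasis (memvf v)).
  elim/big_rec: _ => [|i w _ IH]; first by rewrite oppr0 sublinear0 // addr0.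
  set a := (vbasis fullv)`_i; set c := coord _ i v.
  have al : a \in vbasis fullv by rewrite mem_nth // size_tuple.
  have h1 := sL.1 (c *: a) w; have h2 := sL.1 (- (c *: a)) (- w).
  by rewrite opprD; have := LZ a c (Ll a al); lra.
have LN v : L (- v) = - L v.
  by have := Lodd v; have := sublinear_sym_ge0 v sL; lra.
exists L; split=> //.
  move=> u v; apply/le_anti/andP; split; first exact: sL.1.
  by have := sL.1 (- u) (- v); rewrite -opprD !LN; lra.
move=> c v; have [c0|c0|->] := ltgtP c 0.
- by rewrite -[c *: v]opprK -scaleNr LN sublinearZ ?oppr_gt0 // mulNr opprK.
- exact: sublinearZ.
- by rewrite scale0r sublinear0 // mul0r.
Qed.

End sublinear.

(** * Jordan decomposition of a contractive Schur multiplier *)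
Section schur_jordan.
Context (R : realType) (n : nat).
Implicit Types (H P Q M : 'M[R]_n) (f g v : 'I_n -> R) (d e : 'I_n -> R).

Definition bil M g f : R := \sum_i \sum_j g i * M i j * f j.

Definition nrm2 f : R := \sum_i f i ^+ 2.

(** For a matrix this means operator norm at most 1; the additive form is linear
    in [M] and needs no square roots. *)
Definition mx_contractive M : Prop :=
  forall f g, bil M g f <= (nrm2 f + nrm2 g) / 2.

Lemma bilD M M' g f : bil (M + M') g f = bil M g f + bil M' g f.
Proof.
rewrite /bil -big_split; apply: eq_bigr => i _; rewrite -big_split.
by apply: eq_bigr => j _ /=; rewrite mxE; ring.
Qed.

Lemma bilZ c M g f : bil (c *: M) g f = c * bil M g f.
Proof.
rewrite /bil mulr_sumr; apply: eq_bigr => i _; rewrite mulr_sumr.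
by apply: eq_bigr => j _ /=; rewrite mxE; ring.
Qed.

Lemma bilN M g f : bil (- M) g f = - bil M g f.
Proof. by rewrite -scaleN1r bilZ mulN1r. Qed.

Lemma bil_bound M : exists2 c, 0 <= c &
  forall v, `|bil M v v| <= c * nrm2 v.
Proof.
exists (\sum_i \sum_j `|M i j|).
  by apply: sumr_ge0 => i _; apply: sumr_ge0.
move=> v; rewrite /bil mulr_suml.
apply: le_trans (ler_norm_sum _ _ _) _; apply: ler_sum => i _.
rewrite mulr_suml.
apply: le_trans (ler_norm_sum _ _ _) _; apply: ler_sum => j _.
have le1 k : v k ^+ 2 <= nrm2 v.
  rewrite /nrm2 (bigD1 k) //= lerDl; apply: sumr_ge0 => ? _; exact: sqr_ge0.
have -> : `|v i * M i j * v j| = `|M i j| * (`|v i| * `|v j|).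
  by rewrite !normrM; ring.
rewrite ler_wpM2l //.
have := le1 i; have := le1 j; rewrite -(real_normK (num_real (v i))).
rewrite -(real_normK (num_real (v j))).
by have := sqr_ge0 (`|v i| - `|v j|); nra.
Qed.

Variable (m : 'M[R]_n).
Hypothesis (msym : forall i j, m i j = m j i).
Hypothesis (schur_contractive : forall A : 'M[R]_n, mx_contractive A ->
  mx_contractive (\matrix_(i, j) (m i j * A i j))).

Let prg H : R := \sum_i \sum_j m i j * H i j.

Let prgD H H' : prg (H + H') = prg H + prg H'.
Proof.
rewrite /prg -big_split; apply: eq_bigr => i _; rewrite -big_split.
by apply: eq_bigr => j _ /=; rewrite mxE mulrDr.
Qed.

Let prgZ c H : prg (c *: H) = c * prg H.
Proof.
rewrite /prg mulr_sumr; apply: eq_bigr => i _; rewrite mulr_sumr.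
by apply: eq_bigr => j _ /=; rewrite mxE; ring.
Qed.

Let diagq d v : R := \sum_i d i * v i ^+ 2.

(** The pairing with [m] is the value of the Schur product on the vector of the
    square roots of [d], after the symmetric part of [H] has been divided by
    these square roots in the rows and in the columns; polarization bounds the normalized matrix. *)
Lemma prg_le_strict H d : (forall i, 0 < d i) ->
  (forall v, bil H v v <= diagq d v) -> (forall v, - bil H v v <= diagq d v) ->
  prg H <= \sum_i d i.
Proof.
move=> d0 hp hn.
pose r i := Num.sqrt (d i).
have r0 i : 0 < r i by rewrite sqrtr_gt0.
have r2 i : r i ^+ 2 = d i by rewrite sqr_sqrtr // ltW.
pose A := \matrix_(i, j) ((H i j + H j i) / 2 / (r i * r j)) : 'M[R]_n.
have cA : mx_contractive A.
  move=> f g; pose f' i := f i / r i; pose g' i := g i / r i.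
  have -> : bil A g f = (bil H (fun i => f' i + g' i) (fun i => f' i + g' i)
      - bil H (fun i => f' i - g' i) (fun i => f' i - g' i)) / 4.
    transitivity ((bil H g' f' + bil H f' g') / 2).
      rewrite /bil [X in _ + X]exchange_big -big_split mulr_suml.
      apply: eq_bigr => i _; rewrite -big_split mulr_suml.
      apply: eq_bigr => j _ /=; rewrite /A /f' /g' mxE; field.
      by rewrite !lt0r_neq0.
    rewrite /bil -!big_split mulr_suml -sumrB mulr_suml; apply: eq_bigr => i _.
    rewrite -big_split mulr_suml -sumrB mulr_suml; apply: eq_bigr => j _ /=.
    by field.
  have e v : diagq d (fun i => v i / r i) = nrm2 v.
    apply: eq_bigr => i _; rewrite exprMn exprVn r2 mulrCA mulfV ?mulr1 //.
    exact: lt0r_neq0.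
  have h1 := hp (fun i => f' i + g' i); have h2 := hn (fun i => f' i - g' i).
  have : diagq d (fun i => f' i + g' i) + diagq d (fun i => f' i - g' i) =
      2 * (nrm2 f + nrm2 g).
    rewrite -(e f) -(e g) /diagq mulrDr !mulr_sumr -!big_split.
    by apply: eq_bigr => i _ /=; rewrite /f' /g'; ring.
  lra.
have := schur_contractive cA r r.
have -> : bil (\matrix_(i, j) (m i j * A i j)) r r = prg H.
  transitivity ((prg H + \sum_i \sum_j m j i * H j i) / 2).
    rewrite /bil /prg -big_split mulr_suml; apply: eq_bigr => i _.
    rewrite -big_split mulr_suml; apply: eq_bigr => j _ /=.
    by rewrite !mxE (msym j i); field; rewrite !lt0r_neq0.
  by rewrite [X in _ + X]exchange_big /= -/(prg H); lra.
have -> : nrm2 r = \sum_i d i by apply: eq_bigr => i _; exact: r2.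
lra.
Qed.

Lemma prg_le H d :
  (forall v, bil H v v <= diagq d v) -> (forall v, - bil H v v <= diagq d v) ->
  prg H <= \sum_i d i.
Proof.
move=> hp hn.
have d0 i : 0 <= d i.
  have := hp (fun j => (j == i)%:R); have := hn (fun j => (j == i)%:R).
  have -> : diagq d (fun j => (j == i)%:R) = d i.
    rewrite /diagq (bigD1 i) //= eqxx expr1n mulr1 big1 ?addr0 // => j /negPf->.
    by rewrite expr0n mulr0.
  lra.
apply: (@le_of_le_addMeps _ _ _ n%:R) => // e e0.
have -> : \sum_i d i + n%:R * e = \sum_i (d i + e).
  by rewrite big_split /= sumr_const card_ord mulr_natl.
have le v : diagq d v <= diagq (fun i => d i + e) v.
  by apply: ler_sum => i _; rewrite ler_wpM2r ?sqr_ge0 // lerDl ltW.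
apply: prg_le_strict => [i|v|v]; first by rewrite ltr_wpDl.
  exact: le_trans (hp v) (le v).
exact: le_trans (hn v) (le v).
Qed.

(* The pairs (H, d) with d - P + H and d - Q - H positive, where d is diagonal;
   the optimal value of this programme is a sublinear function of (P, Q). *)
Let feasible (u : 'M[R]_n * 'M[R]_n) H d : Prop :=
  (forall v, bil (u.1 - H) v v <= diagq d v) /\
  (forall v, bil (u.2 + H) v v <= diagq d v).

Let value (u : 'M[R]_n * 'M[R]_n) : R :=
  inf [set prg x.1 + \sum_i x.2 i | x in [set x | feasible u x.1 x.2]].

(* The programme is bounded below because [m] is a contractive multiplier. *)
Let value_lb u : exists c, forall H d, feasible u H d ->
  - c <= prg H + \sum_i d i.
Proof.
have [c1 c10 hc1] := bil_bound u.1; have [c2 c20 hc2] := bil_bound u.2.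
exists (n%:R * (c1 + c2)) => H d [h1 h2].
pose e i := d i + (c1 + c2).
have he v : diagq e v = diagq d v + (c1 + c2) * nrm2 v.
  by rewrite /diagq /nrm2 mulr_sumr -big_split; apply: eq_bigr => i _ /=; rewrite mulrDl.
have n0 v : 0 <= nrm2 v by apply: sumr_ge0 => i _; exact: sqr_ge0.
have := @prg_le (- H) e.
have -> : \sum_i e i = \sum_i d i + n%:R * (c1 + c2).
  by rewrite big_split /= sumr_const card_ord mulr_natl.
rewrite -scaleN1r prgZ scaleN1r => h.
suff : -1 * prg H <= \sum_i d i + n%:R * (c1 + c2) by lra.
apply: h => v; rewrite he bilN ?opprK.
  have := h1 v; rewrite bilD bilN; have := hc1 v; rewrite ler_norml => /andP[+ _].
  by have := n0 v; nra.
have := h2 v; rewrite bilD; have := hc2 v; rewrite ler_norml => /andP[+ _].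
by have := n0 v; nra.
Qed.

Let value_le u H d : feasible u H d -> value u <= prg H + \sum_i d i.
Proof.
move=> f; apply: ge_inf; last by exists (H, d).
by have [c hc] := value_lb u; exists (- c) => _ [[H' d'] /= f' <-]; exact: hc.
Qed.

Let value_ge u c : (forall H d, feasible u H d -> c <= prg H + \sum_i d i) ->
  c <= value u.
Proof.
move=> h; apply: lb_le_inf; last by move=> _ [[H' d'] /= f' <-]; exact: h.
have [c1 c10 hc1] := bil_bound u.1; have [c2 c20 hc2] := bil_bound u.2.
exists (prg 0 + \sum_(i < n) (c1 + c2)); exists (0, fun=> c1 + c2) => //=.
have n0 v : 0 <= nrm2 v by apply: sumr_ge0 => i _; exact: sqr_ge0.
have e v : diagq (fun=> c1 + c2) v = (c1 + c2) * nrm2 v.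
  by rewrite /diagq /nrm2 mulr_sumr.
split=> v; rewrite e /= ?subr0 ?addr0.
  have := hc1 v; rewrite ler_norml => /andP[_ +]; have := n0 v; nra.
have := hc2 v; rewrite ler_norml => /andP[_ +]; have := n0 v; nra.
Qed.

Let diagqD d d' v : diagq (fun i => d i + d' i) v = diagq d v + diagq d' v.
Proof.
by rewrite /diagq -big_split; apply: eq_bigr => i _ /=; rewrite mulrDl.
Qed.

Let diagqZ c d v : diagq (fun i => c * d i) v = c * diagq d v.
Proof. by rewrite /diagq mulr_sumr; apply: eq_bigr => i _; rewrite mulrA. Qed.

Let value_sublinear : sublinear value.
Proof.
split=> [u w|c u c0].
  rewrite -lerBlDr; apply: value_ge => H d [h1 h2].
  rewrite lerBlDr -lerBlDl; apply: value_ge => H' d' [h1' h2'].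
  rewrite lerBlDl.
  have -> : prg H + \sum_i d i + (prg H' + \sum_i d' i) =
      prg (H + H') + \sum_i (d i + d' i).
    by rewrite prgD big_split /=; ring.
  apply: value_le; split=> v; rewrite diagqD /=.
    by rewrite opprD addrACA bilD lerD.
  by rewrite addrACA bilD lerD.
rewrite -ler_pdivrMl //; apply: value_ge => H d [h1 h2].
rewrite ler_pdivrMl // mulrDr -prgZ mulr_sumr; apply: value_le.
split=> v; rewrite diagqZ /=.
  by rewrite -scalerBr bilZ ler_pM2l.
by rewrite -scalerDr bilZ ler_pM2l.
Qed.

(** A linear functional below the value of the programme is a solution of the
    dual one: positive functionals [P |-> L (P, 0)] and [Q |-> L (0, Q)], the
    matrices [b + m] and [b], whose difference is [m] and whose sum has diagonal
    1. *)
Lemma schur_jordan_decomposition : exists b : 'M[R]_n,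
  [/\ forall i j, b i j = b j i,
      forall i, 2 * b i i + m i i = 1,
      forall v, 0 <= bil b v v
    & forall v, 0 <= bil (b + m) v v].
Proof.
have [L [LD LZ Lle]] := linear_below_sublinear value_sublinear.
have L0 : L 0 = 0 by have := LD 0 0; rewrite addr0; lra.
have LN u : L (- u) = - L u.
  by have := LD u (- u); rewrite subrr L0; lra.
have Lsum (I : Type) (r : seq I) (F : I -> 'M[R]_n * 'M[R]_n) :
    L (\sum_(i <- r) F i) = \sum_(i <- r) L (F i).
  by elim/big_rec2: _ => // i x y _; rewrite LD => ->.
have feas0 u H : (forall v, bil (u.1 - H) v v <= 0) ->
    (forall v, bil (u.2 + H) v v <= 0) -> L u <= prg H.
  move=> h1 h2; apply: le_trans (Lle u) _.
  have -> : prg H = prg H + \sum_(i < n) 0 by rewrite big1_eq addr0.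
  have z v : diagq (fun=> 0) v = 0 by rewrite /diagq big1 // => j _; rewrite mul0r.
  by apply: value_le; split=> v; rewrite z.
have bil0 v : bil 0 v v = 0.
  by rewrite -{1}(scale0r (0 : 'M[R]_n)) bilZ mul0r.
have prg0 : prg 0 = 0.
  by rewrite -(scale0r (0 : 'M[R]_n)) prgZ mul0r.
(* The pairs (H, - H) and (D i, D i) and their opposites are feasible with
   explicit values, so [L] is known on them. *)
have Lm H : L (H, - H) = prg H.
  have le H' : L (H', - H') <= prg H'.
    by apply: feas0 => v /=; rewrite ?subrr ?addNr bil0.
  apply/le_anti; rewrite le /= -lerN2 -LN -[- prg H]mulN1r -prgZ scaleN1r.
  exact: (le (- H)).
pose D i : 'M[R]_n := delta_mx i i.
have bilD0 i v : bil (D i) v v = v i ^+ 2.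
  rewrite /bil (bigD1 i) //= (bigD1 i) //= !mxE !eqxx big1 ?big1 => [|j /negPf ji|j /negPf ji].
  - by rewrite mulr1 !addr0 expr2.
  - by rewrite big1 // => k _; rewrite mxE ji mulr0 mul0r.
  - by rewrite mxE ji andbF mulr0 mul0r.
have Ldiag i : L (D i, D i) = 1.
  have le (c : R) : L (c *: D i, c *: D i) <= c.
    apply: le_trans (Lle _) _.
    have -> : c = prg 0 + \sum_j c * (j == i)%:R.
      rewrite prg0 add0r (bigD1 i) //= eqxx mulr1 big1 ?addr0 // => j /negPf->.
      by rewrite mulr0.
    have e v : diagq (fun j => c * (j == i)%:R) v = c * v i ^+ 2.
      rewrite /diagq (bigD1 i) //= eqxx mulr1 big1 ?addr0 // => j /negPf->.
      by rewrite mulr0 mul0r.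
    apply: value_le; rewrite -[in prg 0 + _]/(prg 0) prg0 add0r.
    by split=> v; rewrite e /= ?subr0 ?addr0 bilZ bilD0;
      rewrite (bigD1 i) //= eqxx mulr1 big1 ?addr0 // => j /negPf->; rewrite mulr0.
  have h1 := le 1; have h2 := le (-1).
  have : L (- 1 *: D i, - 1 *: D i) = - L (D i, D i).
    by rewrite -LN; congr L; rewrite !scaleN1r.
  by rewrite scale1r in h1; lra.
(* A functional that is positive on positive matrices has a positive matrix: test
   it on matrices of rank one. *)
have Knn (K : 'M[R]_n -> R) : (forall M M', K (M + M') = K M + K M') ->
    (forall c M, K (c *: M) = c * K M) ->
    (forall M, (forall v, 0 <= bil M v v) -> 0 <= K M) ->
    forall v, 0 <= bil (\matrix_(i, j) ((K (delta_mx i j) + K (delta_mx j i)) / 2)) v v.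
  move=> KD KZ Kp v; pose vv := \matrix_(i, j) (v i * v j) : 'M[R]_n.
  have K0 : K 0 = 0 by rewrite -(scale0r (0 : 'M[R]_n)) KZ mul0r.
  have Ksum (I : Type) (r : seq I) (F : I -> 'M[R]_n) :
      K (\sum_(i <- r) F i) = \sum_(i <- r) K (F i).
    by elim/big_rec2: _ => // i x y _; rewrite KD => ->.
  have Kvv : K vv = \sum_i \sum_j v i * v j * K (delta_mx i j).
    rewrite (matrix_sum_delta vv) Ksum; apply: eq_bigr => i _.
    by rewrite Ksum; apply: eq_bigr => j _; rewrite KZ mxE.
  have -> : bil (\matrix_(i, j) ((K (delta_mx i j) + K (delta_mx j i)) / 2)) v v = K vv.
    transitivity ((K vv + K vv) / 2); last by lra.
    rewrite {2}Kvv exchange_big Kvv -big_split mulr_suml; apply: eq_bigr => i _.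
    rewrite -big_split mulr_suml; apply: eq_bigr => j _ /=.
    by rewrite mxE; ring.
  apply: Kp => w.
  have -> : bil vv w w = (\sum_i v i * w i) ^+ 2.
    rewrite expr2 big_distrlr; apply: eq_bigr => i _; apply: eq_bigr => j _ /=.
    by rewrite mxE; ring.
  exact: sqr_ge0.
exists (\matrix_(i, j) ((L (0, delta_mx i j) + L (0, delta_mx j i)) / 2)).
have Lpair P Q : L (P, Q) = L (P, 0) + L (0, Q).
  by rewrite -LD -[(P, 0) + (0, Q)]/(P + 0, 0 + Q) addr0 add0r.
have mE i j : L (delta_mx i j, 0) = L (0, delta_mx i j) + m i j.
  have := Lm (delta_mx i j); rewrite Lpair.
  have -> : prg (delta_mx i j) = m i j.
    rewrite /prg (bigD1 i) //= (bigD1 j) //= mxE !eqxx mulr1.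
    rewrite big1 => [|l /negPf lj]; last by rewrite mxE lj andbF mulr0.
    rewrite addr0 big1 ?addr0 // => l /negPf li; rewrite big1 // => l' _.
    by rewrite mxE li mulr0.
  have -> : (0, - delta_mx i j) = - (0, delta_mx i j) :> 'M[R]_n * 'M[R]_n.
    by rewrite -[RHS]/(- 0, - delta_mx i j) oppr0.
  by rewrite LN; lra.
split.
- by move=> i j; rewrite !mxE addrC.
- by move=> i; have := Ldiag i; rewrite Lpair mE !mxE; lra.
- apply: (Knn (fun M => L (0, M))) => [M M'|c M|M Mp].
  + by rewrite -LD -[(0, M) + (0, M')]/(0 + 0, M + M') addr0.
  + by rewrite -LZ -[c *: (0, M)]/(c *: 0, c *: M) scaler0.
  rewrite -oppr_le0 -LN -prg0; apply: feas0 => v /=; first by rewrite oppr0 addr0 bil0.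
  by rewrite addr0 bilN oppr_le0.
move=> v.
have -> : (\matrix_(i, j) ((L (0, delta_mx i j) + L (0, delta_mx j i)) / 2) + m)%R =
   \matrix_(i, j) ((L (delta_mx i j, 0) + L (delta_mx j i, 0)) / 2).
  by apply/matrixP => i j; rewrite !mxE !mE (msym j i); lra.
apply: (Knn (fun M => L (M, 0))) => [M M'|c M|M Mp].
+ by rewrite -LD -[(M, 0) + (M', 0)]/(M + M', 0 + 0) addr0.
+ by rewrite -LZ -[c *: (M, 0)]/(c *: M, c *: 0) scaler0.
rewrite -oppr_le0 -LN -prg0; apply: feas0 => w /=.
  by rewrite subr0 bilN oppr_le0.
by rewrite oppr0 addr0 bil0.
Qed.

End schur_jordan.

(** * Integration against a finitely additive probability *)
Definition bounded_fct (R : realType) (T : Type) (F : T -> R) : Prop :=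
  exists C : R, forall x, `|F x| <= C.

Section mean.
Context (R : realType) (T : Type) (mu : set T -> R).
Hypotheses (mu_ge0 : forall A, 0 <= mu A) (mu1 : mu [set: T] = 1).
Hypothesis muU : forall A B, A `&` B = set0 -> mu (A `|` B) = mu A + mu B.
Implicit Types (l : seq (R * set T)) (F : T -> R) (A E : set T).

(** A list of coefficients and sets stands for a simple function. The sets may
    overlap, so that simple functions add by concatenation. *)
Definition sfun l (x : T) : R := \sum_(a <- l) a.1 * \1_a.2 x.

Definition sint l : R := \sum_(a <- l) a.1 * mu a.2.

Lemma sfun_cat l l' x : sfun (l ++ l') x = sfun l x + sfun l' x.
Proof. by rewrite /sfun big_cat. Qed.

Lemma sint_cat l l' : sint (l ++ l') = sint l + sint l'.
Proof. by rewrite /sint big_cat. Qed.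

Lemma sfun_scale c l x : sfun (fscale c l) x = c * sfun l x.
Proof. exact: (ev_fscale (fun A : set T => \1_A x)). Qed.

Lemma sint_scale c l : sint (fscale c l) = c * sint l.
Proof. exact: ev_fscale. Qed.

Lemma mu_set0 : mu set0 = 0.
Proof. by have := muU (setI0 set0); rewrite setU0; lra. Qed.

Lemma mu_split E A : mu E = mu (E `&` A) + mu (E `\` A).
Proof.
rewrite -muU ?setDE -?setIUr ?setUv ?setIT //.
by rewrite setIACA setICr setI0.
Qed.

(** The base set is cut along the first set of the list; the constant [b] collects
    the coefficients of the sets already used. *)
Lemma sint_ge0_on l E b : (forall x, E x -> 0 <= b + sfun l x) ->
  0 <= b * mu E + \sum_(a <- l) a.1 * mu (E `&` a.2).
Proof.
elim: l E b => [|[c A] l IH] E b h.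
  rewrite big_nil addr0; have [->|/set0P[x Ex]] := eqVneq E set0.
    by rewrite mu_set0 mulr0.
  by have := h x Ex; rewrite /sfun big_nil addr0 => b0; exact: mulr_ge0.
have h1 := IH (E `&` A) (b + c); have h2 := IH (E `\` A) b.
rewrite big_cons /= (mu_split E A).
have e : \sum_(a <- l) a.1 * mu (E `&` a.2) =
    \sum_(a <- l) a.1 * mu (E `&` A `&` a.2) +
    \sum_(a <- l) a.1 * mu ((E `\` A) `&` a.2).
  rewrite -big_split; apply: eq_bigr => a _ /=.
  by rewrite (mu_split (E `&` a.2) A) mulrDr !setDE; congr (_ * mu _ + _ * mu _);
    rewrite setIAC.
rewrite e; set s1 := \sum_(_ <- _) _ in h1 *; set s2 := \sum_(_ <- _) _ in h2 *.
suff : 0 <= (b + c) * mu (E `&` A) + s1 /\ 0 <= b * mu (E `\` A) + s2 by lra.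
split.
  apply: h1 => x [Ex Ax]; have := h x Ex.
  by rewrite /sfun big_cons /= indicE mem_set // mulr1 addrA.
apply: h2 => x [Ex Ax]; have := h x Ex.
by rewrite /sfun big_cons /= indicE memNset // mulr0 add0r.
Qed.

Lemma le_sint l l' : (forall x, sfun l x <= sfun l' x) -> sint l <= sint l'.
Proof.
move=> h; have := @sint_ge0_on (l' ++ fscale (-1) l) setT 0.
rewrite mul0r add0r; under eq_bigr do rewrite setTI.
rewrite -/(sint _) sint_cat sint_scale mulN1r subr_ge0; apply=> x _.
by rewrite add0r sfun_cat sfun_scale mulN1r subr_ge0.
Qed.

(** Approximation from below by multiples of [e]: the error is at most [e] once
    [N] steps reach [g]. *)
Lemma staircase (e : R) N g : 0 < e -> 0 <= g ->
  let S := \sum_(k < N) e * (e * k.+1%:R <= g)%R%:R in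
  [/\ S <= g, S <= N%:R * e, g <= N.+1%:R * e -> g <= S + e
    & N%:R * e <= g -> S = N%:R * e].
Proof.
move=> e0 g0; elim: N => [|N [h1 h2 h3 h4]] /=.
  rewrite big_ord0 mul0r; split => //; first by rewrite mul1r add0r.
rewrite big_ord_recr /=; set S := \sum_(k < N) _ in h1 h2 h3 h4 *.
have N1 : N.+1%:R = N%:R + 1 :> R by rewrite natr1.
have N2 : N.+2%:R = N%:R + 2 :> R by rewrite -natr1 N1; lra.
rewrite N1 N2; case: (leP (e * (N%:R + 1)) g) => c; rewrite ?mulr1 ?mulr0.
  have -> : S = N%:R * e by apply: h4; lra.
  by split; lra.
have {}h3 : g <= S + e by apply: h3; rewrite N1; lra.
by split; lra.
Qed.

Lemma sfun_approx F (e : R) : bounded_fct F -> 0 < e ->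
  exists l, forall x, sfun l x <= F x <= sfun l x + e.
Proof.
move=> [C FC] e0.
have C0 x : 0 <= F x + C by have := FC x; rewrite ler_norml; lra.
have [N hN] : exists N : nat, 0 <= C -> C + C < N%:R * e.
  exists (Num.bound ((C + C) / e)) => Cp; rewrite -ltr_pdivrMr //.
  by apply: archi_boundP; rewrite divr_ge0 ?addr_ge0 // ltW.
exists ((- C, setT) :: [seq (e, [set x | e * k.+1%:R <= F x + C]) | k <- index_iota 0 N]).
move=> x; have := staircase N e0 (C0 x).
set S := (\sum_(_ < N) _); move=> /= [h1 _ h3 _].
have -> : sfun ((- C, setT) :: [seq (e, [set x | e * k.+1%:R <= F x + C]) |
    k <- index_iota 0 N]) x = - C + S.
  rewrite /sfun big_cons big_map /= indicE mem_set // mulr1 /S.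
  rewrite big_mkord.
  congr (_ + _); apply: eq_bigr => k _; congr (_ * _).
  rewrite indicE.
  by case: (boolP (e * k.+1%:R <= F x + C)) => h; [rewrite mem_set|rewrite memNset //; apply/negP].
suff h : F x + C <= S + e by lra.
apply: h3; have Cp : 0 <= C by have := FC x; have := normr_ge0 (F x); lra.
by have := hN Cp; have := FC x; rewrite ler_norml -natr1; lra.
Qed.

(** The lower integral; on bounded functions it agrees with the upper one by
    [mintN]. *)
Definition mint F : R := sup [set sint l | l in [set l | forall x, sfun l x <= F x]].

Let cst_sint c : sint [:: (c, setT)] = c.
Proof. by rewrite /sint big_seq1 mu1 mulr1. Qed.

Let cst_sfun c x : sfun [:: (c, setT)] x = c.
Proof. by rewrite /sfun big_seq1 indicE mem_set // mulr1. Qed.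

Lemma mint_le F c : bounded_fct F ->
  (forall l, (forall x, sfun l x <= F x) -> sint l <= c) -> mint F <= c.
Proof.
move=> [C FC] h; apply: ge_sup; last by move=> _ [l /= lF <-]; exact: h.
exists (sint [:: (- C, setT)]), [:: (- C, setT)] => //= x.
by rewrite cst_sfun; have := FC x; rewrite ler_norml => /andP[].
Qed.

Lemma mint_ge F l : bounded_fct F -> (forall x, sfun l x <= F x) ->
  sint l <= mint F.
Proof.
move=> [C FC] lF; apply: ub_le_sup; last by exists l.
exists C => _ [l' /= l'F <-]; rewrite -(cst_sint C); apply: le_sint => x.
rewrite cst_sfun; apply: le_trans (l'F x) _.
by have := FC x; rewrite ler_norml => /andP[].
Qed.

Lemma bounded_fctD F F' : bounded_fct F -> bounded_fct F' ->
  bounded_fct (fun x => F x + F' x).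
Proof.
move=> [C FC] [D FD]; exists (C + D) => x.
by apply: le_trans (ler_normD _ _) _; apply: lerD.
Qed.

Lemma bounded_fctZ c F : bounded_fct F -> bounded_fct (fun x => c * F x).
Proof.
by move=> [C FC]; exists (`|c| * C) => x; rewrite normrM ler_wpM2l.
Qed.

Lemma bounded_fct_cst (c : R) : bounded_fct (fun _ : T => c).
Proof. by exists `|c|. Qed.

Lemma bounded_fct_sum (I : Type) (s : seq I) (F : I -> T -> R) :
  (forall i, bounded_fct (F i)) -> bounded_fct (fun x => \sum_(i <- s) F i x).
Proof.
move=> h; elim: s => [|i s [C IH]].
  by exists 0 => x; rewrite big_nil normr0.
have [D FD] := h i; exists (D + C) => x; rewrite big_cons.
by apply: le_trans (ler_normD _ _) _; apply: lerD.
Qed.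

Lemma mint_superadd F F' : bounded_fct F -> bounded_fct F' ->
  mint F + mint F' <= mint (fun x => F x + F' x).
Proof.
move=> bF bF'; rewrite -lerBrDr; apply: mint_le => // l lF.
rewrite lerBrDr addrC -lerBrDr; apply: mint_le => // l' lF'.
rewrite lerBrDr addrC -sint_cat; apply: mint_ge; first exact: bounded_fctD.
by move=> x; rewrite sfun_cat lerD.
Qed.

Lemma mint_cst c : mint (fun=> c) = c.
Proof.
apply/le_anti/andP; split.
  apply: mint_le; first exact: bounded_fct_cst.
  by move=> l h; rewrite -(cst_sint c); apply: le_sint => x; rewrite cst_sfun.
rewrite -{1}(cst_sint c); apply: mint_ge; first exact: bounded_fct_cst.
by move=> x; rewrite cst_sfun.
Qed.

Lemma mintN F : bounded_fct F -> mint (fun x => - F x) = - mint F.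
Proof.
move=> bF.
have bN : bounded_fct (fun x => - F x).
  by have [C FC] := bF; exists C => x; rewrite normrN.
have h := mint_superadd bF bN.
have e0 : mint (fun x => F x + - F x) = 0.
  by rewrite -[RHS](mint_cst 0); congr mint; apply/funext => x; rewrite subrr.
rewrite e0 in h; apply/le_anti/andP; split; first by lra.
apply/ler_addgt0Pr => e epos.
have [l hl] := sfun_approx bF epos.
have h1 : sint l <= mint F by apply: mint_ge => // x; case/andP: (hl x).
have h2 : sint ((- e, setT) :: fscale (-1) l) <= mint (fun x => - F x).
  apply: mint_ge => // x; rewrite /sfun big_cons -/(sfun _ x) sfun_scale indicE.
  by rewrite mem_set // mulr1 /=; case/andP: (hl x); lra.
move: h2; rewrite /sint big_cons -/(sint _) sint_scale mu1 /=; lra.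
Qed.

Lemma mintD F F' : bounded_fct F -> bounded_fct F' ->
  mint (fun x => F x + F' x) = mint F + mint F'.
Proof.
move=> bF bF'; apply/le_anti/andP; split; last exact: mint_superadd.
have bD := bounded_fctD bF bF'.
have bN : bounded_fct (fun x => - F' x).
  by have [C FC] := bF'; exists C => x; rewrite normrN.
have := mint_superadd bD bN; rewrite mintN // => h.
have -> : mint F = mint (fun x => F x + F' x + - F' x).
  by congr mint; apply/funext => x; rewrite addrK.
lra.
Qed.

Lemma mint_ge0 F : bounded_fct F -> (forall x, 0 <= F x) -> 0 <= mint F.
Proof.
move=> bF F0; rewrite -{1}(cst_sint 0); apply: mint_ge => // x.
by rewrite cst_sfun.
Qed.

Lemma mintZ c F : bounded_fct F -> mint (fun x => c * F x) = c * mint F.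
Proof.
have pos d F' : 0 < d -> bounded_fct F' -> d * mint F' <= mint (fun x => d * F' x).
  move=> d0 bF; rewrite mulrC -ler_pdivlMr //; apply: mint_le => // l lF.
  rewrite ler_pdivlMr // mulrC -sint_scale; apply: mint_ge.
    exact: bounded_fctZ.
  by move=> x; rewrite sfun_scale ler_pM2l.
have eq d F' : 0 < d -> bounded_fct F' -> mint (fun x => d * F' x) = d * mint F'.
  move=> d0 bF; apply/le_anti/andP; split; last exact: pos.
  rewrite -ler_pdivrMl //; have di : 0 < d^-1 by rewrite invr_gt0.
  apply: le_trans (pos _ _ di (bounded_fctZ d bF)) _.
  rewrite (_ : (fun x => _) = F') //; apply/funext => x.
  by rewrite mulrA mulVf ?mul1r // gt_eqF.
move=> bF; have [c0|c0|->] := ltgtP c 0.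
- rewrite -[c]opprK mulNr -eq ?oppr_gt0 // -mintN; last exact: bounded_fctZ.
  by congr mint; apply/funext => x; rewrite mulNr.
- exact: eq.
- by rewrite mul0r -[RHS](mint_cst 0); congr mint; apply/funext => x; rewrite mul0r.
Qed.

Lemma mint_sum (I : Type) (s : seq I) (F : I -> T -> R) :
  (forall i, bounded_fct (F i)) ->
  mint (fun x => \sum_(i <- s) F i x) = \sum_(i <- s) mint (F i).
Proof.
move=> bF; elim: s => [|i s IH].
  rewrite big_nil -[RHS](mint_cst 0); congr mint.
  by apply/funext => x; rewrite big_nil.
rewrite big_cons -IH -mintD //; last exact: bounded_fct_sum.
by congr mint; apply/funext => x; rewrite big_cons.
Qed.

(** Only one inequality is stated: the opposite one is the same statement for the
    inverse transformation. *)
Lemma mint_invariant (h h' : T -> T) F : cancel h h' -> cancel h' h ->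
  (forall A, mu (h' @` A) = mu A) -> bounded_fct F ->
  mint F <= mint (fun x => F (h x)).
Proof.
move=> hK h'K muh bF; apply: mint_le => // l lF.
pose l' := [seq (a.1, h' @` a.2) | a <- l].
have -> : sint l = sint l'.
  by rewrite /sint big_map; apply: eq_bigr => a _; rewrite /= muh.
apply: mint_ge => [|x]; first by have [C FC] := bF; exists C.
apply: le_trans (lF (h x)); rewrite le_eqVlt; apply/orP; left; apply/eqP.
rewrite /sfun big_map; apply: eq_bigr => a _ /=; congr (_ * _).
rewrite !indicE; congr (_%:R); congr nat_of_bool.
apply/idP/idP.
  by rewrite !inE => -[y ay <-]; rewrite h'K.
by rewrite !inE => ahx; exists (h x); rewrite ?hK.
Qed.

End mean.

(** * Square-summable families and finite sections of operators *)
Section complex_facts.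
Context (R : realType).
Implicit Types (z w : R[i]).

Lemma reD z w : complex.Re (z + w) = complex.Re z + complex.Re w.
Proof. by case: z w => [a b] [c d]. Qed.

Lemma imD z w : complex.Im (z + w) = complex.Im z + complex.Im w.
Proof. by case: z w => [a b] [c d]. Qed.

Lemma reM z w : complex.Re (z * w) =
  complex.Re z * complex.Re w - complex.Im z * complex.Im w.
Proof. by case: z w => [a b] [c d]. Qed.

Lemma imM z w : complex.Im (z * w) =
  complex.Re z * complex.Im w + complex.Im z * complex.Re w.
Proof. by case: z w => [a b] [c d]. Qed.

Lemma re_sum (I : Type) (s : seq I) (P : pred I) (F : I -> R[i]) :
  complex.Re (\sum_(i <- s | P i) F i) = \sum_(i <- s | P i) complex.Re (F i).
Proof. exact: (big_morph _ reD (erefl : complex.Re (0 : R[i]) = 0)). Qed.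

Lemma im_sum (I : Type) (s : seq I) (P : pred I) (F : I -> R[i]) :
  complex.Im (\sum_(i <- s | P i) F i) = \sum_(i <- s | P i) complex.Im (F i).
Proof. exact: (big_morph _ imD (erefl : complex.Im (0 : R[i]) = 0)). Qed.

Lemma cmod_sqr z : cmod z ^+ 2 = complex.Re z ^+ 2 + complex.Im z ^+ 2.
Proof. by case: z => a b; rewrite /cmod /= sqr_sqrtr // addr_ge0 ?sqr_ge0. Qed.

Lemma cmodM z w : cmod (z * w) = cmod z * cmod w.
Proof. exact: ComplexField.Normc.normcM. Qed.

Lemma cmod_real (r : R) : cmod r%:C%C ^+ 2 = r ^+ 2.
Proof. by rewrite cmod_sqr /= expr0n addr0. Qed.

Lemma cmod0 : cmod (0 : R[i]) = 0.
Proof. exact: ComplexField.Normc.normc0. Qed.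

End complex_facts.

Section l2_facts.
Context (R : realType) (X : choiceType).
Implicit Types (f g : l2 R X) (F : X -> R[i]) (s : seq X) (c : R).
Implicit Types (A B : {linear l2 R X -> l2 R X}).

Lemma sqsum_le F c :
  (forall s, uniq s -> \sum_(x <- s) cmod (F x) ^+ 2 <= c) ->
  (sqsum F <= c%:E)%E.
Proof.
move=> h; apply: ge_ereal_sup => _ [A [/finite_seqP[s ->] _] <-].
rewrite (_ : [set` s] = [set` undup s]); last first.
  by apply/seteqP; split=> x /=; rewrite mem_undup.
by rewrite -fsbig_seq ?undup_uniq // sumEFin lee_fin h // undup_uniq.
Qed.

Lemma sqsum_ge F s : uniq s ->
  ((\sum_(x <- s) cmod (F x) ^+ 2)%:E <= sqsum F)%E.
Proof.
move=> us; apply: ereal_sup_ubound; exists [set` s]; first by split.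
by rewrite -fsbig_seq // sumEFin.
Qed.

Lemma sqsum_ge0 F : (0 <= sqsum F)%E.
Proof. by apply: esum_ge0 => x _; rewrite lee_fin sqr_ge0. Qed.

Lemma sqsum_l2 f : sqsum f = (l2norm f ^+ 2)%:E.
Proof.
have /asboolP sf := valP f; have s0 := sqsum_ge0 f.
rewrite /l2norm sqr_sqrtr ?fine_ge0 // fineK //.
by rewrite ge0_fin_numE.
Qed.

Lemma l2norm_ge0 f : 0 <= l2norm f.
Proof. exact: sqrtr_ge0. Qed.

Lemma l2norm_le f c : 0 <= c ->
  (forall s, uniq s -> \sum_(x <- s) cmod (f x) ^+ 2 <= c ^+ 2) -> l2norm f <= c.
Proof.
move=> c0 /sqsum_le; rewrite sqsum_l2 lee_fin.
by rewrite ler_sqr ?nnegrE // l2norm_ge0.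
Qed.

Lemma l2norm_ge f s : uniq s ->
  \sum_(x <- s) cmod (f x) ^+ 2 <= l2norm f ^+ 2.
Proof. by move=> us; rewrite -lee_fin -sqsum_l2; exact: sqsum_ge. Qed.

Lemma l2normZ_le (z : R[i]) f : l2norm (z *: f) <= cmod z * l2norm f.
Proof.
apply: l2norm_le; first by rewrite mulr_ge0 ?cmod_ge0 ?l2norm_ge0.
move=> s us; rewrite exprMn.
apply: le_trans (ler_wpM2l (sqr_ge0 _) (l2norm_ge f us)).
rewrite mulr_sumr le_eqVlt; apply/orP; left; apply/eqP/eq_bigr => x _.
by rewrite cmodM exprMn.
Qed.

Lemma l2norm_eq0 f : l2norm f = 0 -> f = 0.
Proof.
move=> f0; apply/val_inj/funext => x /=.
have := @l2norm_ge f [:: x] isT; rewrite big_seq1 f0 expr0n /= => h.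
apply: ComplexField.Normc.eq0_normc; apply/eqP; rewrite -sqrf_eq0.
by rewrite eq_le h sqr_ge0.
Qed.

Lemma l2norm0 : l2norm (0 : l2 R X) = 0.
Proof.
apply/le_anti; rewrite l2norm_ge0 andbT -(scale0r (0 : l2 R X)).
by apply: le_trans (l2normZ_le _ _) _; rewrite cmod0 mul0r.
Qed.

Lemma opnorm_le A c : 0 <= c -> (forall f, l2norm (A f) <= c * l2norm f) ->
  (opnorm A <= c%:E)%E.
Proof.
move=> c0 h; apply: ge_ereal_sup => _ [f /= f1 <-]; rewrite lee_fin.
by apply: le_trans (h f) _; rewrite ler_piMr.
Qed.

Lemma opnorm_bound A c f : 0 <= c -> (opnorm A <= c%:E)%E ->
  l2norm (A f) <= c * l2norm f.
Proof.
move=> c0 h; have [f0|fp] := leP (l2norm f) 0.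
  have -> : f = 0 by apply: l2norm_eq0; apply/le_anti; rewrite f0 l2norm_ge0.
  by rewrite linear0 l2norm0 mulr0.
pose t := (l2norm f)^-1.
have tp : 0 < t by rewrite invr_gt0.
have ct (r : R) : 0 < r -> cmod r%:C%C = r.
  by move=> r0; apply/eqP; rewrite -(@eqrXn2 _ 2) ?cmod_ge0 ?ltW // cmod_real.
have h1 : (l2norm (A (t%:C%C *: f)) <= c).
  rewrite -lee_fin; apply: le_trans h; apply: ereal_sup_ubound.
  exists (t%:C%C *: f) => //=; apply: le_trans (l2normZ_le _ _) _.
  by rewrite ct // /t mulVf // gt_eqF.
have -> : f = (l2norm f)%:C%C *: (t%:C%C *: f).
  rewrite scalerA -rmorphM /= /t mulfV ?gt_eqF // rmorph1 scale1r //.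
rewrite linearZ /=; apply: le_trans (l2normZ_le _ _) _.
rewrite ct // mulrC; apply: ler_pM => //; first exact: l2norm_ge0.
  exact: ltW.
rewrite scalerA -rmorphM /= /t mulfV ?gt_eqF // rmorph1 scale1r //.
Qed.

Lemma bounded_opP A : bounded_op A ->
  exists2 c, 0 < c & (opnorm A <= c%:E)%E.
Proof.
rewrite /bounded_op => h.
have a0 : (0 <= opnorm A)%E.
  apply: le_trans (_ : ((l2norm (A 0))%:E <= _)%E).
    by rewrite lee_fin l2norm_ge0.
  by apply: ereal_sup_ubound; exists 0 => //=; rewrite l2norm0.
exists (fine (opnorm A) + 1); first by rewrite ltr_wpDl // fine_ge0.
by rewrite EFinD fineK ?ge0_fin_numE // leeDl // lee_fin.
Qed.

Section finite_vectors.
Context (I : finType) (p : I -> X).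
Hypothesis pinj : injective p.

Definition fin_vec (cc : I -> R[i]) : l2 R X := \sum_i cc i *: l2delta R (p i).

Lemma l2_sumE (J : Type) (r : seq J) (u : J -> l2 R X) x :
  (\sum_(j <- r) u j) x = \sum_(j <- r) u j x.
Proof. by elim/big_rec2: _ => // j a b _ <-. Qed.

Lemma fin_vecE cc x : fin_vec cc x = \sum_i cc i * (x == p i)%:R.
Proof. by rewrite /fin_vec l2_sumE. Qed.

Lemma fin_vec_point cc i : fin_vec cc (p i) = cc i.
Proof.
rewrite fin_vecE (bigD1 i) //= eqxx mulr1 big1 ?addr0 // => j ji.
by rewrite (inj_eq pinj) eq_sym (negPf ji) mulr0.
Qed.

Lemma fin_vec_out cc x : (forall i, x != p i) -> fin_vec cc x = 0.
Proof.
by move=> h; rewrite fin_vecE big1 // => i _; rewrite (negPf (h i)) mulr0.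
Qed.

Lemma fin_vec_norm cc : l2norm (fin_vec cc) ^+ 2 <= \sum_i cmod (cc i) ^+ 2.
Proof.
have S0 : 0 <= \sum_i cmod (cc i) ^+ 2 by apply: sumr_ge0 => i _; exact: sqr_ge0.
rewrite -[leRHS]sqr_sqrtr // ler_sqr ?nnegrE ?sqrtr_ge0 ?l2norm_ge0 //.
apply: l2norm_le; first exact: sqrtr_ge0.
move=> s us; rewrite sqr_sqrtr //.
apply: (@le_trans _ _ (\sum_(x <- s) \sum_i cmod (cc i) ^+ 2 * (x == p i)%:R)).
  apply: ler_sum => x _; have [[i xi]|nx] := pselect (exists i, x = p i).
    rewrite xi fin_vec_point (bigD1 i) //= eqxx mulr1 lerDl.
    by apply: sumr_ge0 => j _; rewrite mulr_ge0 ?sqr_ge0.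
  rewrite fin_vec_out ?cmod0 ?expr0n.
    by apply: sumr_ge0 => j _; rewrite mulr_ge0 ?sqr_ge0.
  by move=> i; apply/eqP => xi; apply: nx; exists i.
rewrite exchange_big; apply: ler_sum => i _; rewrite -mulr_sumr.
apply: ler_piMr; first exact: sqr_ge0.
have [pis|pis] := boolP (p i \in s).
  rewrite (bigD1_seq (p i)) //= eqxx big1 ?addr0 // => x /negPf->//.
rewrite big_seq big1 ?ler01 // => x xs; case: eqVneq => // xi.
by rewrite -xi xs in pis.
Qed.

End finite_vectors.

End l2_facts.

Section schur_to_sections.
Context (R : realType) (X : choiceType) (k : X -> X -> R).
Variables (n : nat) (p : 'I_n -> X).
Hypothesis pinj : injective p.
Implicit Types (M : 'M[R]_n) (f : 'I_n -> R).

Lemma mx_contractive_vec M f : mx_contractive M ->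
  \sum_i (\sum_j M i j * f j) ^+ 2 <= \sum_j f j ^+ 2.
Proof.
move=> /(_ f (fun i => \sum_j M i j * f j)).
have -> : bil M (fun i => \sum_j M i j * f j) f =
    \sum_i (\sum_j M i j * f j) ^+ 2.
  apply: eq_bigr => i _; rewrite expr2 mulr_sumr; apply: eq_bigr => j _.
  by rewrite mulrA.
rewrite /nrm2; lra.
Qed.

Lemma vec_mx_contractive M : (forall f,
  \sum_i (\sum_j M i j * f j) ^+ 2 <= \sum_j f j ^+ 2) -> mx_contractive M.
Proof.
move=> h f g; have := h f; rewrite /nrm2.
have : bil M g f <= (\sum_i (\sum_j M i j * f j) ^+ 2 + \sum_i g i ^+ 2) / 2.
  rewrite -big_split mulr_suml; apply: ler_sum => i _ /=.
  have -> : \sum_j g i * M i j * f j = g i * \sum_j M i j * f j.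
    by rewrite mulr_sumr; apply: eq_bigr => j _; rewrite mulrA.
  by have := sqr_ge0 (g i - \sum_j M i j * f j); lra.
lra.
Qed.

Let sect M (f : l2 R X) : l2 R X :=
  fin_vec p (fun i => \sum_j (M i j)%:C%C * f (p j)).

Let sect_linear M : linear (sect M).
Proof.
move=> c f g; rewrite /sect /fin_vec scaler_sumr -big_split /=.
apply: eq_bigr => i _; rewrite scalerA -scalerDl; congr (_ *: _).
rewrite mulr_sumr -big_split; apply: eq_bigr => j _ /=.
rewrite mulrDr; congr (_ + _); rewrite mulrCA; congr (_ * _).
Qed.

Let sect_op M : {linear l2 R X -> l2 R X} :=
  HB.pack (sect M) (GRing.isLinear.Build R[i] (l2 R X) (l2 R X) *:%R (sect M)
    (sect_linear M)).

Let sect_le1 M : mx_contractive M -> (opnorm (sect_op M) <= 1)%E.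
Proof.
move=> cM; apply: opnorm_le => // f; rewrite mul1r.
rewrite -ler_sqr ?nnegrE ?l2norm_ge0 //.
apply: le_trans (fin_vec_norm pinj _) _.
have up : uniq [seq p j | j <- enum 'I_n] by rewrite map_inj_uniq ?enum_uniq.
apply: le_trans (l2norm_ge f up); rewrite big_map big_enum /=.
have h1 := mx_contractive_vec (fun j => complex.Re (f (p j))) cM.
have h2 := mx_contractive_vec (fun j => complex.Im (f (p j))) cM.
have -> : \sum_i cmod (\sum_j (M i j)%:C%C * f (p j)) ^+ 2 =
    \sum_i (\sum_j M i j * complex.Re (f (p j))) ^+ 2 +
    \sum_i (\sum_j M i j * complex.Im (f (p j))) ^+ 2.
  rewrite -big_split; apply: eq_bigr => i _ /=; rewrite cmod_sqr re_sum im_sum.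
  congr (_ ^+ 2 + _ ^+ 2); apply: eq_bigr => j _.
    by rewrite reM /= mul0r subr0.
  by rewrite imM /= mul0r addr0.
under [leRHS]eq_bigr do rewrite cmod_sqr.
by rewrite big_split lerD.
Qed.

(** A matrix acts on the span of finitely many basis vectors, and extends by zero
    to a bounded operator of the same norm, to which the multiplier applies. *)
Lemma schur_norm_le1_section M :
  schur_multiplier (fun x y => (k x y)%:C%C) ->
  (schur_norm (fun x y => (k x y)%:C%C : R[i]) <= 1)%E ->
  mx_contractive M -> mx_contractive (\matrix_(i, j) (k (p i) (p j) * M i j)).
Proof.
move=> km k1 cM.
have bM : bounded_op (sect_op M) by apply: le_lt_trans (sect_le1 cM) _; rewrite ltry.
have [B kB] := km _ bM.
have B1 : (opnorm B <= 1)%E.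
  apply: le_trans k1; apply: ereal_sup_ubound; exists (sect_op M), B; split=> //.
  exact: sect_le1.
apply: vec_mx_contractive => f.
pose v : l2 R X := fin_vec p (fun j => (f j)%:C%C).
have up : uniq [seq p j | j <- enum 'I_n] by rewrite map_inj_uniq ?enum_uniq.
have : l2norm (B v) ^+ 2 <= \sum_j f j ^+ 2.
  apply: (@le_trans _ _ (l2norm v ^+ 2)).
    rewrite ler_sqr ?nnegrE ?l2norm_ge0 //.
    by have := opnorm_bound v ler01 B1; rewrite mul1r.
  apply: le_trans (fin_vec_norm pinj _) _.
  by under eq_bigr do rewrite cmod_real.
apply: le_trans; apply: le_trans (l2norm_ge (B v) up).
rewrite big_map big_enum /= le_eqVlt; apply/orP; left; apply/eqP.
apply: eq_bigr => i _; rewrite -cmod_real; congr (cmod _ ^+ 2).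
rewrite /v /fin_vec linear_sum l2_sumE rmorph_sum; apply: eq_bigr => j _ /=.
have [_ /(_ (p i) (p j))] := kB; rewrite /op_entry => e.
have e' : sect_op M (l2delta R (p j)) (p i) = (M i j)%:C%C.
  rewrite /= /sect fin_vec_point // (bigD1 j) //= eqxx mulr1 big1 ?addr0 //.
  by move=> l lj; rewrite (inj_eq pinj) (negPf lj) mulr0.
rewrite linearZ -[RHS]/((f j)%:C%C * B (l2delta R (p j)) (p i)) e e'.
by rewrite !mxE -!rmorphM mulrC.
Qed.

End schur_to_sections.

(** * From contractive exponentials to a kernel decomposition *)
Section enumeration.
Context (T : choiceType) (x0 : T).

Lemma countable_enumeration : countable [set: T] ->
  exists e : nat -> T, forall x, exists n, e n = x.
Proof.
move=> /countable_injP[f finj].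
exists (fun n => xget x0 [set x | f x = n]) => x; exists (f x).
have := xgetPex x0 (ex_intro [set y | f y = f x] x erefl).
by apply: finj; rewrite in_setT.
Qed.

Definition first (e : nat -> T) n : seq T := undup [seq e k | k <- iota 0 n].

Lemma first_uniq e n : uniq (first e n). Proof. exact: undup_uniq. Qed.

Lemma first_near e x : (exists n, e n = x) ->
  \forall n \near \oo, x \in first e n.
Proof.
move=> [k <-]; exists k.+1 => //= n kn.
by rewrite mem_undup; apply: map_f; rewrite mem_iota.
Qed.

Lemma first_near_all e (s : seq T) : (forall x, exists n, e n = x) ->
  \forall n \near \oo, {subset s <= first e n}.
Proof.
move=> he; elim: s => [|x s IH]; first by exists 0.
have := first_near (he x); apply: filterS2 IH => n sn xn y.
by rewrite inE => /predU1P[->//|]; exact: sn.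
Qed.

End enumeration.

Section limits.
Context (R : realType).

Lemma cvg_bounded_seq (u : nat -> R) (l : R) : u @ \oo --> l -> bounded_seq u.
Proof.
move=> /cvgrPdist_le /(_ 1 ltr01) [N _ hN].
exists (`|l| + 1 + \sum_(k < N) `|u k|) => n.
have S0 : 0 <= \sum_(k < N) `|u k| by apply: sumr_ge0.
have [nN|Nn] := ltnP n N.
  rewrite (bigD1 (Ordinal nN)) //= addrCA lerDl.
  by rewrite addr_ge0 ?addr_ge0 //; apply: sumr_ge0.
have := hN n Nn; have := ler_normB l (l - u n).
by rewrite opprB addrC subrK; lra.
Qed.

(** Both bounds on the exponential come from [1 + x <= exp x], applied to [- t K]
    and to [t K]. *)
Lemma exp_quotient_bound (K t : R) : 0 < t -> t * `|K| <= 2^-1 ->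
  `|K - (1 - expR (- t * K)) / t| <= 2 * t * K ^+ 2.
Proof.
move=> t0 tK.
have h1 := expR_ge1Dx (- t * K); have h2 := expR_ge1Dx (t * K).
have a1 : - (2^-1) <= t * K <= 2^-1.
  by rewrite -ler_norml normrM (gtr0_norm t0).
have tp : 0 < 1 + t * K by case/andP: a1; lra.
have h3 : expR (- t * K) <= (1 + t * K)^-1.
  by rewrite mulNr expRN lef_pV2 // posrE ?expR_gt0.
have -> : K - (1 - expR (- t * K)) / t = (t * K - 1 + expR (- t * K)) / t.
  by field; rewrite gt_eqF.
rewrite ger0_norm; last by apply: divr_ge0; [lra|exact: ltW].
rewrite ler_pdivrMr //; apply: (@le_trans _ _ (t * K - 1 + (1 + t * K)^-1)); first by lra.
have -> : t * K - 1 + (1 + t * K)^-1 = (t * K) ^+ 2 / (1 + t * K).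
  by field; rewrite gt_eqF.
rewrite ler_pdivrMr // -subr_ge0.
have -> : 2 * t * K ^+ 2 * t * (1 + t * K) - (t * K) ^+ 2 =
  (t * K) ^+ 2 * (1 + 2 * (t * K)) by ring.
by apply: mulr_ge0; [exact: sqr_ge0|case/andP: a1; lra].
Qed.

Lemma exp_quotient_cvg (K : R) :
  (1 - expR (- n.+1%:R^-1 * K)) / n.+1%:R^-1 @[n --> \oo] --> K.
Proof.
apply/cvgrPdist_le => e e0.
have hc : (fun n : nat => n.+1%:R^-1 : R) @ \oo --> 0 by exact: cvg_harmonic.
have hK c : (fun n : nat => n.+1%:R^-1 * c : R) @ \oo --> 0.
  by rewrite -(mul0r c); apply: cvgM hc _; exact: cvg_cst.
have /cvgrPdist_le /(_ _ e0) n1 := hK (2 * K ^+ 2).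
have /cvgrPdist_le /(_ (2^-1)) n2 := hK `|K|.
have {}n2 := n2 ltac:(by rewrite invr_gt0).
apply: filterS2 n1 n2 => n; rewrite !sub0r !normrN => n1 n2.
have t0 : 0 < n.+1%:R^-1 :> R by rewrite invr_gt0.
apply: le_trans (exp_quotient_bound t0 _) _.
  by apply: le_trans n2; exact: ler_norm.
by rewrite -mulrA mulrCA; exact: le_trans (ler_norm _) n1.
Qed.

End limits.

Section kernel_limit.
Context (R : realType) (X : choiceType) (K : X -> X -> R) (d : R).
Hypotheses (Ksym : forall x y, K x y = K y x) (Kd : forall x, K x x = d).
Variables (e : nat -> X).
Hypothesis esurj : forall x, exists n, e n = x.
Hypothesis exp_section : forall (t : R), 0 < t ->
  forall n (p : 'I_n -> X), injective p -> forall A : 'M[R]_n,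
  mx_contractive A ->
  mx_contractive (\matrix_(i, j) (expR (- t * K (p i) (p j)) * A i j)).
Implicit Types (u v : seq (R * X)).

(* The extension of a matrix by zero outside the points of [p]. *)
Let lift n (p : 'I_n -> X) (M : 'M[R]_n) (x y : X) : R :=
  \sum_i \sum_j M i j * ((x == p i)%:R * (y == p j)%:R).

Let lift_form n (p : 'I_n -> X) (M : 'M[R]_n) u :
  fform (lift p M) u u = bil M (fun i => ev (fun x => (x == p i)%:R) u)
                               (fun i => ev (fun x => (x == p i)%:R) u).
Proof.
rewrite /fform /bil.
transitivity (\sum_i \sum_j M i j * (ev (fun x => (x == p i)%:R) u *
    ev (fun x => (x == p j)%:R) u)).
  rewrite [LHS](_ : _ = ev (fun x => \sum_i \sum_j M i j *
      ev (fun y => (y == p j)%:R) u * (x == p i)%:R) u).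
    rewrite ev_sum; apply: eq_bigr => i _; rewrite ev_sum; apply: eq_bigr => j _.
    by rewrite evZ; ring.
  apply: eq_ev => x; rewrite ev_sum; apply: eq_bigr => i _; rewrite ev_sum.
  apply: eq_bigr => j _; rewrite evZ evZ; ring.
by apply: eq_bigr => i _; apply: eq_bigr => j _; ring.
Qed.

Let lift_point n (p : 'I_n -> X) (M : 'M[R]_n) i j : injective p ->
  lift p M (p i) (p j) = M i j.
Proof.
move=> pinj; rewrite /lift (bigD1 i) //= (bigD1 j) //= !eqxx !mulr1.
rewrite big1 => [|l /negPf lj]; last first.
  by rewrite (inj_eq pinj) [j == l]eq_sym lj !mulr0.
rewrite addr0 big1 ?addr0 // => l /negPf li; rewrite big1 // => l' _.
by rewrite (inj_eq pinj) [i == l]eq_sym li mul0r mulr0.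
Qed.

Lemma eq_fform_on (k k' : X -> X -> R) (s : seq X) u v :
  {in s &, k =2 k'} -> {subset [seq a.2 | a <- u] <= s} ->
  {subset [seq a.2 | a <- v] <= s} -> fform k u v = fform k' u v.
Proof.
move=> kk us vs; rewrite !fformE !big_seq; apply: eq_bigr => a au.
rewrite !big_seq; apply: eq_bigr => b bv; rewrite kk //.
  by apply: us; exact: map_f.
by apply: vs; exact: map_f.
Qed.

(** The exponential [m = a - b] at time [t] gives [(1 - m) / t - b / t =
    (1 - a) / t], which is conditionally negative definite since [a] is positive
    and constants vanish on measures of total mass 0. *)
Let section_decomposition n : exists b : X -> X -> R,
  let t : R := n.+1%:R^-1 in
  [/\ forall x y, b x y = b y x, psd b,
      forall x, x \in first e n -> b x x = (1 - expR (- t * d)) / t / 2,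
      forall x, 0 <= b x x <= `|d|
    & forall u, {subset [seq a.2 | a <- u] <= first e n} ->
        ev (fun=> 1) u = 0 ->
        fform (fun x y => (1 - expR (- t * K x y)) / t - b x y) u u <= 0].
Proof.
set s := first e n; pose t : R := n.+1%:R^-1.
have t0 : 0 < t by rewrite invr_gt0.
pose N := size s; pose p (i : 'I_N) : X := tnth (in_tuple s) i.
have pinj : injective p by apply/tuple_uniqP; exact: first_uniq.
have ps x : x \in s -> exists i, p i = x.
  by move=> xs; have /tnthP[i ->] : x \in in_tuple s by []; exists i.
pose m : 'M[R]_N := \matrix_(i, j) expR (- t * K (p i) (p j)).
have msym i j : m i j = m j i by rewrite !mxE Ksym.
have mc (A : 'M[R]_N) : mx_contractive A ->
    mx_contractive (\matrix_(i, j) (m i j * A i j)).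
  move=> cA; have := exp_section t0 pinj cA.
  by congr mx_contractive; apply/matrixP => i j; rewrite !mxE.
have [B [Bsym Bd Bp Bmp]] := schur_jordan_decomposition msym mc.
exists (fun x y => t^-1 * lift p B x y); rewrite /= -/t.
have psdb : psd (fun x y => t^-1 * lift p B x y).
  move=> u; rewrite fformZk lift_form mulr_ge0 //.
  by rewrite invr_ge0 ltW.
have diag x : x \in s -> t^-1 * lift p B x x = (1 - expR (- t * d)) / t / 2.
  move=> /ps[i <-]; rewrite lift_point //.
  have := Bd i; rewrite /m mxE Kd => h.
  rewrite (_ : B i i = (1 - expR (- t * d)) / 2); first by ring.
  by lra.
have b0 x : 0 <= t^-1 * lift p B x x.
  by have := psdb [:: (1, x)]; rewrite fformE !big_seq1 /= !mul1r.
split.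
- move=> x y; congr (_ * _); rewrite /lift exchange_big; apply: eq_bigr => i _.
  by apply: eq_bigr => j _; rewrite Bsym; congr (_ * _); exact: mulrC.
- exact: psdb.
- exact: diag.
- move=> x; rewrite b0 /=; have [xs|xs] := boolP (x \in s).
    have := b0 x; rewrite diag // => q0.
    have : (1 - expR (- t * d)) / t <= d.
      by rewrite ler_pdivrMr //; have := expR_ge1Dx (- t * d); lra.
    by have := ler_norm d; lra.
  rewrite /lift big1 ?mulr0 // => i _; rewrite big1 // => j _.
  have /negPf-> : x != p i.
    by apply: contraNneq xs => ->; exact: mem_tnth.
  by rewrite mul0r mulr0.
- move=> u us u0.
  rewrite (@eq_fform_on _ (fun x y => t^-1 * (1 - lift p (B + m) x y)) s) //.
    rewrite fformZk fformBk fform_cstk u0 mulr0 sub0r lift_form.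
    by rewrite pmulr_rle0 ?invr_gt0 // oppr_le0; exact: Bmp.
  move=> _ _ /ps[i <-] /ps[j <-]; rewrite !lift_point //= !mxE; ring.
Qed.

(** As [t] tends to 0 the quotients [(1 - exp (- t K)) / t] converge to [K],
    while the positive parts are bounded, like their diagonals, and have a
    generalized limit [beta]; every inequality between finite sums passes to the
    limit. *)
Lemma exp_section_limit : exists beta : X -> X -> R,
  [/\ forall x y, beta x y = beta y x, psd beta, forall x, beta x x = d / 2,
      exists C : R, forall x y, `|beta x y| <= C
    & forall u, ev (fun=> 1) u = 0 ->
        fform (fun x y => K x y - beta x y) u u <= 0].
Proof.
have [b hb] := choice section_decomposition.
pose q n x y : R := (1 - expR (- n.+1%:R^-1 * K x y)) / n.+1%:R^-1.
have bC n x y : `|b n x y| <= `|d|.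
  have [bsym bp _ bd _] := hb n.
  have := fform_CauchySchwarz [:: (1, x)] [:: (1, y)] bp bsym.
  rewrite !fformE !big_seq1 /= !mul1r => h.
  have /andP[x0 xd] := bd x; have /andP[y0 yd] := bd y.
  have : `|b n x y| ^+ 2 <= `|d| ^+ 2.
    by rewrite real_normK ?num_real //; apply: le_trans h _; rewrite expr2 ler_pM.
  by rewrite ler_sqr ?nnegrE.
have bb x y : bounded_seq (fun n => b n x y) by exists `|d| => n; exact: bC.
have bq x y : bounded_seq (fun n => q n x y).
  exact: (@cvg_bounded_seq _ _ (K x y) (@exp_quotient_cvg R (K x y))).
have qK x y : glim (fun n => q n x y) = K x y.
  by apply: glim_cvg => //; exact: exp_quotient_cvg.
have bform (k : nat -> X -> X -> R) u v : (forall x y, bounded_seq (fun n => k n x y)) ->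
    bounded_seq (fun n => fform (k n) u v).
  move=> bk.
  have -> : (fun n => fform (k n) u v) = (fun n =>
      \sum_(a <- u) \sum_(c <- v) a.1 * c.1 * k n a.2 c.2).
    by apply/funext => n; rewrite fformE.
  by apply: bounded_sum => a; apply: bounded_sum => c; exact: boundedZ.
have lform (k : nat -> X -> X -> R) u v : (forall x y, bounded_seq (fun n => k n x y)) ->
    fform (fun x y => glim (fun n => k n x y)) u v = glim (fun n => fform (k n) u v).
  move=> bk; rewrite fformE.
  have -> : (fun n => fform (k n) u v) = (fun n =>
      \sum_(a <- u) \sum_(c <- v) a.1 * c.1 * k n a.2 c.2).
    by apply/funext => n; rewrite fformE.
  rewrite glim_sum => [|a]; last by apply: bounded_sum => c; exact: boundedZ.
  apply: eq_bigr => a _; rewrite glim_sum => [|c]; last exact: boundedZ.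
  by apply: eq_bigr => c _; rewrite glimZ.
exists (fun x y => glim (fun n => b n x y)); split.
- move=> x y; congr glim; apply/funext => n; by have [-> _ _ _ _] := hb n.
- move=> u; rewrite lform //; apply: glim_ge0; first exact: bform.
  by apply: nearW => n; have [_ + _ _ _] := hb n; exact.
- move=> x; apply/eqP; rewrite -subr_eq0 -(Kd x) -(qK x x) mulrC.
  have bz := boundedZ 2^-1 (bq x x).
  rewrite -glimZ // -glimB //; apply/eqP/glim_near.
    by apply: boundedD => //; exact: boundedN.
  apply: filterS (first_near (esurj x)) => n xn.
  have [_ _ /(_ _ xn) -> _ _] := hb n.
  by rewrite /q Kd mulrC subrr.
- exists `|d| => x y; rewrite ler_norml; apply/andP; split.
    apply: glim_ge => //; apply: nearW => n; have := bC n x y.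
    by rewrite ler_norml => /andP[].
  apply: glim_le => //; apply: nearW => n; have := bC n x y.
  by rewrite ler_norml => /andP[].
move=> u u0.
have bqb x y : bounded_seq (fun n => q n x y - b n x y).
  by apply: boundedD => //; exact: boundedN.
rewrite (@eq_fform _ _ _ (fun x y => glim (fun n => q n x y - b n x y))); last first.
  by move=> x y; rewrite glimB // qK.
rewrite (lform (fun n x y => q n x y - b n x y)) //; apply: glim_le.
  exact: bform.
apply: filterS (first_near_all [seq a.2 | a <- u] esurj) => n un.
by have [_ _ _ _] := hb n; apply.
Qed.

End kernel_limit.

(** * Averaging over an amenable group *)
(** For a symmetric real kernel the complex form is the sum of the real forms of
    the real and imaginary parts of the coefficients. *)
Lemma real_cond_neg_def (R : realType) (X : Type) (k : X -> X -> R) :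
  (forall x y, k x y = k y x) ->
  (forall u : seq (R * X), ev (fun=> 1) u = 0 -> fform k u u <= 0) ->
  cond_neg_def_kernel (fun x y => (k x y)%:C%C : R[i]).
Proof.
move=> ks kn; split; first by move=> x y; rewrite ks /= oppr0.
move=> n x c c0.
pose u (r : R[i] -> R) := [seq (r (c i), x i) | i <- enum 'I_n].
have uE r : fform k (u r) (u r) =
    \sum_i \sum_j r (c i) * r (c j) * k (x i) (x j).
  rewrite fformE big_map big_enum; apply: eq_bigr => i _ /=.
  by rewrite big_map big_enum.
have u0 r : r (\sum_i c i) = \sum_i r (c i) -> r 0 = 0 -> fform k (u r) (u r) <= 0.
  rewrite c0 => + r0; rewrite r0 => s0; apply: kn.
  by rewrite /ev big_map big_enum [RHS]s0; apply: eq_bigr => i _; rewrite mulr1.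
have hre := u0 _ (re_sum _ _ _) erefl; have him := u0 _ (im_sum _ _ _) erefl.
rewrite lecE /= re_sum im_sum; apply/andP; split.
  rewrite eq_sym; apply/eqP; under eq_bigr do rewrite im_sum.
  pose D i j := (complex.Re (c i) * complex.Im (c j)) * k (x i) (x j).
  transitivity (\sum_i \sum_j D j i - \sum_i \sum_j D i j).
    rewrite -sumrB; apply: eq_bigr => i _; rewrite -sumrB; apply: eq_bigr => j _.
    by rewrite /D !(imM, reM) /= ks; case: (c i) (c j) => [a b] [a' b'] /=; ring.
  by rewrite exchange_big subrr.
under eq_bigr do rewrite re_sum.
suff -> : \sum_i \sum_j complex.Re (c i * conjc (c j) * (k (x i) (x j))%:C%C) =
    fform k (u (@complex.Re R)) (u (@complex.Re R)) +
    fform k (u (@complex.Im R)) (u (@complex.Im R)) by lra.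
rewrite !uE -big_split; apply: eq_bigr => i _; rewrite -big_split.
apply: eq_bigr => j _; rewrite !(imM, reM) /=.
by case: (c i) (c j) => [a b] [a' b'] /=; ring.
Qed.

Section amenable_average.
Context (R : realType) (G : groupType).
Hypothesis amG : amenable R G.

(** The mean integrates the translates of [k], and an invariant kernel is a
    function of [y^-1 x]. The last clause keeps the inequalities: the form of [p]
    is invariant, so they are averaged along the translates of [u]. *)
Lemma average_kernel (k : G -> G -> R) : (exists C : R, forall x y, `|k x y| <= C) ->
  exists b : G -> R,
  [/\ (forall x y, k x y = k y x) -> forall x, b x^-1%g = b x,
      forall c : R, (forall x, k x x = c) -> b 1%g = c
    & forall (p : G -> R) (u : seq (R * G)),
        (forall g : G, 0 <= fform (fun x y => p (y^-1 * x)%g + k x y) (fpush (fun x => g * x)%g u)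
           (fpush (fun x => g * x)%g u)) ->
        0 <= fform (fun x y => p (y^-1 * x)%g + b (y^-1 * x)%g) u u].
Proof.
move=> [C kC].
have [mu [mu0 mu1 muU muG]] := amG.
pose F x y (z : G) : R := k (z^-1 * x)%g (z^-1 * y)%g.
have bF x y : bounded_fct (F x y) by exists C => z; exact: kC.
pose M := mint mu.
have Minv x y (g : G) : M (F (g * x)%g (g * y)%g) = M (F x y).
  have le x' y' (h : G) : M (F x' y') <= M (F (h * x')%g (h * y')%g).
    have -> : F (h * x')%g (h * y')%g = (fun z => F x' y' (h^-1 * z)%g).
      by apply/funext => z; rewrite /F invgM invgK !mulgA.
    apply: (mint_invariant mu0 mu1 muU (h' := fun z => h * z)%g) => //.
    - by move=> z; rewrite mulgA mulgV mul1g.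
    - by move=> z; rewrite mulgA mulVg mul1g.
  apply/eqP; rewrite eq_le; apply/andP; split; last exact: le.
  by apply: le_trans (le _ _ g^-1%g) _; rewrite !mulgA mulVg !mul1g.
have bE x y : M (F (y^-1 * x)%g 1%g) = M (F x y).
  by rewrite -(Minv _ _ y) !mulgA mulgV mul1g mulg1.
exists (fun x => M (F x 1%g)); split.
- move=> ks x; rewrite -[x^-1%g]mulg1 bE; congr M.
  by apply/funext => z; exact: ks.
- move=> c kc; rewrite -[RHS](mint_cst mu0 mu1 muU); congr M.
  by apply/funext => z; exact: kc.
move=> p u h.
rewrite (@eq_fform _ _ _ (fun x y => M (fun z => p (y^-1 * x)%g + F x y z))); last first.
  move=> x y; rewrite bE /M mintD //; last exact: bounded_fct_cst.
  by rewrite mint_cst.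
have bpF x y : bounded_fct (fun z => p (y^-1 * x)%g + F x y z).
  by apply: bounded_fctD => //; exact: bounded_fct_cst.
rewrite fformE.
have -> : \sum_(a <- u) \sum_(b <- u) a.1 * b.1 * M (fun z => p (b.2^-1 * a.2)%g + F a.2 b.2 z) =
  M (fun z => \sum_(a <- u) \sum_(b <- u) a.1 * b.1 * (p (b.2^-1 * a.2)%g + F a.2 b.2 z)).
  rewrite /M mint_sum // => [|a]; last first.
    by apply: bounded_fct_sum => b; exact: bounded_fctZ.
  apply: eq_bigr => a _; rewrite mint_sum // => [|b]; last exact: bounded_fctZ.
  by apply: eq_bigr => b _; rewrite mintZ.
apply: mint_ge0 => // [|z].
  apply: bounded_fct_sum => a; apply: bounded_fct_sum => b.
  exact: bounded_fctZ.
have := h z^-1%g; rewrite fform_fpush fformE => h'.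
apply: le_trans h' _; rewrite le_eqVlt; apply/orP; left; apply/eqP.
apply: eq_bigr => a _; apply: eq_bigr => b _; rewrite /F; congr (_ * (p _ + _)).
by rewrite invgM invgK mulgA mulgK.
Qed.

End amenable_average.

Definition splits (R : realType) (G : groupType) (phi : G -> R) : Prop :=
  exists (psi : G -> R[i]) (H : realHilbertSpace R)
         (pi : G -> {linear H -> H}) (xi : H),
    [/\ cond_neg_def psi, psi 1%g = 0, orthogonal_rep pi
      & forall x : G,
          (phi x)%:C%C = psi x + (`|xi| ^+ 2 + inner H (pi x xi) xi)%:C%C].

(** Half of [phi 1] is carried by the positive definite part: the kernel
    decomposition puts the constant [phi 1 / 2] on the diagonal of [k], averaging
    keeps that constant and makes [k] invariant, and the Gelfand-Naimark-Segal
    construction turns the result into [inner H (pi x xi) xi]. *)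
Lemma amenable_splitting (R : realType) (G : groupType) :
  countable [set: G] -> amenable R G -> forall phi : G -> R,
  symmetric_fun phi ->
  (forall t : R, 0 < t -> B2norm_le1 (fun x => (expR (- t * phi x))%:C%C)) ->
  splits phi.
Proof.
move=> /(countable_enumeration 1%g)[e esurj] amG phi phis phiB.
pose K x y := phi (y^-1 * x)%g.
have Ksym x y : K x y = K y x by rewrite /K -phis invgM invgK.
have Kd x : K x x = phi 1%g by rewrite /K mulVg.
have exps (t : R) : 0 < t -> forall n (p : 'I_n -> G), injective p ->
    forall A : 'M[R]_n, mx_contractive A ->
    mx_contractive (\matrix_(i, j) (expR (- t * K (p i) (p j)) * A i j)).
  move=> t0 n p pinj A cA; have [km k1] := phiB t t0.
  exact: (schur_norm_le1_section (k := fun x y => expR (- t * K x y)) pinj km k1 cA).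
have [k [ksym kpos kd kC kneg]] := exp_section_limit Ksym Kd esurj exps.
have [b [bsym bd bpos]] := average_kernel amG kC.
have {}bsym := bsym ksym; have {}bd := bd _ kd.
have bp : psd (fun x y => b (y^-1 * x)%g).
  move=> u; have := bpos (fun=> 0) u.
  rewrite -[X in _ -> 0 <= X](@eq_fform _ _ (fun x y => 0 + b (y^-1 * x)%g)); last first.
    by move=> x y; rewrite add0r.
  apply=> g; rewrite (@eq_fform _ _ _ k) //.
  by move=> x y; rewrite add0r.
have bn u : ev (fun=> 1) u = 0 ->
    fform (fun x y => phi (y^-1 * x)%g - b (y^-1 * x)%g) u u <= 0.
  move=> u0; rewrite -oppr_ge0 -mulN1r -fformZk.
  rewrite (@eq_fform _ _ _ (fun x y => - phi (y^-1 * x)%g + b (y^-1 * x)%g)); last first.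
    by move=> x y; ring.
  apply: (bpos (fun x => - phi x)) => g.
  have := kneg (fpush (fun x => g * x)%g u); rewrite ev_fpush => /(_ u0).
  rewrite -oppr_ge0 -mulN1r -fformZk.
  congr (0 <= _); apply: eq_fform => x y; rewrite /K; ring.
have [H [pi [xi [rep pib]]]] := real_gns bp bsym.
have xi2 : `|xi| ^+ 2 = phi 1%g / 2.
  by rewrite sqr_norm_inner -bd -pib; case: rep => ->.
exists (fun x => (phi x - (phi 1%g / 2 + b x))%:C%C), H, pi, xi; split.
- apply: (@real_cond_neg_def _ _
    (fun x y => phi (y^-1 * x)%g - (phi 1%g / 2 + b (y^-1 * x)%g))).
    move=> x y; rewrite -[phi (y^-1 * x)%g]phis -[b (y^-1 * x)%g]bsym.
    by rewrite invgM invgK.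
  move=> u u0; have h := bn u u0.
  rewrite (@eq_fform _ _ (fun x y => phi (y^-1 * x)%g - (phi 1%g / 2 + b (y^-1 * x)%g))
    (fun x y => phi (y^-1 * x)%g - b (y^-1 * x)%g - phi 1%g / 2)); last first.
    by move=> x y; ring.
  by rewrite fformBk fform_cstk u0 mulr0 subr0.
- by rewrite bd (_ : _ - _ = 0) //; field.
- exact: rep.
by move=> x; rewrite xi2 pib -rmorphD /= subrK.
Qed.

(** * Schur multipliers from their finite sections *)
Section sections_to_schur.
Context (R : realType) (X : choiceType).
Implicit Types (M N : X -> X -> R[i]) (f g : X -> R[i]) (s r : seq X).

(** Sesquilinear forms are replaced by the real part of bilinear ones: the vectors
    range over all complex functions, so conjugating one of them changes
    nothing. *)
Definition cbil M s g f : R :=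
  complex.Re (\sum_(x <- s) \sum_(y <- s) g x * M x y * f y).

Definition csq s f : R := \sum_(x <- s) cmod (f x) ^+ 2.

(** The arithmetic-geometric form of the bound [c |f| |g|] on the finite sections
    of the matrix [N]; scaling [f] against [g] recovers the product form. *)
Definition sections_le (c : R) N : Prop := forall s, uniq s -> forall f g,
  cbil N s g f <= (c ^+ 2 * csq s f + csq s g) / 2.

(** A condition on finite sums only, which passes to products, sums and pointwise
    limits of kernels before any operator is constructed;
    [schur_sections_multiplier] returns to operators. *)
Definition schur_sections_le (c : R) (k : X -> X -> R) : Prop :=
  forall s, uniq s -> forall M,
  (forall f g, cbil M s g f <= (csq s f + csq s g) / 2) ->
  forall f g, cbil (fun x y => (k x y)%:C%C * M x y) s g f <=
    c * (csq s f + csq s g) / 2.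

Lemma csq_ge0 s f : 0 <= csq s f.
Proof. by apply: sumr_ge0 => x _; exact: sqr_ge0. Qed.

Lemma csqZ s (c : R) f : csq s (fun x => c%:C%C * f x) = c ^+ 2 * csq s f.
Proof.
rewrite /csq mulr_sumr; apply: eq_bigr => x _.
by rewrite cmodM exprMn cmod_real.
Qed.

Lemma cbilE M s g f : cbil M s g f =
  complex.Re (\sum_(x <- s) g x * (\sum_(y <- s) M x y * f y)).
Proof.
rewrite /cbil; congr complex.Re; apply: eq_bigr => x _; rewrite mulr_sumr.
by apply: eq_bigr => y _; rewrite mulrA.
Qed.

Lemma cbilZ M s (c : R) g f :
  cbil M s g (fun x => c%:C%C * f x) = c * cbil M s g f.
Proof.
rewrite /cbil !re_sum mulr_sumr; apply: eq_bigr => x _.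
rewrite !re_sum mulr_sumr; apply: eq_bigr => y _.
by rewrite mulrCA reM /= mul0r subr0.
Qed.

Lemma re_mul_le (z w : R[i]) :
  complex.Re (z * w) <= (cmod z ^+ 2 + cmod w ^+ 2) / 2.
Proof.
rewrite !cmod_sqr reM; case: z w => [a b] [a' b'] /=.
by have := sqr_ge0 (a - a'); have := sqr_ge0 (b + b'); lra.
Qed.

Definition seq_vec s f : l2 R X := \sum_(y <- s) f y *: l2delta R y.

Lemma seq_vec_fin s f : seq_vec s f =
  fin_vec (tnth (in_tuple s)) (fun i => f (tnth (in_tuple s) i)).
Proof. by rewrite /seq_vec big_tnth. Qed.

Lemma seq_vec_norm s f : uniq s -> l2norm (seq_vec s f) ^+ 2 <= csq s f.
Proof.
move=> us; rewrite seq_vec_fin /csq big_tnth; apply: fin_vec_norm.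
by apply/tuple_uniqP.
Qed.

Lemma seq_vecE s f x : uniq s ->
  seq_vec s f x = if x \in s then f x else 0.
Proof.
move=> us; rewrite /seq_vec l2_sumE.
transitivity (\sum_(y <- s) f y * (x == y)%:R) => //.
case: ifPn => [xs|xs].
  rewrite (bigD1_seq x) //= eqxx mulr1 big1 ?addr0 // => y /negPf yx.
  by rewrite eq_sym yx mulr0.
rewrite big_seq big1 // => y ys; case: eqVneq => [xy|]; last by rewrite mulr0.
by rewrite -xy (negPf xs) in ys.
Qed.

Lemma op_seq_vec (A : {linear l2 R X -> l2 R X}) s f x :
  A (seq_vec s f) x = \sum_(y <- s) op_entry A x y * f y.
Proof.
rewrite /seq_vec linear_sum l2_sumE; apply: eq_bigr => y _ /=.
by rewrite linearZ -[LHS]/(f y * A (l2delta R y) x) mulrC.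
Qed.

Lemma op_sections_le (A : {linear l2 R X -> l2 R X}) c : 0 <= c ->
  (opnorm A <= c%:E)%E -> sections_le c (op_entry A).
Proof.
move=> c0 Ac s us f g; rewrite cbilE re_sum.
apply: (@le_trans _ _ ((csq s g + csq s (A (seq_vec s f))) / 2)).
  rewrite /csq -big_split mulr_suml; apply: ler_sum => x _ /=.
  by rewrite -op_seq_vec; exact: re_mul_le.
have h1 := l2norm_ge (A (seq_vec s f)) us.
have h2 := opnorm_bound (seq_vec s f) c0 Ac.
have h3 : l2norm (A (seq_vec s f)) ^+ 2 <= c ^+ 2 * csq s f.
  apply: (@le_trans _ _ ((c * l2norm (seq_vec s f)) ^+ 2)).
    by rewrite ler_sqr ?nnegrE ?mulr_ge0 ?l2norm_ge0.
  by rewrite exprMn ler_wpM2l ?sqr_ge0 // seq_vec_norm.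
rewrite -/(csq s _) in h1; lra.
Qed.

Lemma schur_sections_op k (A : {linear l2 R X -> l2 R X}) c : 0 < c ->
  schur_sections_le 1 k -> (opnorm A <= c%:E)%E ->
  sections_le c (fun x y => (k x y)%:C%C * op_entry A x y).
Proof.
move=> c0 k1 Ac s us f g.
pose M x y := c^-1%:C%C * op_entry A x y.
have cc : c%:C%C * c^-1%:C%C = 1 :> R[i].
  by rewrite -rmorphM /= mulfV ?gt_eqF.
have Mb f' g' : cbil M s g' f' <= (csq s f' + csq s g') / 2.
  have := op_sections_le (ltW c0) Ac us (fun x => c^-1%:C%C * f' x) g'.
  rewrite csqZ mulrA -exprMn mulfV ?gt_eqF // expr1n mul1r.
  congr (_ <= _); rewrite /cbil; congr complex.Re.
  apply: eq_bigr => x _; apply: eq_bigr => y _; rewrite /M; ring.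
have := k1 s us M Mb (fun x => c%:C%C * f x) g.
rewrite csqZ mul1r; congr (_ <= _); rewrite /cbil; congr complex.Re.
apply: eq_bigr => x _; apply: eq_bigr => y _.
rewrite /M -[RHS]mul1r -cc; ring.
Qed.

(** Different finite sets of rows and columns are covered by the section on their
    union, tested on the vector [f] against its own image. *)
Lemma sections_le_vec c N r s f : sections_le c N -> uniq r -> uniq s ->
  csq r (fun x => \sum_(y <- s) N x y * f y) <= c ^+ 2 * csq s f.
Proof.
move=> Nc ur us; pose z x := \sum_(y <- s) N x y * f y.
pose t := undup (r ++ s).
have ut : uniq t by exact: undup_uniq.
have sub (V : nmodType) (q : seq X) (F : X -> V) : uniq q -> {subset q <= t} ->
    \sum_(x <- t) (if x \in q then F x else 0) = \sum_(x <- q) F x.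
  move=> uq qt; rewrite -big_mkcond -big_filter; apply: perm_big.
  apply: uniq_perm => //; first exact: filter_uniq.
  by move=> x; rewrite mem_filter; apply/andP/idP => [[]//|xq]; split => //; exact: qt.
have rt : {subset r <= t} by move=> x xr; rewrite mem_undup mem_cat xr.
have st : {subset s <= t} by move=> x xs; rewrite mem_undup mem_cat xs orbT.
pose f' x := if x \in s then f x else 0.
pose g' x := if x \in r then conjc (z x) else 0.
have := Nc t ut f' g'.
have -> : csq t f' = csq s f.
  rewrite /csq -(sub _ s) //; apply: eq_bigr => x _; rewrite /f'.
  by case: ifP => // _; rewrite cmod0 expr0n.
have -> : csq t g' = csq r z.
  rewrite /csq -(sub _ r) //; apply: eq_bigr => x _; rewrite /g'.
  case: ifP => // _; last by rewrite cmod0 expr0n.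
  by rewrite !cmod_sqr; case: (z x) => a b /=; rewrite sqrrN.
suff -> : cbil N t g' f' = csq r z by lra.
rewrite cbilE re_sum /csq -(sub _ r) //; apply: eq_bigr => x _; rewrite /g'.
case: ifP => // _; last by rewrite mul0r.
have -> : \sum_(y <- t) N x y * f' y = z x.
  rewrite /z -(sub _ s) //; apply: eq_bigr => y _; rewrite /f'.
  by case: ifP => // _; rewrite mulr0.
by rewrite cmod_sqr reM; case: (z x) => a b /=; ring.
Qed.

(** The error made by truncating the vector is controlled by the unspecified
    bound [D] of the operator, and is absorbed by
    [(p + q) ^ 2 <= (1 + d) p ^ 2 + (1 + 1 / d) q ^ 2]. *)
Lemma opnorm_le_sections (B : {linear l2 R X -> l2 R X}) c : 0 <= c ->
  bounded_op B -> sections_le c (op_entry B) -> (opnorm B <= c%:E)%E.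
Proof.
move=> c0 /bounded_opP[D D0 BD] Bc.
apply: opnorm_le => // f; apply: l2norm_le; first by rewrite mulr_ge0 ?l2norm_ge0.
move=> r ur; rewrite exprMn; set L := l2norm f ^+ 2.
have L0 : 0 <= L by exact: sqr_ge0.
(* Finitely supported vectors are dense. *)
have approx (e : R) : 0 < e -> exists2 s, uniq s & l2norm (f - seq_vec s f) ^+ 2 <= e.
  move=> e0.
  have [s us Ls] : exists2 s, uniq s & L - e <= csq s f.
    apply: contrapT => ns.
    have : (sqsum f <= (L - e)%:E)%E.
      apply: sqsum_le => s us; rewrite leNgt; apply/negP => h.
      by apply: ns; exists s => //; exact: ltW.
    by rewrite sqsum_l2 lee_fin -/L; lra.
  exists s => //; rewrite -[leRHS](sqr_sqrtr (ltW e0)).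
  rewrite ler_sqr ?nnegrE ?l2norm_ge0 ?sqrtr_ge0 //.
  apply: l2norm_le; first exact: sqrtr_ge0.
  move=> t ut; rewrite (sqr_sqrtr (ltW e0)).
  have fE x : (f - seq_vec s f) x = if x \in s then 0 else f x.
    rewrite -[LHS]/(f x - seq_vec s f x) seq_vecE //.
    by case: ifP => _; rewrite ?subrr ?subr0.
  have uts : uniq ([seq x <- t | x \notin s] ++ s).
    rewrite cat_uniq filter_uniq // us andbT /=; apply/hasPn => x xs.
    by rewrite mem_filter xs.
  have := l2norm_ge f uts; rewrite big_cat /= big_filter -/L -/(csq s f) => h.
  have -> : \sum_(x <- t) cmod ((f - seq_vec s f) x) ^+ 2 =
      \sum_(x <- t | x \notin s) cmod (f x) ^+ 2.
    rewrite [RHS]big_mkcond; apply: eq_bigr => x _; rewrite fE.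
    by case: (x \in s); rewrite ?cmod0 ?expr0n.
  lra.
apply: (@le_of_le_addMeps _ _ _ (c ^+ 2 * L)); first by rewrite mulr_ge0 // sqr_ge0.
move=> d d0.
apply: (@le_of_le_addMeps _ _ _ ((1 + d^-1) * D ^+ 2)).
  by rewrite mulr_ge0 ?sqr_ge0 // addr_ge0 // invr_ge0 ltW.
move=> e e0; have [s us se] := approx e e0.
have h1 : csq r (B (seq_vec s f)) <= c ^+ 2 * L.
  have := sections_le_vec f Bc ur us.
  under [csq r _]eq_bigr do rewrite -op_seq_vec.
  move=> h; apply: le_trans h _; apply: ler_wpM2l; first exact: sqr_ge0.
  exact: l2norm_ge.
have h2 : csq r (B (f - seq_vec s f)) <= D ^+ 2 * e.
  apply: le_trans (l2norm_ge _ ur) _.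
  apply: (@le_trans _ _ ((D * l2norm (f - seq_vec s f)) ^+ 2)).
    rewrite ler_sqr ?nnegrE ?mulr_ge0 ?l2norm_ge0 ?(ltW D0) //.
    exact: opnorm_bound (ltW D0) BD.
  by rewrite exprMn ler_wpM2l ?sqr_ge0.
have h3 : \sum_(x <- r) cmod (B f x) ^+ 2 <=
    (1 + d) * csq r (B (seq_vec s f)) + (1 + d^-1) * csq r (B (f - seq_vec s f)).
  rewrite /csq !mulr_sumr -big_split; apply: ler_sum => x _ /=.
  have -> : B f x = B (seq_vec s f) x + B (f - seq_vec s f) x.
    rewrite linearB -[X in _ = _ + X]/(B f x - B (seq_vec s f) x); ring.
  rewrite !cmod_sqr reD imD.
  set a := complex.Re _; set b := complex.Re _; set a' := complex.Im _; set b' := complex.Im _.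
  have key (p q : R) : (p + q) ^+ 2 <= (1 + d) * p ^+ 2 + (1 + d^-1) * q ^+ 2.
    rewrite -subr_ge0.
    have -> : (1 + d) * p ^+ 2 + (1 + d^-1) * q ^+ 2 - (p + q) ^+ 2 =
        d^-1 * (d * p - q) ^+ 2 by field; rewrite gt_eqF.
    by rewrite mulr_ge0 ?sqr_ge0 // invr_ge0 ltW.
  by have := key a b; have := key a' b'; lra.
apply: le_trans h3 _.
have d1 : 0 <= 1 + d by lra.
have d2 : 0 <= 1 + d^-1 by rewrite addr_ge0 // invr_ge0 ltW.
have := ler_wpM2l d1 h1; have := ler_wpM2l d2 h2; lra.
Qed.

End sections_to_schur.

Section limit_operator.
Context (R : realType) (X : choiceType) (e : nat -> X).
Hypothesis esurj : forall x, exists n, e n = x.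
Variables (c : R) (N : X -> X -> R[i]).
Hypotheses (c0 : 0 < c) (Nc : sections_le c N).
Implicit Types (f : l2 R X).

Let z f n x : R[i] := \sum_(y <- first e n) N x y * f y.

Let z_le f n r : uniq r -> csq r (z f n) <= c ^+ 2 * l2norm f ^+ 2.
Proof.
move=> ur; apply: le_trans (sections_le_vec f Nc ur (first_uniq e n)) _.
by apply: ler_wpM2l; [exact: sqr_ge0|exact: l2norm_ge (first_uniq e n)].
Qed.

Let z_bound f x n : `|complex.Re (z f n x)| <= c * l2norm f /\
  `|complex.Im (z f n x)| <= c * l2norm f.
Proof.
have := @z_le f n [:: x] isT; rewrite /csq big_seq1 cmod_sqr -exprMn => h.
have L0 : 0 <= c * l2norm f by rewrite mulr_ge0 ?l2norm_ge0 ?ltW.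
have := sqr_ge0 (complex.Re (z f n x)); have := sqr_ge0 (complex.Im (z f n x)).
move=> i0 r0; split; rewrite -ler_sqr ?nnegrE // real_normK ?num_real //; lra.
Qed.

Let bre f x : bounded_seq (fun n => complex.Re (z f n x)).
Proof. by exists (c * l2norm f) => n; case: (z_bound f x n). Qed.

Let bim f x : bounded_seq (fun n => complex.Im (z f n x)).
Proof. by exists (c * l2norm f) => n; case: (z_bound f x n). Qed.

Let lim_fun f x : R[i] :=
  (glim (fun n => complex.Re (z f n x)) +i* glim (fun n => complex.Im (z f n x)))%C.

Let lim_le f r : uniq r -> csq r (lim_fun f) <= c ^+ 2 * l2norm f ^+ 2.
Proof.
move=> ur; pose a x := complex.Re (lim_fun f x); pose b x := complex.Im (lim_fun f x).
have h : csq r (lim_fun f) = glim (fun n => \sum_(x <- r)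
    (a x * complex.Re (z f n x) + b x * complex.Im (z f n x))).
  rewrite glim_sum => [|x]; last by apply: boundedD; exact: boundedZ.
  apply: eq_bigr => x _; rewrite glimD; [|exact: boundedZ|exact: boundedZ].
  by rewrite !glimZ // cmod_sqr -!expr2.
suff : csq r (lim_fun f) <= (csq r (lim_fun f) + c ^+ 2 * l2norm f ^+ 2) / 2 by lra.
rewrite {1}h; apply: glim_le.
  by apply: bounded_sum => x; apply: boundedD; exact: boundedZ.
apply: nearW => n.
apply: (@le_trans _ _ ((csq r (lim_fun f) + csq r (z f n)) / 2)); last first.
  by have := z_le f n ur; lra.
have key (v w : R[i]) : complex.Re v * complex.Re w + complex.Im v * complex.Im w <=
    (cmod v ^+ 2 + cmod w ^+ 2) / 2.
  rewrite !cmod_sqr; have := sqr_ge0 (complex.Re v - complex.Re w).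
  by have := sqr_ge0 (complex.Im v - complex.Im w); lra.
rewrite /csq -big_split mulr_suml; apply: ler_sum => x _; exact: key.
Qed.

Let lim_summable f : lim_fun f \in @square_summable R X.
Proof.
apply/asboolP; apply: le_lt_trans (_ : (_ <= (c ^+ 2 * l2norm f ^+ 2)%:E)%E) _.
  by apply: sqsum_le => s us; exact: lim_le.
by rewrite ltry.
Qed.

Let lim_vec f : l2 R X := L2 (lim_summable f).

Let zlin a f g n x : z (a *: f + g) n x = a * z f n x + z g n x.
Proof.
rewrite /z mulr_sumr -big_split; apply: eq_bigr => y _ /=.
by rewrite mulrDr; congr (_ + _); rewrite mulrCA.
Qed.

Let lim_linear : linear lim_vec.
Proof.
move=> a f g; apply/val_inj/funext => x /=.
rewrite -[RHS]/(a * lim_fun f x + lim_fun g x).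
apply/eqP; rewrite eq_complex reD imD reM imM /=; apply/andP; split; apply/eqP.
  rewrite -!glimZ // -glimB; [|exact: boundedZ|exact: boundedZ].
  rewrite -glimD //; last first.
    by apply: boundedD; [exact: boundedZ|apply: boundedN; exact: boundedZ].
  by congr glim; apply/funext => n; rewrite zlin reD reM.
rewrite -!glimZ // -glimD; [|exact: boundedZ|exact: boundedZ].
rewrite -glimD //; last by apply: boundedD; exact: boundedZ.
by congr glim; apply/funext => n; rewrite zlin imD imM.
Qed.

(** The operator is built row by row as a generalized limit of partial sums, so
    that no convergence has to be checked. *)
Lemma operator_of_sections : exists B : {linear l2 R X -> l2 R X},
  (opnorm B <= c%:E)%E /\ forall x y, op_entry B x y = N x y.
Proof.
exists (HB.pack_for {linear l2 R X -> l2 R X} lim_vec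
  (GRing.isLinear.Build R[i] (l2 R X) (l2 R X) *:%R lim_vec lim_linear)); split.
  apply: opnorm_le => [|f]; first exact: ltW.
  apply: l2norm_le => [|s us]; first by rewrite mulr_ge0 ?l2norm_ge0 ?ltW.
  by rewrite exprMn; exact: lim_le.
move=> x y; rewrite /op_entry /= /lim_fun.
have zN : \forall n \near \oo, z (l2delta R y) n x = N x y.
  apply: filterS (first_near (esurj y)) => n yn.
  rewrite /z (bigD1_seq y) ?first_uniq //= eqxx mulr1 big1 ?addr0 // => j /negPf->.
  by rewrite mulr0.
apply/eqP; rewrite eq_complex /=; apply/andP; split; apply/eqP/glim_near => //;
  by apply: filterS zN => n ->.
Qed.

End limit_operator.

Section schur_criterion.
Context (R : realType) (X : choiceType) (e : nat -> X).
Hypothesis esurj : forall x, exists n, e n = x.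

(** The product matrix has bounded sections, which are those of an operator; the
    bound on its norm is read off from the sections again. *)
Lemma schur_sections_multiplier (k : X -> X -> R) : schur_sections_le 1 k ->
  schur_multiplier (fun x y => (k x y)%:C%C : R[i]) /\
  (schur_norm (fun x y => (k x y)%:C%C : R[i]) <= 1)%E.
Proof.
move=> k1; split.
  move=> A /bounded_opP[c c0 Ac].
  have [B [Bc BN]] := operator_of_sections esurj c0 (schur_sections_op c0 k1 Ac).
  exists B; split => //.
  by apply: le_lt_trans Bc _; rewrite ltry.
apply: ge_ereal_sup => _ [A [B [Ab A1 [Bb BN] ->]]].
apply: opnorm_le_sections => //.
have -> : op_entry B = fun x y => (k x y)%:C%C * op_entry A x y.
  by apply/funext => x; apply/funext => y.
exact: schur_sections_op.
Qed.

Lemma schur_sections_one : schur_sections_le 1 (fun _ _ : X => 1 : R).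
Proof.
move=> s us M Mb f g; have := Mb f g; rewrite mul1r; congr (_ <= _).
rewrite /cbil; congr complex.Re; apply: eq_bigr => x _; apply: eq_bigr => y _.
by rewrite mul1r.
Qed.

Lemma schur_sections_mul (k k' : X -> X -> R) :
  schur_sections_le 1 k -> schur_sections_le 1 k' ->
  schur_sections_le 1 (fun x y => k x y * k' x y).
Proof.
move=> h h' s us M Mb f g.
have kM : forall f g, cbil (fun x y => (k' x y)%:C%C * M x y) s g f <=
    (csq s f + csq s g) / 2.
  by move=> f' g'; have := h' s us M Mb f' g'; rewrite mul1r.
have := h s us _ kM f g; congr (_ <= _); rewrite /cbil; congr complex.Re.
by apply: eq_bigr => x _; apply: eq_bigr => y _; rewrite rmorphM /= !mulrA.
Qed.

Lemma cbilD (M M' : X -> X -> R[i]) s f g :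
  cbil (fun x y => M x y + M' x y) s g f = cbil M s g f + cbil M' s g f.
Proof.
rewrite /cbil -reD -big_split; congr complex.Re; apply: eq_bigr => x _ /=.
by rewrite -big_split; apply: eq_bigr => y _ /=; rewrite mulrDr mulrDl.
Qed.

Lemma schur_sections_add (k k' : X -> X -> R) c c' :
  schur_sections_le c k -> schur_sections_le c' k' ->
  schur_sections_le (c + c') (fun x y => k x y + k' x y).
Proof.
move=> h h' s us M Mb f g.
have -> : cbil (fun x y => (k x y + k' x y)%:C%C * M x y) s g f =
    cbil (fun x y => (k x y)%:C%C * M x y) s g f +
    cbil (fun x y => (k' x y)%:C%C * M x y) s g f.
  rewrite -cbilD /cbil; congr complex.Re.
  apply: eq_bigr => x _; apply: eq_bigr => y _; congr (_ * _ * _).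
  by rewrite rmorphD mulrDl.
by have := h s us M Mb f g; have := h' s us M Mb f g; lra.
Qed.

Lemma schur_sections_scale (k : X -> X -> R) c a : 0 <= a ->
  schur_sections_le c k -> schur_sections_le (a * c) (fun x y => a * k x y).
Proof.
move=> a0 h s us M Mb f g.
have -> : cbil (fun x y => (a * k x y)%:C%C * M x y) s g f =
    a * cbil (fun x y => (k x y)%:C%C * M x y) s g f.
  rewrite -cbilZ /cbil; congr complex.Re.
  apply: eq_bigr => x _; apply: eq_bigr => y _; rewrite rmorphM /=; ring.
by have := ler_wpM2l a0 (h s us M Mb f g); rewrite !mulrA.
Qed.

Lemma schur_sections_limit (k : nat -> X -> X -> R) l c :
  (forall n, schur_sections_le c (k n)) ->
  (forall x y, (fun n => k n x y) @ \oo --> l x y) -> schur_sections_le c l.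
Proof.
move=> h kl s us M Mb f g.
pose a x y := complex.Re (g x * M x y * f y).
have cE k' : cbil (fun x y => (k' x y)%:C%C * M x y) s g f =
    \sum_(x <- s) \sum_(y <- s) k' x y * a x y.
  rewrite /cbil re_sum; apply: eq_bigr => x _; rewrite re_sum; apply: eq_bigr => y _.
  have -> : g x * ((k' x y)%:C%C * M x y) * f y = (k' x y)%:C%C * (g x * M x y * f y).
    by ring.
  by rewrite reM /= mul0r subr0.
have bk x y : bounded_seq (fun n => k n x y) by exact: cvg_bounded_seq (kl x y).
have bka x y : bounded_seq (fun n => k n x y * a x y).
  have := boundedZ (a x y) (bk x y); congr bounded_seq.
  by apply/funext => n; rewrite mulrC.
have -> : cbil (fun x y => (l x y)%:C%C * M x y) s g f =
    glim (fun n => cbil (fun x y => (k n x y)%:C%C * M x y) s g f).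
  rewrite cE.
  have -> : (fun n => cbil (fun x y => (k n x y)%:C%C * M x y) s g f) =
      (fun n => \sum_(x <- s) \sum_(y <- s) k n x y * a x y).
    by apply/funext => n; rewrite cE.
  rewrite glim_sum => [|x]; last exact: bounded_sum.
  apply: eq_bigr => x _; rewrite glim_sum //; apply: eq_bigr => y _.
  rewrite -(glim_cvg (bk x y) (kl x y)) mulrC -glimZ //.
  by congr glim; apply/funext => n; rewrite mulrC.
apply: glim_le; last by apply: nearW => n; exact: h.
have -> : (fun n => cbil (fun x y => (k n x y)%:C%C * M x y) s g f) =
    (fun n => \sum_(x <- s) \sum_(y <- s) k n x y * a x y).
  by apply/funext => n; rewrite cE.
by apply: bounded_sum => x; exact: bounded_sum.
Qed.

Lemma eq_schur_sections (k k' : X -> X -> R) c : k =2 k' ->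
  schur_sections_le c k -> schur_sections_le c k'.
Proof.
move=> kk'; congr schur_sections_le.
by apply/funext => x; apply/funext => y; rewrite kk'.
Qed.

(** Schur contractions are closed under products, convex combinations and
    pointwise limits, and [exp (- t (1 - k))] is a power series in [k] with
    coefficients [exp (- t) t ^ j / j!], which have sum 1. *)
Lemma schur_sections_exp (k : X -> X -> R) (t : R) : 0 <= t ->
  schur_sections_le 1 k ->
  schur_sections_le 1 (fun x y => expR (- t * (1 - k x y))).
Proof.
move=> t0 k1.
pose co (j : nat) : R := expR (- t) * (t ^+ j / j`!%:R).
have co0 j : 0 <= co j.
  by rewrite mulr_ge0 ?expR_ge0 // mulr_ge0 ?exprn_ge0 // invr_ge0.
have kp j : schur_sections_le 1 (fun x y => k x y ^+ j).
  elim: j => [|j IH].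
    by apply: eq_schur_sections schur_sections_one => x y; rewrite expr0.
  by apply: eq_schur_sections (schur_sections_mul k1 IH) => x y; rewrite exprS.
have S (n : nat) : schur_sections_le (\sum_(j < n) co j)
    (fun x y => \sum_(j < n) co j * k x y ^+ j).
  elim: n => [|n IH].
    have h0 := schur_sections_scale (lexx 0) schur_sections_one.
    rewrite mul0r in h0; rewrite big_ord0.
    by apply: eq_schur_sections h0 => x y; rewrite big_ord0.
  have h := schur_sections_add IH (schur_sections_scale (co0 n) (kp n)).
  rewrite mulr1 in h; rewrite big_ord_recr /=.
  by apply: eq_schur_sections h => x y; rewrite big_ord_recr.
have cvgS (a : R) : (fun n => \sum_(j < n) co j * a ^+ j) @ \oo --> expR (- t * (1 - a)).
  have -> : expR (- t * (1 - a)) = expR (- t) * expR (t * a).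
    by rewrite -expRD; congr expR; ring.
  have -> : (fun n => \sum_(j < n) co j * a ^+ j) =
      (fun n => expR (- t) * series (exp_coeff (t * a)) n).
    apply/funext => n; rewrite seriesEord /= mulr_sumr; apply: eq_bigr => j _.
    by rewrite /co /exp_coeff /= exprMn; ring.
  apply: cvgM; [exact: cvg_cst|exact: is_cvg_series_exp_coeff].
have co1 n : \sum_(j < n) co j <= 1.
  have co_nd : nondecreasing_seq (fun n => \sum_(j < n) co j).
    by apply/nondecreasing_seqP => m; rewrite big_ord_recr lerDl.
  have c1 := cvgS 1; rewrite subrr mulr0 expR0 in c1.
  have e1 : (fun n => \sum_(j < n) co j * 1 ^+ j) = (fun n => \sum_(j < n) co j).
    by apply/funext => m; apply: eq_bigr => j _; rewrite expr1n mulr1.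
  rewrite e1 in c1.
  have cv : cvgn (fun n => \sum_(j < n) co j) by apply/cvg_ex; exists 1.
  have := nondecreasing_cvgn_le co_nd cv n.
  by rewrite (cvg_lim _ c1) //.
apply: (@schur_sections_limit (fun n x y => \sum_(j < n) co j * k x y ^+ j)).
  move=> n s us M Mb f g; apply: le_trans (S n s us M Mb f g) _.
  by rewrite ler_pM2r // ler_wpM2r // addr_ge0 // csq_ge0.
by move=> x y; exact: cvgS.
Qed.

(** The columns of a contraction have norm at most 1, so by Cauchy-Schwarz in each
    row the Schur product with [k] maps [f] to a vector of norm at most that of [f]. *)
Lemma schur_sections_row (k : X -> X -> R) :
  (forall s x, uniq s -> \sum_(y <- s) k x y ^+ 2 <= 1) -> schur_sections_le 1 k.
Proof.
move=> rows s us M Mb f g.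
have cols y : y \in s -> \sum_(x <- s) cmod (M x y) ^+ 2 <= 1.
  move=> ys; pose f0 x : R[i] := (x == y)%:R.
  have := Mb f0 (fun x => conjc (M x y)).
  have -> : csq s f0 = 1.
    rewrite /csq (bigD1_seq y) //= /f0 eqxx.
    rewrite /cmod ComplexField.Normc.normc1 expr1n big1 ?addr0 // => x /negPf->.
    by rewrite ComplexField.Normc.normc0 expr0n.
  have cc (z : R[i]) : cmod (conjc z) = cmod z by rewrite /cmod; case: z => a b /=; rewrite sqrrN.
  have -> : csq s (fun x => conjc (M x y)) = \sum_(x <- s) cmod (M x y) ^+ 2.
    by apply: eq_bigr => x _; rewrite cc.
  have -> : cbil M s (fun x => conjc (M x y)) f0 = \sum_(x <- s) cmod (M x y) ^+ 2.
    rewrite cbilE re_sum; apply: eq_bigr => x _.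
    rewrite (bigD1_seq y) //= /f0 eqxx mulr1 big1 ?addr0 => [|x' /negPf->]; last first.
      by rewrite mulr0.
    by rewrite cmod_sqr reM; case: (M x y) => a b /=; ring.
  lra.
rewrite mul1r cbilE re_sum.
apply: (@le_trans _ _ ((csq s g + \sum_(x <- s) \sum_(y <- s) cmod (M x y) ^+ 2 * cmod (f y) ^+ 2) / 2)).
  rewrite /csq -big_split mulr_suml; apply: ler_sum => x _ /=.
  apply: le_trans (re_mul_le _ _) _.
  rewrite ler_pM2r ?invr_gt0 // lerD2l.
  have CS (h : X -> R) : (\sum_(y <- s) k x y * h y) ^+ 2 <= \sum_(y <- s) h y ^+ 2.
    set P := \sum_(y <- s) k x y * h y.
    have : 0 <= \sum_(y <- s) (P * k x y - h y) ^+ 2.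
      by apply: sumr_ge0 => y _; exact: sqr_ge0.
    have -> : \sum_(y <- s) (P * k x y - h y) ^+ 2 =
        P ^+ 2 * (\sum_(y <- s) k x y ^+ 2) - 2 * P * P + \sum_(y <- s) h y ^+ 2.
      have -> : 2 * P * P = \sum_(y <- s) 2 * P * (k x y * h y).
        by rewrite -mulr_sumr.
      rewrite mulr_sumr -sumrB -big_split; apply: eq_bigr => y _ /=; ring.
    by have := rows s x us; have := sqr_ge0 P; nra.
  rewrite cmod_sqr re_sum im_sum.
  have -> : \sum_(y <- s) complex.Re ((k x y)%:C%C * M x y * f y) =
      \sum_(y <- s) k x y * complex.Re (M x y * f y).
    by apply: eq_bigr => y _; rewrite -mulrA reM /= mul0r subr0.
  have -> : \sum_(y <- s) complex.Im ((k x y)%:C%C * M x y * f y) =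
      \sum_(y <- s) k x y * complex.Im (M x y * f y).
    by apply: eq_bigr => y _; rewrite -mulrA imM /= mul0r addr0.
  apply: le_trans (lerD (CS _) (CS _)) _; rewrite -big_split le_eqVlt.
  apply/orP; left; apply/eqP; apply: eq_bigr => y _ /=.
  by rewrite -cmod_sqr cmodM exprMn.
rewrite ler_pM2r ?invr_gt0 // [leRHS]addrC lerD2l exchange_big /csq.
rewrite !big_seq; apply: ler_sum => y ys.
rewrite -mulr_suml; apply: ler_piMl; first exact: sqr_ge0.
exact: cols.
Qed.

Lemma schur_sections_tr (k : X -> X -> R) :
  schur_sections_le 1 (fun x y => k y x) -> schur_sections_le 1 k.
Proof.
have tr M s g f : cbil M s g f = cbil (fun x y => M y x) s f g.
  rewrite /cbil exchange_big; congr complex.Re; apply: eq_bigr => x _.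
  by apply: eq_bigr => y _; ring.
move=> h s us M Mb f g; rewrite tr.
have := h s us (fun x y => M y x) _ g f; rewrite [csq s g + _]addrC; apply.
by move=> f' g'; rewrite -tr addrC; exact: Mb.
Qed.

End schur_criterion.

Section schur_weighted.
Context (R : realType) (X : choiceType).

(** Cutting the kernel according to the order of the weights of its two
    arguments bounds the rows of one half and the columns of the other. *)
Lemma schur_sections_weighted (k : X -> X -> R) (eta : X -> R) :
  (forall x, 0 < eta x) ->
  (forall s x, uniq s -> \sum_(y <- s) k x y ^+ 2 * eta y <= eta x) ->
  (forall s y, uniq s -> \sum_(x <- s) k x y ^+ 2 * eta x <= eta y) ->
  schur_sections_le 2 k.
Proof.
move=> eta0 row col.
have cut (k' : X -> X -> R) (P : rel X) :
    (forall s x, uniq s -> \sum_(y <- s) k' x y ^+ 2 * eta y <= eta x) ->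
    (forall x y, P x y -> eta x <= eta y) ->
    schur_sections_le 1 (fun x y => k' x y * (P x y)%:R).
  move=> row' Peta; apply: schur_sections_row => s x us.
  rewrite -(ler_pM2r (eta0 x)) mul1r; apply: le_trans (row' s x us).
  rewrite mulr_suml; apply: ler_sum => y _; rewrite exprMn -mulrA.
  apply: ler_wpM2l; first exact: sqr_ge0.
  case: (boolP (P x y)) => [/Peta|_]; first by rewrite expr1n mul1r.
  by rewrite expr0n mul0r ltW.
have h1 := cut k (fun x y => eta x <= eta y) row (fun _ _ h => h).
have h2 : schur_sections_le 1 (fun x y => k x y * (eta y < eta x)%R%:R).
  apply: schur_sections_tr.
  apply: (cut (fun x y => k y x) (fun x y => eta x < eta y)) => [s x us|x y].
    exact: col.
  exact: ltW.
have := schur_sections_add h1 h2; rewrite (_ : 1 + 1 = 2); last by lra.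
apply: eq_schur_sections => x y /=.
by case: leP => _; rewrite ?mulr1 ?mulr0 ?addr0 ?add0r.
Qed.

End schur_weighted.

(** * Random walks *)
Section words.
Context (R : realType) (G : groupType) (S : seq G).
Implicit Types (F : G -> R) (x g : G).

(** The words are listed with multiplicity, so that sums over them are sums over
    the paths of the random walk. *)
Fixpoint words n : seq G :=
  if n is n'.+1 then [seq (s * w)%g | s <- S, w <- words n'] else [:: 1%g].

Lemma sum_wordsS n F : \sum_(w <- words n.+1) F w =
  \sum_(s <- S) \sum_(w <- words n) F (s * w)%g.
Proof. by rewrite /= big_allpairs_dep. Qed.

Lemma sum_words0 F : \sum_(w <- words 0) F w = F 1%g.
Proof. by rewrite big_seq1. Qed.

Lemma sum_wordsSr n F : \sum_(w <- words n.+1) F w =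
  \sum_(w <- words n) \sum_(s <- S) F (w * s)%g.
Proof.
elim: n F => [|n IH] F.
  rewrite sum_wordsS sum_words0; apply: eq_bigr => s _.
  by rewrite sum_words0 mulg1 mul1g.
rewrite sum_wordsS [RHS]sum_wordsS; apply: eq_bigr => s _.
rewrite (IH (fun w => F (s * w)%g)); apply: eq_bigr => w _.
by apply: eq_bigr => t _; rewrite mulgA.
Qed.

(** Coincidences of two independent words, i.e. the squared l2-norm of the
    counting function of the words. *)
Definition coincidences n : R :=
  \sum_(w <- words n) \sum_(w' <- words n) (w == w')%:R.

Definition wcount n x : R := \sum_(w <- words n) (w == x)%:R.

Lemma wcount_ge0 n x : 0 <= wcount n x.
Proof. by apply: sumr_ge0 => w _. Qed.

Let vec n : seq (R * G) := [seq (1, w) | w <- words n].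

Let delta (A : pred G) (x y : G) : R := ((x == y) && A x)%:R.

Let delta_sym A x y : delta A x y = delta A y x.
Proof. by rewrite /delta eq_sym; case: eqVneq => [->|]. Qed.

Lemma ev_words L n : ev L (vec n) = \sum_(w <- words n) L w.
Proof. by rewrite /ev big_map; apply: eq_bigr => w _; rewrite mul1r. Qed.

Lemma coincidencesE n : coincidences n = fform (delta predT) (vec n) (vec n).
Proof.
rewrite /fform ev_words; apply: eq_bigr => w _; rewrite ev_words.
by apply: eq_bigr => w' _; rewrite /delta andbT.
Qed.

(** A single value of the counting function is at most its l2-norm. *)
Lemma wcount_le n x : wcount n x ^+ 2 <= coincidences n.
Proof.
have := fform_CauchySchwarz (vec n) [:: (1, x)] (@psd_diag R G predT) (delta_sym predT).
rewrite -coincidencesE.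
have -> : fform (delta predT) [:: (1, x)] [:: (1, x)] = 1.
  by rewrite fformE !big_seq1 /delta /= eqxx !mulr1.
rewrite mulr1; congr (_ ^+ 2 <= _).
rewrite /fform ev_words; apply: eq_bigr => w _.
by rewrite /ev big_seq1 /= mul1r andbT.
Qed.

Lemma coincidences0 : coincidences 0 = 1.
Proof. by rewrite /coincidences !big_seq1 eqxx. Qed.

Let N : R := (size S)%:R.

Lemma sum_words1 n : \sum_(w <- words n) 1 = N ^+ n.
Proof.
elim: n => [|n IH]; first by rewrite sum_words0.
rewrite sum_wordsS; under eq_bigr do rewrite IH.
by rewrite big_const_seq count_predT iter_addr_0 exprS mulr_natl.
Qed.

Hypothesis Ssym : forall F, \sum_(s <- S) F s^-1%g = \sum_(s <- S) F s.

Lemma sum_words_inv n F : \sum_(w <- words n) F w^-1%g = \sum_(w <- words n) F w.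
Proof.
elim: n F => [|n IH] F; first by rewrite !sum_words0 invg1.
rewrite sum_wordsS sum_wordsSr exchange_big [RHS]exchange_big /=.
transitivity (\sum_(s <- S) \sum_(w <- words n) F (w * s^-1)%g).
  rewrite exchange_big /=; apply: eq_bigr => s _.
  rewrite -(IH (fun w => F (w * s^-1)%g)).
  by apply: eq_bigr => w _; rewrite invgM.
exact: (Ssym (fun s => \sum_(w <- words n) F (w * s)%g)).
Qed.

Lemma wcount_inv n x : wcount n x^-1%g = wcount n x.
Proof.
rewrite /wcount -[RHS]sum_words_inv; apply: eq_bigr => w _.
by rewrite -[in LHS](inj_eq (@invg_inj G)) invgK.
Qed.

Lemma wcountS n x : wcount n.+1 x = \sum_(s <- S) wcount n (x * s)%g.
Proof.
rewrite /wcount sum_wordsSr exchange_big /=.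
rewrite -(Ssym (fun s => \sum_(w <- words n) (w == x * s)%g%:R)).
apply: eq_bigr => s _; apply: eq_bigr => w _.
by rewrite (can2_eq (mulgK s) (mulgVK s)).
Qed.

Section positive_supersolution.
Variables (e : nat -> G) (rho : R).
Hypothesis esurj : forall x, exists n, e n = x.
Hypotheses (N0 : 0 < N) (rho0 : 0 < rho) (rho1 : rho < 1).
Hypothesis decay : forall n, coincidences n.+1 <= rho * N ^+ 2 * coincidences n.

(* The distribution of the random walk after [n] steps. *)
Let P n x := wcount n x / N ^+ n.
(* The walk decays like [kap ^ n]; the ratio [r] lies strictly between 1 and
   [1 / kap]. *)
Let kap := Num.sqrt rho.
Let r := 2 / (1 + kap).

Let kap0 : 0 < kap. Proof. by rewrite sqrtr_gt0. Qed.

Let kap1 : kap < 1.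
Proof. by rewrite -sqrtr1 ltr_sqrt. Qed.

Let r1 : 1 < r.
Proof. by rewrite /r ltr_pdivlMr ?mul1r; have := kap0; have := kap1; lra. Qed.

Let q := r * kap.
Let q0 : 0 < q. Proof. by rewrite mulr_gt0 // (lt_trans ltr01). Qed.

Let q1 : q < 1.
Proof.
by rewrite /q /r mulrAC ltr_pdivrMr ?mul1r; have := kap0; have := kap1; lra.
Qed.

Let P_ge0 n x : 0 <= P n x.
Proof. by rewrite divr_ge0 ?wcount_ge0 // exprn_ge0 // ltW. Qed.

Let P_le n x : P n x <= kap ^+ n.
Proof.
have cn : coincidences n <= (rho * N ^+ 2) ^+ n.
  elim: n => [|n IH]; first by rewrite coincidences0 expr0.
  apply: le_trans (decay n) _; rewrite [leRHS]exprS ler_wpM2l //.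
  by rewrite mulr_ge0 ?sqr_ge0 // ltW.
have : wcount n x ^+ 2 <= (kap ^+ n * N ^+ n) ^+ 2.
  apply: le_trans (wcount_le n x) _; apply: le_trans cn _.
  have k2 : kap ^+ 2 = rho by rewrite /kap sqr_sqrtr // ltW.
  by rewrite -exprMn exprAC [(kap * N) ^+ 2]exprMn k2.
rewrite ler_sqr ?nnegrE ?wcount_ge0 ?mulr_ge0 ?exprn_ge0 ?(ltW N0) ?(ltW kap0) //.
by rewrite /P ler_pdivrMr // exprn_gt0.
Qed.

Let walk_weight n x : R := r ^+ n * P n x.

Lemma walk_weight_le1 n x : walk_weight n x <= 1.
Proof.
apply: (@le_trans _ _ (q ^+ n)); last by rewrite exprn_ile1 // ltW.
rewrite /walk_weight /q (exprMn n r kap) ler_wpM2l // exprn_ge0 //.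
by rewrite ltW // (lt_trans ltr01).
Qed.

Let h k : R := 2^-1 ^+ k.

Let geo (a : R) n : 0 <= a -> a < 1 -> \sum_(k < n) a ^+ k <= (1 - a)^-1.
Proof.
move=> a0 a1; have a10 : 0 < 1 - a by lra.
rewrite -[leRHS]mul1r ler_pdivlMr // mulrC -opprB mulNr -subrX1 opprB.
by rewrite gerBl exprn_ge0.
Qed.

Let C := (1 - q)^-1 * 2.

(* Partial sums of the resolvent of the walk started at all the points [e k], with
   summable coefficients [h k] that make the sum positive everywhere. *)
Let E n x : R :=
  \sum_(m < n) \sum_(k < n) h k * (r ^+ m * P m ((e k)^-1 * x)%g).

Let r_ge0 : 0 <= r. Proof. by rewrite ltW // (lt_trans ltr01). Qed.

Let h_ge0 k : 0 <= h k. Proof. by rewrite exprn_ge0 // invr_ge0. Qed.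

Let term_ge0 k m x : 0 <= h k * (r ^+ m * P m x).
Proof. by rewrite mulr_ge0 ?h_ge0 // mulr_ge0 ?P_ge0 ?exprn_ge0. Qed.

Let inner_le n m (F : nat -> G) :
  \sum_(k < n) h k * (r ^+ m * P m (F k)) <= q ^+ m * 2.
Proof.
apply: (@le_trans _ _ (\sum_(k < n) h k * q ^+ m)).
  apply: ler_sum => k _; rewrite ler_wpM2l ?h_ge0 //.
  by rewrite /q (exprMn m r kap) ler_wpM2l // exprn_ge0.
rewrite -mulr_suml mulrC ler_wpM2l ?exprn_ge0 ?(ltW q0) //.
have := @geo 2^-1 n; rewrite invr_ge0 => /(_ (ler0n _ _)).
have -> : (1 - 2^-1)^-1 = 2 :> R by field.
by apply; lra.
Qed.

Let E_bound x n : `|E n x| <= C.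
Proof.
rewrite ger0_norm; last first.
  by apply: sumr_ge0 => m _; apply: sumr_ge0 => k _; exact: term_ge0.
apply: (@le_trans _ _ (\sum_(m < n) q ^+ m * 2)).
  by apply: ler_sum => m _; exact: (inner_le n m (fun k => (e k)^-1 * x)%g).
by rewrite -mulr_suml ler_wpM2r // geo // ltW.
Qed.

Let bE x : bounded_seq (fun n => E n x).
Proof. by exists C => n; exact: E_bound. Qed.

Let eta x : R := glim (fun n => E n x).

Let eta_gt0 x : 0 < eta x.
Proof.
have [k ek] := esurj x.
apply: (@lt_le_trans _ _ (h k)); first by rewrite exprn_gt0 // invr_gt0.
apply: glim_ge => //; exists k.+1 => //= n kn.
have n0 : (0 < n)%N by exact: leq_trans kn.
rewrite /E (bigD1 (Ordinal n0)) //= (bigD1 (Ordinal kn)) //= ek mulVg.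
have -> : h k * (r ^+ 0 * P 0 1%g) = h k.
  by rewrite /P /wcount /= big_seq1 eqxx expr0 invr1 !mulr1.
rewrite -addrA lerDl; apply: addr_ge0; apply: sumr_ge0 => i _.
  exact: term_ge0.
by apply: sumr_ge0 => j _; exact: term_ge0.
Qed.

Let r_gt0 : 0 < r. Proof. exact: lt_trans ltr01 r1. Qed.

Let Nr_gt0 : 0 < N / r. Proof. exact: divr_gt0 N0 r_gt0. Qed.

(* A step of the walk shifts the sum of the [r ^ m P m] by one index, which costs
   a factor [1 / r]. *)
Let eta_step x : \sum_(s <- S) eta (x * s)%g <= N / r * eta x.
Proof.
have -> : \sum_(s <- S) eta (x * s)%g = glim (fun n => \sum_(s <- S) E n (x * s)%g).
  by rewrite glim_sum.
have step n : \sum_(s <- S) E n (x * s)%g <= N / r * (E n x + q ^+ n * 2).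
  have -> : \sum_(s <- S) E n (x * s)%g = N / r * \sum_(m < n) \sum_(k < n)
      h k * (r ^+ m.+1 * P m.+1 ((e k)^-1 * x)%g).
    rewrite exchange_big mulr_sumr; apply: eq_bigr => m _ /=.
    rewrite exchange_big mulr_sumr; apply: eq_bigr => k _ /=.
    rewrite -mulr_sumr -mulr_sumr /P wcountS.
    under eq_bigr do rewrite mulgA.
    rewrite -mulr_suml exprS [N ^+ m.+1]exprS; field.
    by rewrite !gt_eqF //; first exact: exprn_gt0.
  rewrite (ler_pM2l Nr_gt0).
  apply: (@le_trans _ _ (\sum_(m < n.+1) \sum_(k < n)
      h k * (r ^+ m * P m ((e k)^-1 * x)%g))).
    rewrite big_ord_recl /= lerDr; apply: sumr_ge0 => k _; exact: term_ge0.
  rewrite big_ord_recr /= lerD2l; exact: (inner_le n n (fun k => (e k)^-1 * x)%g).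
have bq : (fun n : nat => q ^+ n * 2) @ \oo --> (0 : R).
  rewrite -(mul0r 2); apply: cvgM; last exact: cvg_cst.
  by apply: cvg_expr; rewrite ger0_norm ?(ltW q0).
have bqb := cvg_bounded_seq bq.
have e2 : N / r * eta x = glim (fun n => N / r * (E n x + q ^+ n * 2)).
  by rewrite glimZ ?glimD // ?(glim_cvg bqb bq) ?addr0 //; exact: boundedD.
rewrite e2; apply: ler_glim; [exact: bounded_sum|by apply: boundedZ; exact: boundedD|].
exact: nearW.
Qed.

Let eta_words n x : \sum_(w <- words n) eta (x * w)%g <= (N / r) ^+ n * eta x.
Proof.
elim: n => [|n IH]; first by rewrite sum_words0 mulg1 expr0 mul1r.
rewrite sum_wordsSr; apply: (@le_trans _ _ (\sum_(w <- words n) N / r * eta (x * w)%g)).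
  by apply: ler_sum => w _; under eq_bigr do rewrite mulgA; exact: eta_step.
by rewrite -mulr_sumr exprS -[leRHS]mulrA (ler_wpM2l (ltW Nr_gt0)).
Qed.

Let walk_row n s x : uniq s ->
  \sum_(y <- s) walk_weight n (y^-1 * x)%g * eta y <= eta x.
Proof.
move=> us.
have Nn : 0 < (N / r) ^+ n by exact: exprn_gt0 Nr_gt0.
rewrite -(ler_pM2l Nn); apply: le_trans (eta_words n x).
have -> : (N / r) ^+ n * \sum_(y <- s) walk_weight n (y^-1 * x)%g * eta y =
    \sum_(w <- words n) \sum_(y <- s) (y == x * w^-1)%g%:R * eta y.
  rewrite exchange_big mulr_sumr; apply: eq_bigr => y _ /=.
  rewrite -mulr_suml mulrA; congr (_ * _).
  rewrite /walk_weight /P /wcount expr_div_n mulrA.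
  rewrite (_ : _ * r ^+ n * _ = \sum_(w <- words n) (w == y^-1 * x)%g%:R); last first.
    by field; rewrite !gt_eqF // exprn_gt0.
  apply: eq_bigr => w _; congr (_%:R); congr nat_of_bool.
  apply/eqP/eqP => [->|->]; first by rewrite invgM invgK mulgA mulgV mul1g.
  by rewrite invgM invgK mulgVK.
rewrite -(sum_words_inv n (fun w => eta (x * w)%g)); apply: ler_sum => w _.
have [ys|ys] := boolP ((x * w^-1)%g \in s).
  rewrite (bigD1_seq _ ys us) /= eqxx mul1r big1 ?addr0 // => y /negPf->.
  by rewrite mul0r.
rewrite big_seq big1 ?ltW // => y yS; case: eqVneq => [yx|]; last by rewrite mul0r.
by rewrite -yx yS in ys.
Qed.

Lemma walk_weight_inv n x : walk_weight n x^-1%g = walk_weight n x.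
Proof. by rewrite /walk_weight /P wcount_inv. Qed.

(** By [walk_row] the function [eta] is a Schur test function for the kernel of
    the weight, in the rows and, by symmetry, in the columns. *)
Lemma walk_schur n (f : G -> R) :
  (forall x, f x ^+ 2 <= walk_weight n x / 4) ->
  schur_sections_le 1 (fun x y => f (y^-1 * x)%g).
Proof.
move=> fw.
have h2 : schur_sections_le 2 (fun x y => 2 * f (y^-1 * x)%g).
  have fw' x : (2 * f x) ^+ 2 <= walk_weight n x by rewrite exprMn; have := fw x; lra.
  apply: (schur_sections_weighted eta_gt0) => s x us.
    apply: le_trans (walk_row n x us); apply: ler_sum => y _.
    by rewrite ler_pM2r.
  apply: le_trans (walk_row n x us); apply: ler_sum => y _.
  by rewrite ler_pM2r // -walk_weight_inv invgM invgK.
have := schur_sections_scale (a := 2^-1) _ h2; rewrite mulVf // invr_ge0 ler0n => /(_ isT).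
by apply: eq_schur_sections => x y; rewrite mulrA mulVf // mul1r.
Qed.

Lemma sum_walk_weight n : \sum_(x <- undup (words n)) walk_weight n x = r ^+ n.
Proof.
rewrite -mulr_sumr -mulr_suml.
rewrite (_ : \sum_(x <- undup (words n)) wcount n x = N ^+ n).
  by rewrite mulfV ?mulr1 // gt_eqF // exprn_gt0.
rewrite exchange_big -sum_words1; apply: eq_big_seq => w ww /=.
rewrite (bigD1_seq w) ?undup_uniq ?mem_undup //= eqxx big1 ?addr0 //.
by move=> x; rewrite eq_sym => /negPf->.
Qed.

(** The square root of the normalized walk [r ^ n P n] is a weight whose squares
    have sum [r ^ n], which is as large as desired since [r > 1]. *)
Lemma large_schur_weights (T : R) : exists (w : G -> R) (E0 : seq G),
  [/\ forall x, 0 <= w x <= 1, forall x, w x^-1%g = w x,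
      uniq E0, T <= \sum_(x <- E0) w x ^+ 2
    & forall f : G -> R, (forall x, `|f x| <= w x / 2) ->
        schur_sections_le 1 (fun x y => f (y^-1 * x)%g)].
Proof.
have [n hn] : exists n : nat, T <= r ^+ n.
  have r10 : 0 < r - 1 by rewrite subr_gt0.
  have bern m : 1 + m%:R * (r - 1) <= r ^+ m.
    elim: m => [|m IH]; first by rewrite mul0r addr0 expr0.
    rewrite exprS -natr1; have h1 := ler_wpM2l r_ge0 IH.
    have h2 : 0 <= m%:R * (r - 1) ^+ 2 by rewrite mulr_ge0 ?sqr_ge0.
    apply: le_trans h1; rewrite -subr_ge0.
    by move: h2; congr (0 <= _); ring.
  exists (Num.bound `|T / (r - 1)|); apply: le_trans (bern _).
  have := archi_boundP (normr_ge0 `|T / (r - 1)|); rewrite normr_id => h1.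
  have h2 := le_lt_trans (ler_norm _) h1.
  by move: h2; rewrite ltr_pdivrMr //; lra.
have ww0 x : 0 <= walk_weight n x by rewrite mulr_ge0 ?P_ge0 ?exprn_ge0.
exists (fun x => Num.sqrt (walk_weight n x)), (undup (words n)); split.
- move=> x; rewrite sqrtr_ge0 /= -[leRHS]sqrtr1 ler_wsqrtr //.
  exact: walk_weight_le1.
- by move=> x; rewrite walk_weight_inv.
- exact: undup_uniq.
- apply: le_trans hn _; rewrite -sum_walk_weight le_eqVlt; apply/orP; left.
  by apply/eqP/eq_bigr => x _; rewrite sqr_sqrtr.
move=> f fw; apply: (walk_schur (n := n)) => x.
have := fw x; rewrite -(ler_sqr (x := `|f x|)) ?nnegrE ?divr_ge0 ?sqrtr_ge0 //.
by rewrite real_normK ?num_real // expr_div_n sqr_sqrtr // -natrX.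
Qed.

End positive_supersolution.
End words.

(** * Almost invariant vectors give a mean *)
Section almost_invariant.
Context (R : realType) (G : groupType).
Implicit Types (u v : seq (R * G)) (A : set G) (g : G).

(** The squared l2-norm on [A] of the measure [u]. *)
Definition mass A u : R := fform (fun x y => ((x == y) && (x \in A))%:R) u u.

Lemma mass_psd A : psd (fun x y : G => ((x == y) && (x \in A))%:R : R).
Proof. exact: psd_diag (fun x => x \in A). Qed.

Lemma mass_ge0 A u : 0 <= mass A u.
Proof. exact: mass_psd. Qed.

Lemma massU A B u : A `&` B = set0 -> mass (A `|` B) u = mass A u + mass B u.
Proof.
move=> AB; rewrite /mass -fformDk; apply: eq_fform => x y.
have -> : (x \in A `|` B) = (x \in A) || (x \in B) by rewrite in_setU.
have : ~~ ((x \in A) && (x \in B)).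
  by rewrite -in_setI AB in_set0.
by case: (x \in A); case: (x \in B); case: (x == y) => //= _; rewrite ?addr0 ?add0r.
Qed.

Lemma mass_le A u : mass A u <= mass setT u.
Proof. by rewrite -(setUv A) massU ?setICr // lerDl mass_ge0. Qed.

Lemma mass_translate A u g :
  mass [set (g * x)%g | x in A] u = mass A (fpush (fun x => g^-1 * x)%g u).
Proof.
rewrite /mass fform_fpush; apply: eq_fform => x y.
rewrite (inj_eq (@mulgI _ g^-1%g)); congr ((_ && _)%:R).
apply/idP/idP.
  by rewrite !inE => -[z Az <-]; rewrite mulKg.
by rewrite !inE => Agx; exists (g^-1 * x)%g => //; rewrite mulVKg.
Qed.

(** The difference of the squared norms is the pairing of the difference of the
    vectors with their sum; the parameter [d] balances the two factors. *)
Lemma mass_diff A u v (d : R) : 0 < d ->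
  `|mass A u - mass A v| <=
    mass setT (fsub u v) / (2 * d) + d * (mass setT u + mass setT v).
Proof.
move=> d0; have ps := mass_psd A.
have key w w' : mass A w - mass A w' <=
    mass setT (fsub w w') / (2 * d) + d * (mass setT w + mass setT w').
  have h1 : mass A w - mass A w' = fform (fun x y => ((x == y) && (x \in A))%:R) (fsub w w') (w ++ w').
    rewrite !(fform_subl, fform_catr) /mass.
    have -> : fform (fun x y => ((x == y) && (x \in A))%:R) w' w =
       fform (fun x y => ((x == y) && (x \in A))%:R) w w'.
      by apply: fform_sym => x y; rewrite eq_sym; case: eqVneq => [->|].
    by ring.
  have h2 := ps (fsub (fscale d^-1 (fsub w w')) (w ++ w')).
  rewrite fform_subl !fform_subr !fform_scalel !fform_scaler in h2.
  have hs : fform (fun x y => ((x == y) && (x \in A))%:R) (w ++ w') (fsub w w') =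
    fform (fun x y => ((x == y) && (x \in A))%:R) (fsub w w') (w ++ w').
    by apply: fform_sym => x y; rewrite eq_sym; case: eqVneq => [->|].
  rewrite hs -h1 -!/(mass A _) in h2.
  have h3 := mass_le A (fsub w w').
  have h4 := fform_cat_le w w' ps; rewrite -!/(mass A _) in h4.
  have h5 := mass_le A w; have h6 := mass_le A w'.
  have : 0 <= d / 2 * (d^-1 * (d^-1 * mass A (fsub w w')) -
     d^-1 * (mass A w - mass A w') - (d^-1 * (mass A w - mass A w') - mass A (w ++ w'))).
    by rewrite mulr_ge0 // divr_ge0 // ltW.
  have -> : d / 2 * (d^-1 * (d^-1 * mass A (fsub w w')) -
     d^-1 * (mass A w - mass A w') - (d^-1 * (mass A w - mass A w') - mass A (w ++ w'))) =
    mass A (fsub w w') / (2 * d) - (mass A w - mass A w') + d / 2 * mass A (w ++ w').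
    by field; rewrite gt_eqF.
  have d20 : 0 <= (2 * d)^-1 by rewrite invr_ge0 mulr_ge0 // ltW.
  have := ler_wpM2l d20 h3; rewrite ![(2 * d)^-1 * _]mulrC.
  have dd : 0 <= d / 2 by rewrite divr_ge0 // ltW.
  have := ler_wpM2l dd (le_trans h4 (ler_wpM2l (ler0n _ 2) (lerD h5 h6))).
  lra.
rewrite ler_norml; apply/andP; split; last exact: key.
have := key v u.
have -> : mass setT (fsub v u) = mass setT (fsub u v).
  by rewrite /mass !(fform_subl, fform_subr); ring.
lra.
Qed.

End almost_invariant.

Section nonamenable_gap.
Context (R : realType) (G : groupType) (e : nat -> G).
Hypothesis esurj : forall x, exists n, e n = x.
Implicit Types (u : seq (R * G)) (S : seq G).

Let left (g : G) u := fpush (fun x => g * x)%g u.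

Lemma mass_left (g : G) u : mass setT (left g u) = mass setT u.
Proof.
rewrite /mass fform_fpush; apply: eq_fform => x y.
by rewrite (inj_eq (@mulgI _ g)) !in_setT.
Qed.

(** The normalized squares of almost invariant vectors are almost invariant
    probabilities, and a generalized limit of these is an invariant mean. *)
Lemma amenable_of_almost_invariant :
  (forall n : nat, exists u, 0 < mass setT u /\ forall g, g \in first e n ->
     mass setT (fsub (left g u) u) <= n.+1%:R^-1 ^+ 2 * mass setT u) ->
  amenable R G.
Proof.
move=> /choice[u hu].
have u0 n : 0 < mass setT (u n) by case: (hu n).
pose p n A : R := mass A (u n) / mass setT (u n).
have p01 n A : 0 <= p n A <= 1.
  rewrite divr_ge0 ?mass_ge0 //= ler_pdivrMr // mul1r; exact: mass_le.
have bp A : bounded_seq (fun n => p n A).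
  by exists 1 => n; have /andP[a b] := p01 n A; rewrite ger0_norm.
exists (fun A => glim (fun n => p n A)); split.
- move=> A; apply: glim_ge0 => //; apply: nearW => n; by case/andP: (p01 n A).
- by rewrite -[RHS]glim_cst; congr glim; apply/funext => n; rewrite /p mulfV ?gt_eqF.
- move=> A B AB; rewrite -glimD //; congr glim; apply/funext => n.
  by rewrite /p massU // mulrDl.
move=> g A; apply/eqP; rewrite -subr_eq0 -glimB //; apply/eqP/glim_cvg.
  by apply: boundedD => //; exact: boundedN.
have hc : (fun n : nat => n.+1%:R^-1 * (5 / 2) : R) @ \oo --> 0.
  by rewrite -(mul0r (5 / 2)); apply: cvgM; [exact: cvg_harmonic|exact: cvg_cst].
apply/cvgrPdist_le => d d0.
move/cvgrPdist_le: hc => /(_ _ d0); apply: filterS2 (first_near (esurj g^-1%g)).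
move=> n gn; rewrite !sub0r !normrN.
pose t : R := n.+1%:R^-1; have t0 : 0 < t by rewrite invr_gt0.
rewrite -/t [`|t * (5 / 2)|]ger0_norm; last by rewrite mulr_ge0 // ltW.
apply: le_trans; rewrite /p mass_translate -mulrBl normrM [`|_^-1|]gtr0_norm ?invr_gt0 //.
rewrite ler_pdivrMr //.
apply: le_trans (mass_diff A (left g^-1%g (u n)) (u n) t0) _.
have [_ /(_ _ gn) h] := hu n; rewrite -/t in h.
rewrite mass_left.
have t20 : 0 <= (2 * t)^-1 by rewrite invr_ge0 mulr_ge0 // ltW.
have := ler_wpM2l t20 h.
have -> : (2 * t)^-1 * (t ^+ 2 * mass setT (u n)) = t / 2 * mass setT (u n).
  by field; rewrite gt_eqF.
by rewrite mulrC; lra.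
Qed.

Lemma ler_sum_mem (T : eqType) (s : seq T) (F : T -> R) x :
  (forall y, 0 <= F y) -> x \in s -> F x <= \sum_(y <- s) F y.
Proof.
move=> F0; elim: s => // y s IH; rewrite inE big_cons => /predU1P[->|/IH xs].
  by rewrite lerDl sumr_ge0.
by apply: le_trans xs _; rewrite lerDr.
Qed.

Let vec S n : seq (R * G) := [seq (1, w) | w <- words S n].

Let mass_vec S n : mass setT (vec S n) = coincidences R S n.
Proof. by rewrite coincidencesE; apply: eq_fform => x y; rewrite in_setT. Qed.

Let coincidences_gt0 S n : 1%g \in S -> 0 < coincidences R S n.
Proof.
move=> S1; apply: (@lt_le_trans _ _ (\sum_(w <- words S n) 1)).
  rewrite sum_words1 exprn_gt0 // ltr0n.
  by case: S S1.
rewrite /coincidences [leLHS]big_seq [leRHS]big_seq.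
apply: ler_sum => w wS; rewrite -[leLHS](_ : (w == w)%:R = 1); last by rewrite eqxx.
by apply: (@ler_sum_mem _ _ (fun w' => (w == w')%:R)).
Qed.

(* The squared distances between the translates of a vector of words add up to
   twice the loss of squared l2-norm in one more step of the walk. *)
Let sum_mass S n :
  \sum_(s <- S) \sum_(t <- S) mass setT (fsub (left s (vec S n)) (left t (vec S n))) =
  2 * ((size S)%:R ^+ 2 * coincidences R S n - coincidences R S n.+1).
Proof.
pose k (x y : G) : R := ((x == y) && (x \in [set: G]))%:R.
have ksym x y : k x y = k y x by rewrite /k !in_setT eq_sym.
have -> : coincidences R S n.+1 =
    \sum_(s <- S) \sum_(t <- S) fform k (left s (vec S n)) (left t (vec S n)).
  rewrite -mass_vec -[LHS]/(fform k _ _) {1}/fform ev_words sum_wordsS; apply: eq_bigr => s _.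
  transitivity (ev (fun x => ev (k x) (vec S n.+1)) (left s (vec S n))).
    by rewrite ev_fpush ev_words.
  rewrite -ev_sum; apply: eq_ev => x; rewrite ev_words sum_wordsS.
  by apply: eq_bigr => t _; rewrite ev_fpush ev_words.
transitivity (\sum_(s <- S) \sum_(t <- S) (2 * coincidences R S n -
   2 * fform k (left s (vec S n)) (left t (vec S n)))).
  apply: eq_bigr => s _; apply: eq_bigr => t _.
  have hk x : fform k (left x (vec S n)) (left x (vec S n)) = coincidences R S n.
    by rewrite -mass_vec -(mass_left x).
  rewrite -[LHS]/(fform k _ _) !(fform_subl, fform_subr) !hk.
  by rewrite (fform_sym ksym (left t _)); ring.
under eq_bigr do rewrite sumrB -mulr_sumr big_const_seq count_predT iter_addr_0.
rewrite sumrB -mulr_sumr big_const_seq count_predT iter_addr_0 mulrBr.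
congr (_ - _).
  by rewrite -[_ *+ _ *+ size S]mulrnA -[_ *+ (size S * size S)]mulr_natl natrM; ring.
by rewrite mulr_sumr; apply: eq_bigr => s _; rewrite mulr_sumr.
Qed.

(** Kesten's argument: if no finite symmetric set has a gap, then some step of the
    walk on any given set [S] loses almost nothing, and the words before this step
    form a vector almost invariant under [S]. *)
Lemma nonamenable_gap : ~ amenable R G -> exists (S : seq G) (rho : R),
  [/\ forall F : G -> R, \sum_(s <- S) F s^-1%g = \sum_(s <- S) F s,
      0 < (size S)%:R :> R, 0 < rho, rho < 1
    & forall n, coincidences R S n.+1 <=
        rho * (size S)%:R ^+ 2 * coincidences R S n].
Proof.
move=> nam; apply: contrapT => ngap; apply/nam/amenable_of_almost_invariant => n.
pose s := first e n; pose S := 1%g :: s ++ [seq x^-1%g | x <- s].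
have Ssym (F : G -> R) : \sum_(s <- S) F s^-1%g = \sum_(s <- S) F s.
  rewrite /S !big_cons !big_cat !big_map invg1 /=; congr (_ + _).
  by under [X in _ + X]eq_bigr do rewrite invgK; exact: addrC.
have S1 : 1%g \in S by rewrite inE eqxx.
pose N : R := (size S)%:R.
have N1 : 1 <= N by rewrite ler1n.
pose t : R := n.+1%:R^-1.
have t0 : 0 < t by rewrite invr_gt0.
have t1 : t <= 1 by rewrite invf_le1 // ler1n.
(* The sum of the squared distances is then at most [2 d N ^ 2 = t ^ 2] times the
   squared norm. *)
pose d := t ^+ 2 / (2 * N ^+ 2).
have N2 : 1 <= N ^+ 2 by rewrite exprn_ege1.
have d0 : 0 < d by rewrite divr_gt0 ?exprn_gt0 // mulr_gt0 ?exprn_gt0 // (lt_le_trans ltr01).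
have dN : d * N ^+ 2 = t ^+ 2 / 2.
  by rewrite /d; field; rewrite gt_eqF // (lt_le_trans ltr01).
have d1 : d < 1.
  have : t ^+ 2 <= 1 by rewrite exprn_ile1 // ltW.
  by nra.
have [m hm] : exists m, (1 - d) * N ^+ 2 * coincidences R S m < coincidences R S m.+1.
  apply: contrapT => nm; apply: ngap; exists S, (1 - d); split => //.
  - by rewrite subr_gt0.
  - by rewrite ltrBlDr ltrDl.
  by move=> m; rewrite leNgt; apply/negP => h; apply: nm; exists m.
exists (vec S m); split; first by rewrite mass_vec coincidences_gt0.
move=> g gs; have gS : g \in S by rewrite inE mem_cat gs orbT.
pose M x y := mass setT (fsub (left x (vec S m)) (left y (vec S m))).
have M0 x y : 0 <= M x y by exact: mass_ge0.
have : M g 1%g <= \sum_(x <- S) \sum_(y <- S) M x y.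
  apply: le_trans (ler_sum_mem (M0 g) S1) _.
  by apply: (@ler_sum_mem _ S (fun x => \sum_(y <- S) M x y)) => // x; exact: sumr_ge0.
rewrite /M sum_mass; have -> : left 1%g (vec S m) = vec S m.
  by rewrite /left /fpush map_id_in // => -[a x] _ /=; rewrite mul1g.
rewrite -/N mass_vec => h; apply: le_trans h _.
have := hm; rewrite mulrBl mul1r dN -/t; lra.
Qed.

End nonamenable_gap.

(** * Averages over signs and noncommutative Riesz products *)
Section sign_average.
Context (R : realType).
Implicit Types (Phi Psi : seq R -> R).

(** Averaging over the signs one at a time makes linearity and conditioning on the
    first sign definitional. *)
Fixpoint sign_avg n (Phi : seq R -> R) : R :=
  if n is n'.+1 then
    (sign_avg n' (fun s => Phi (1 :: s)) + sign_avg n' (fun s => Phi (-1 :: s))) / 2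
  else Phi [::].

Lemma sign_avgD n Phi Psi :
  sign_avg n (fun s => Phi s + Psi s) = sign_avg n Phi + sign_avg n Psi.
Proof.
by elim: n Phi Psi => [|n IH] Phi Psi //=; rewrite !IH; field.
Qed.

Lemma sign_avgZ n c Phi : sign_avg n (fun s => c * Phi s) = c * sign_avg n Phi.
Proof. by elim: n Phi => [|n IH] Phi //=; rewrite !IH; field. Qed.

Lemma eq_sign_avg n Phi Psi : Phi =1 Psi -> sign_avg n Phi = sign_avg n Psi.
Proof.
elim: n Phi Psi => [|n IH] Phi Psi h /=; first exact: h.
by rewrite (IH _ _ (fun s => h (1 :: s))) (IH _ _ (fun s => h (-1 :: s))).
Qed.

Lemma sign_avg_ler n Phi : exists s : seq R,
  [/\ size s = n, {in s, forall a, `|a| = 1} & sign_avg n Phi <= Phi s].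
Proof.
elim: n Phi => [|n IH] Phi /=; first by exists [::].
have [s1 [z1 a1 h1]] := IH (fun s => Phi (1 :: s)).
have [s2 [z2 a2 h2]] := IH (fun s => Phi (-1 :: s)).
have [le|/ltW le] := leP (Phi (1 :: s1)) (Phi (-1 :: s2)).
  exists (-1 :: s2); split => [|a|]; last by lra.
    by rewrite /= z2.
  by rewrite inE => /predU1P[->|/a2//]; rewrite normrN normr1.
exists (1 :: s1); split => [|a|]; last by lra.
  by rewrite /= z1.
by rewrite inE => /predU1P[->|/a1//]; rewrite normr1.
Qed.

End sign_average.

Section riesz.
Context (R : realType) (G : groupType).
Implicit Types (u v : seq (R * G)) (g x y : G) (s : seq R) (ys : seq G).

(** Left multiplication by [g + g^-1]. *)
Definition selfadj g u : seq (R * G) :=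
  fpush (fun x => g * x)%g u ++ fpush (fun x => g^-1 * x)%g u.

Variable tau : G -> R.

(** Real and imaginary parts of the product of the [1 + i a tau(y) (y + y^-1)]
    over the points [y] and their signs [a]. The product stops with the shorter of
    the two lists. *)
Fixpoint riesz ys s : seq (R * G) * seq (R * G) :=
  match ys, s with
  | y :: ys', a :: s' =>
      let r := riesz ys' s' in
      (fsub r.1 (fscale (a * tau y) (selfadj y r.2)),
       r.2 ++ fscale (a * tau y) (selfadj y r.1))
  | _, _ => ([:: (1, 1%g)], [::])
  end.

Lemma ev_selfadj L g u :
  ev L (selfadj g u) = ev (fun x => L (g * x)%g + L (g^-1 * x)%g) u.
Proof. by rewrite /selfadj ev_cat !ev_fpush evD. Qed.

Section norm.
Variable (p : G -> R).
Let k x y := p (y^-1 * x)%g.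
Hypotheses (kpos : psd k) (psym : forall x, p x^-1%g = p x).

Let ksym x y : k x y = k y x.
Proof. by rewrite /k -psym invgM invgK. Qed.

Let kleft g u v :
  fform k (fpush (fun x => g * x)%g u) v = fform k u (fpush (fun x => g^-1 * x)%g v).
Proof.
rewrite -[v in LHS](_ : fpush id v = v); last first.
  by rewrite /fpush map_id_in // => -[].
rewrite fform_fpush -[u in RHS](_ : fpush id u = u); last first.
  by rewrite /fpush map_id_in // => -[].
rewrite fform_fpush; apply: eq_fform => x y /=.
by rewrite /k invgM invgK mulgA.
Qed.

Let selfadjP g u v : fform k (selfadj g u) v = fform k u (selfadj g v).
Proof. by rewrite fform_catl fform_catr !kleft invgK addrC. Qed.

Let selfadj_norm g u : fform k (selfadj g u) (selfadj g u) <= 4 * fform k u u.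
Proof.
apply: le_trans (fform_cat_le _ _ kpos) _.
have inv h : fform k (fpush (fun x => h * x)%g u) (fpush (fun x => h * x)%g u) =
    fform k u u.
  rewrite fform_fpush; apply: eq_fform => x y.
  by rewrite /k invgM -mulgA mulKg.
rewrite !inv; lra.
Qed.

Let sigma ys : R := \sum_(y <- ys) 4 * tau y ^+ 2.

Let sigma_ge0 ys : 0 <= sigma ys.
Proof. by apply: sumr_ge0 => y _; rewrite mulr_ge0 ?sqr_ge0. Qed.

Let base : fform k [:: (1, 1%g)] [:: (1, 1%g)] = p 1%g.
Proof. by rewrite fformE !big_seq1 /k invg1 mulg1 /= !mul1r. Qed.

Let p0 : 0 <= p 1%g.
Proof. by rewrite -base; exact: kpos. Qed.

(* [1 + i t x] with [x] self-adjoint of norm at most 2 has norm at most the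
   square root of [1 + 4 t ^ 2]. *)
Let riesz_norm ys s : {in s, forall a, `|a| = 1} -> sigma ys <= 1 ->
  (fform k (riesz ys s).1 (riesz ys s).1 + fform k (riesz ys s).2 (riesz ys s).2)
    * (1 - sigma ys) <= p 1%g.
Proof.
have small ys' : (fform k [:: (1, 1%g)] [:: (1, 1%g)] + fform k [::] [::]) *
    (1 - sigma ys') <= p 1%g.
  by rewrite base /fform ev_nil addr0 ler_piMr // gerBl.
elim: ys s => [|y ys IH] [|a s] hs; try by move=> _; exact: small.
rewrite [sigma (y :: ys)]/sigma big_cons -/(sigma ys) => h.
have a1 : a ^+ 2 = 1.
  by rewrite -real_normK ?num_real // hs ?mem_head // expr1n.
have hs' : {in s, forall a, `|a| = 1} by move=> b bs; apply: hs; rewrite inE bs orbT.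
have h' : sigma ys <= 1 by have := sqr_ge0 (tau y); lra.
have := IH s hs' h'; rewrite [riesz (y :: ys) _]/=; case: (riesz ys s) => u v /=.
set t := a * tau y; have t2 : t ^+ 2 = tau y ^+ 2 by rewrite exprMn a1 mul1r.
have e1 : fform k (selfadj y v) u = fform k u (selfadj y v) by exact: fform_sym.
have e2 : fform k v (selfadj y u) = fform k u (selfadj y v).
  by rewrite -e1 -selfadjP.
have e3 : fform k (selfadj y u) v = fform k u (selfadj y v) by exact: selfadjP.
have := selfadj_norm y u; have := selfadj_norm y v.
move: (selfadj y u) (selfadj y v) e1 e2 e3 => X Y e1 e2 e3 hY hX.
have -> : fform k (fsub u (fscale t Y)) (fsub u (fscale t Y)) +
    fform k (v ++ fscale t X) (v ++ fscale t X) =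
    fform k u u + fform k v v + t ^+ 2 * (fform k X X + fform k Y Y).
  rewrite !(fform_subl, fform_subr, fform_catl, fform_catr, fform_scalel, fform_scaler).
  by rewrite e1 e2 e3; ring.
rewrite t2.
have := kpos u; have := kpos v; have := sqr_ge0 (tau y); have := sigma_ge0 ys.
move: (tau y ^+ 2) (sigma ys) (fform k u u) (fform k v v) h hX hY.
move: (fform k X X) (fform k Y Y) => A B T S U V hST hA hB S0 T0 V0 U0 hI.
apply: le_trans hI; apply: (@le_trans _ _ ((U + V) * (1 + 4 * T) * (1 - (4 * T + S)))).
  apply: ler_wpM2r; first by lra.
  by have := ler_wpM2l T0 hA; have := ler_wpM2l T0 hB; lra.
have : 0 <= (U + V) * (4 * T * (4 * T + S)).
  by apply: mulr_ge0; [lra|apply: mulr_ge0; lra].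
by lra.
Qed.

(** The product is a vector of squared norm at most [2 p 1] in the Hilbert space of
    [p], and the value of [p] on its imaginary part is an inner product with the
    point mass at the identity. *)
Lemma riesz_bound ys s : {in s, forall a, `|a| = 1} -> sigma ys <= 2^-1 ->
  `|ev p (riesz ys s).2| <= 2 * p 1%g.
Proof.
move=> hs h; have s1 : sigma ys <= 1 by lra.
have hN := riesz_norm hs s1.
set U := fform k (riesz ys s).1 _ in hN; set V := fform k (riesz ys s).2 _ in hN.
have U0 : 0 <= U by exact: kpos.
have V0 : 0 <= V by exact: kpos.
have evE : ev p (riesz ys s).2 = fform k (riesz ys s).2 [:: (1, 1%g)].
  by apply: eq_ev => x; rewrite /ev big_seq1 /= mul1r /k invg1 mul1g.
have V2 : V <= 2 * p 1%g.
  have : (U + V) * 2^-1 <= (U + V) * (1 - sigma ys).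
    by apply: ler_wpM2l; [exact: addr_ge0|lra].
  by lra.
have := fform_CauchySchwarz (riesz ys s).2 [:: (1, 1%g)] kpos ksym.
rewrite -evE base -/V => CS.
have pp : 0 <= 2 * p 1%g by rewrite mulr_ge0.
rewrite -ler_sqr ?nnegrE // real_normK ?num_real //.
apply: le_trans CS _; rewrite expr2.
have := ler_wpM2r p0 V2; have := mulr_ge0 p0 p0; lra.
Qed.

End norm.

(** Averaging over the signs keeps the terms of the product that have no sign. *)
Lemma riesz_avg1 L ys :
  sign_avg (size ys) (fun s => ev L (riesz ys s).1) = L 1%g /\
  sign_avg (size ys) (fun s => ev L (riesz ys s).2) = 0.
Proof.
elim: ys => [|y ys [IH1 IH2]] /=.
  by rewrite ev_nil /ev big_seq1 mul1r.
pose D s := tau y * ev L (selfadj y (riesz ys s).2).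
pose D' s := tau y * ev L (selfadj y (riesz ys s).1).
split.
  transitivity ((sign_avg (size ys) (fun s => ev L (riesz ys s).1 + (-1) * D s) +
      sign_avg (size ys) (fun s => ev L (riesz ys s).1 + 1 * D s)) / 2).
    by congr ((_ + _) / 2); apply: eq_sign_avg => s; rewrite ev_fsub ev_fscale /D; ring.
  by rewrite !sign_avgD !sign_avgZ IH1; field.
transitivity ((sign_avg (size ys) (fun s => ev L (riesz ys s).2 + 1 * D' s) +
    sign_avg (size ys) (fun s => ev L (riesz ys s).2 + (-1) * D' s)) / 2).
  by congr ((_ + _) / 2); apply: eq_sign_avg => s; rewrite ev_cat ev_fscale /D'; ring.
by rewrite !sign_avgD !sign_avgZ IH2; field.
Qed.

Fixpoint signed_fun (L : G -> G -> R) ys s (x : G) : R :=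
  match ys, s with
  | y :: ys', a :: s' => a * L y x + signed_fun L ys' s' x
  | _, _ => 0
  end.

(** In the average only the terms that carry one sign from the function and the
    same sign from the product survive; the rest of the product averages to the
    point mass at the identity. *)
Lemma riesz_avg (L : G -> G -> R) ys :
  sign_avg (size ys) (fun s => ev (signed_fun L ys s) (riesz ys s).2) =
  \sum_(y <- ys) tau y * (L y y + L y y^-1%g).
Proof.
elim: ys => [|y ys IH] /=; first by rewrite big_nil ev_nil.
pose A s := ev (L y) (riesz ys s).2.
pose B s := tau y * ev (L y) (selfadj y (riesz ys s).1).
pose C s := ev (signed_fun L ys s) (riesz ys s).2.
pose D s := tau y * ev (signed_fun L ys s) (selfadj y (riesz ys s).1).
transitivity ((sign_avg (size ys) (fun s => 1 * A s + (B s + (C s + 1 * D s))) +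
    sign_avg (size ys) (fun s => (-1) * A s + (B s + (C s + (-1) * D s)))) / 2).
  by congr ((_ + _) / 2); apply: eq_sign_avg => s;
    rewrite evD evZ !ev_cat !ev_fscale /A /B /C /D; ring.
rewrite !sign_avgD !sign_avgZ big_cons IH.
have -> : sign_avg (size ys) (fun s => ev (L y) (selfadj y (riesz ys s).1)) =
    L y y + L y y^-1%g.
  have [h _] := riesz_avg1 (fun x => L y (y * x)%g + L y (y^-1 * x)%g) ys.
  rewrite !mulg1 in h; rewrite -h; apply: eq_sign_avg => s; exact: ev_selfadj.
by field.
Qed.

End riesz.

(** * Non-amenable groups do not satisfy the splitting condition *)
Section second_difference.
Context (R : realType) (G : groupType).
Implicit Types (F : G -> R) (u v : seq (R * G)) (g x y : G).

(** The form of this function on [u] is that of [F] on [u (g - 1)], a measure of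
    total mass 0. So positive definite functions and the opposites of
    conditionally negative definite ones all give positive definite functions, and
    constants disappear. *)
Definition sdiff g F x : R :=
  F (g^-1 * x * g)%g - F (g^-1 * x)%g - F (x * g)%g + F x.

Lemma fform_fpush_l (T : Type) (k : T -> T -> R) h (w w' : seq (R * T)) :
  fform k (fpush h w) w' = fform (fun a b => k (h a) b) w w'.
Proof. exact: ev_fpush. Qed.

Lemma fform_fpush_r (T : Type) (k : T -> T -> R) h (w w' : seq (R * T)) :
  fform k w (fpush h w') = fform (fun a b => k a (h b)) w w'.
Proof. by apply: eq_ev => a; exact: ev_fpush. Qed.

Lemma sdiff_form g F u :
  fform (fun x y => sdiff g F (y^-1 * x)%g) u u =
  fform (fun x y => F (y^-1 * x)%g) (fsub (fpush (fun x => x * g)%g u) u)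
    (fsub (fpush (fun x => x * g)%g u) u).
Proof.
rewrite fform_subl !fform_subr fform_fpush fform_fpush_l fform_fpush_r.
transitivity (fform (fun x y => F (g^-1 * (y^-1 * x) * g)%g) u u -
    fform (fun x y => F (g^-1 * (y^-1 * x))%g) u u -
    fform (fun x y => F (y^-1 * x * g)%g) u u + fform (fun x y => F (y^-1 * x)%g) u u).
  by rewrite -!fformBk -fformDk.
have -> : fform (fun x y => F (g^-1 * (y^-1 * x) * g)%g) u u =
    fform (fun x y => F ((y * g)^-1 * (x * g))%g) u u.
  by apply: eq_fform => x y; rewrite invgM !mulgA.
have -> : fform (fun x y => F (g^-1 * (y^-1 * x))%g) u u =
    fform (fun x y => F ((y * g)^-1 * x)%g) u u.
  by apply: eq_fform => x y; rewrite invgM !mulgA.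
have -> : fform (fun x y => F (y^-1 * x * g)%g) u u =
    fform (fun x y => F (y^-1 * (x * g))%g) u u.
  by apply: eq_fform => x y; rewrite !mulgA.
ring.
Qed.

Lemma sdiff_sym g F : (forall x, F x^-1%g = F x) ->
  forall x, sdiff g F x^-1%g = sdiff g F x.
Proof.
move=> Fs x; rewrite /sdiff Fs -[F (g^-1 * x^-1 * g)%g]Fs -[F (g^-1 * x^-1)%g]Fs.
by rewrite -[F (x^-1 * g)%g]Fs !invgM !invgK mulgA; ring.
Qed.

Lemma sdiff_signed g (L : G -> G -> R) ys s x :
  sdiff g (signed_fun L ys s) x = signed_fun (fun y => sdiff g (L y)) ys s x.
Proof.
elim: ys s => [|y ys IH] [|a s]; rewrite /sdiff /= ?subr0 ?addr0 //.
by rewrite -IH /sdiff; ring.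
Qed.

(** The splitting writes [f] as a constant minus [rpsi] minus the coefficient
    [theta] of the representation; the second differences of [- rpsi] and of
    [theta] are positive definite. Evaluating the splitting at [g] and at the
    identity bounds them there, since [theta] is bounded by [`|xi| ^ 2]. *)
Lemma splitting_sdiff (f : G -> R) g :
  symmetric_fun f -> (forall x, `|f x| <= 2^-1) ->
  splits (fun x => 1 - f x) ->
  exists P Q : G -> R,
    [/\ psd (fun x y => P (y^-1 * x)%g) /\ (forall x, P x^-1%g = P x),
        psd (fun x y => Q (y^-1 * x)%g) /\ (forall x, Q x^-1%g = Q x),
        P 1%g <= 3, Q 1%g <= 3 & forall x, sdiff g f x = P x - Q x].
Proof.
move=> fs fb [psi [H [pi [xi [[psih psin] psi1 [pi1 piM piO] split]]]]].
rewrite /= in split.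
pose theta x := inner H (pi x xi) xi.
pose rpsi x := complex.Re (psi x).
have psiE x : psi x = (rpsi x)%:C%C.
  have := split x; rewrite /rpsi; case: (psi x) => a b [_ /= bE].
  by rewrite addr0 in bE; rewrite -bE.
have splitr x : 1 - f x = rpsi x + (`|xi| ^+ 2 + theta x).
  by have := split x; rewrite psiE => -[].
have innC z w : inner H z w = inner H w z.
  by rewrite hermC expr0 mul1r.
have innl z (u : seq (R * G)) : inner H (\sum_(a <- u) a.1 *: pi a.2 xi) z =
    ev (fun x => inner H (pi x xi) z) u.
  elim: u => [|a u IH]; first by rewrite big_nil ev_nil linear0l.
  by rewrite big_cons ev_cons linearDl linearZl_LR; congr (_ + _); exact: IH.
have thetaE x y : theta (y^-1 * x)%g = inner H (pi x xi) (pi y xi).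
  by rewrite /theta -(piO y) -piM mulgA mulgV mul1g.
have theta_psd : psd (fun x y => theta (y^-1 * x)%g).
  move=> u; pose V := \sum_(a <- u) a.1 *: pi a.2 xi.
  suff -> : fform (fun x y => theta (y^-1 * x)%g) u u = inner H V V.
    by rewrite -sqr_norm_inner sqr_ge0.
  rewrite /V innl; apply: eq_ev => x; rewrite innC innl; apply: eq_ev => y.
  by rewrite thetaE innC.
have theta_sym x : theta x^-1%g = theta x.
  have := thetaE 1%g x; rewrite mulg1 => ->; rewrite pi1 innC //.
have theta1 : theta 1%g = `|xi| ^+ 2 by rewrite /theta pi1 sqr_norm_inner.
have theta_bd x : - theta 1%g <= theta x <= theta 1%g.
  have h c := theta_psd [:: (1, x); (c, 1%g)].
  have := h 1; have := h (-1).
  rewrite !fformE !big_cons !big_nil /= !(invg1, mulg1, mul1g, mulVg, addr0).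
  by rewrite theta_sym; lra.
have rpsi_sym x : rpsi x^-1%g = rpsi x.
  by have := splitr x; have := splitr x^-1%g; rewrite fs theta_sym; lra.
have rpsi1 : rpsi 1%g = 0 by rewrite /rpsi psi1.
have rpsi_neg u : ev (fun=> 1) u = 0 ->
    fform (fun x y => rpsi (y^-1 * x)%g) u u <= 0.
  move=> u0; have := psin (size u) (fun i => (nth (0, 1%g) u i).2)
    (fun i => ((nth (0, 1%g) u i).1)%:C%C).
  have c0 : \sum_(i < size u) ((nth (0, 1%g) u i).1)%:C%C = 0 :> R[i].
    transitivity (ev (fun=> 1) u)%:C%C; last by rewrite u0.
    rewrite /ev (big_nth (0, 1%g)) big_mkord rmorph_sum.
    by apply: eq_bigr => i _; rewrite mulr1.
  move=> /(_ c0); rewrite lecE /= => /andP[_].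
  congr (_ <= 0); rewrite fformE (big_nth (0, 1%g)) big_mkord re_sum.
  apply: eq_bigr => i _; rewrite (big_nth (0, 1%g)) big_mkord re_sum.
  apply: eq_bigr => j _; rewrite /left_kernel psiE !(reM, imM) /=; ring.
exists (fun x => - sdiff g rpsi x), (sdiff g theta); split.
- split=> [u|x]; last by rewrite sdiff_sym.
  rewrite (@eq_fform _ _ _ (fun x y => -1 * sdiff g rpsi (y^-1 * x)%g)); last first.
    by move=> x y; rewrite mulN1r.
  rewrite fformZk sdiff_form mulN1r oppr_ge0; apply: rpsi_neg.
  by rewrite ev_fsub ev_fpush subrr.
- split=> [u|x]; last by rewrite sdiff_sym.
  by rewrite sdiff_form; exact: theta_psd.
- rewrite /sdiff !(mulg1, mul1g) mulVg rpsi1 rpsi_sym.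
  have := splitr g; have := theta_bd g; have := fb g; rewrite ler_norml -theta1; lra.
- rewrite /sdiff !(mulg1, mul1g) mulVg theta_sym.
  have := splitr 1%g; have := theta_bd g; have := fb 1%g; rewrite ler_norml -theta1 rpsi1; lra.
have fE : f = (fun x => (1 - theta 1%g - rpsi x) - theta x).
  by apply/funext => x; have := splitr x; rewrite -theta1; lra.
by move=> x; rewrite {1}fE /sdiff; ring.
Qed.

End second_difference.

Section contradiction.
Context (R : realType) (G : groupType).
Implicit Types (g x y : G).

Lemma signed_fun_inv (L : G -> G -> R) ys s x :
  (forall y z, L y z^-1%g = L y z) ->
  signed_fun L ys s x^-1%g = signed_fun L ys s x.
Proof.
by move=> h; elim: ys s => [|y ys IH] [|a s] //=; rewrite h IH.
Qed.

Lemma signed_fun_le (L : G -> G -> R) ys s x : (forall y, 0 <= L y x) ->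
  {in s, forall a, `|a| = 1} -> `|signed_fun L ys s x| <= \sum_(y <- ys) L y x.
Proof.
move=> L0; elim: ys s => [|y ys IH] [|a s] s1; rewrite /= ?big_nil ?normr0 ?sumr_ge0 //.
rewrite big_cons; apply: le_trans (ler_normD _ _) _; apply: lerD.
  by rewrite normrM s1 ?mem_head // mul1r ger0_norm.
by apply: IH => b bs; apply: s1; rewrite inE bs orbT.
Qed.

Lemma signed_funD (L L' : G -> G -> R) ys s x :
  signed_fun (fun y z => L y z + L' y z) ys s x =
  signed_fun L ys s x + signed_fun L' ys s x.
Proof.
by elim: ys s => [|y ys IH] [|a s] /=; rewrite ?addr0 // IH; ring.
Qed.

(* The symmetric point mass at [y]; it is doubled when [y] is its own
   inverse. *)
Let bump y x : R := (x == y)%:R + (x == y^-1%g)%:R.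

Let bump_inv y x : bump y x^-1%g = bump y x.
Proof.
rewrite /bump addrC -[in LHS](inj_eq (@invg_inj G)) !invgK.
by congr (_ + _); rewrite -[in LHS](inj_eq (@invg_inj G)) !invgK.
Qed.

Let bump_ge0 y x : 0 <= bump y x.
Proof. by rewrite addr_ge0. Qed.

Let bump_self y : 1 <= bump y y.
Proof. by rewrite /bump eqxx lerDl. Qed.

Let sdiff_bumpE g y : g != 1%g ->
  sdiff g (bump y) y + sdiff g (bump y) y^-1%g =
  2 * bump y (g^-1 * y * g)%g + 2 * bump y y -
  2 * (y * y == g)%g%:R - 2 * (y * y == g^-1)%g%:R.
Proof.
move=> g1.
have e1 : bump y (g^-1 * y)%g = (y * y == g)%g%:R.
  rewrite /bump -{2}[y]mul1g (inj_eq (@mulIg _ y)) -(inj_eq (@invg_inj G)) invgK invg1 (negPf g1) add0r.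
  congr (_%:R); congr nat_of_bool; apply/eqP/eqP => h.
    by rewrite -{1}(mulVKg g y) h mulgVK.
  by rewrite -h invgM -mulgA mulVg mulg1.
have e2 : bump y (y * g)%g = (y * y == g^-1)%g%:R.
  rewrite /bump -{2}[y]mulg1 (inj_eq (@mulgI _ y)) (negPf g1) add0r.
  congr (_%:R); congr nat_of_bool; apply/eqP/eqP => h.
    by rewrite -(mulKg y g) h invgM !invgK.
  by rewrite -[g in LHS]invgK -h invgM mulgA mulgV mul1g.
rewrite /sdiff bump_inv.
have -> : bump y (g^-1 * y^-1 * g)%g = bump y (g^-1 * y * g)%g.
  by rewrite -bump_inv !invgM !invgK mulgA.
have -> : bump y (g^-1 * y^-1)%g = bump y (y * g)%g by rewrite -bump_inv invgM !invgK.
have -> : bump y (y^-1 * g)%g = bump y (g^-1 * y)%g by rewrite -bump_inv invgM !invgK.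
by rewrite e1 e2; ring.
Qed.

(* The two negative terms can only occur when [y] commutes with [g], and then they
   are compensated by the value at the conjugate of [y]. *)
Let sdiff_bump_ge0 g y : g != 1%g ->
  0 <= sdiff g (bump y) y + sdiff g (bump y) y^-1%g.
Proof.
move=> g1; rewrite sdiff_bumpE //; have := bump_self y.
have := bump_ge0 y (g^-1 * y * g)%g.
have comm : (y * y == g)%g || (y * y == g^-1)%g -> bump y (g^-1 * y * g)%g = bump y y.
  move=> /predU1P[<-|/eqP h]; first by rewrite invgM -!mulgA mulKg mulKg.
  by rewrite -h -[g]invgK -h invgM !mulgA !mulgK.
case: eqVneq comm => [_ /(_ isT)->|_]; case: eqVneq => /= [_ |_]; rewrite /=; lra.
Qed.

(* [y] cannot be a square root of two elements that are neither equal nor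
   inverse to each other. *)
Let sdiff_bump_ge2 g g' y : g != 1%g -> g' != 1%g -> g' != g -> g' != g^-1%g ->
  2 <= (sdiff g (bump y) y + sdiff g (bump y) y^-1%g) +
       (sdiff g' (bump y) y + sdiff g' (bump y) y^-1%g).
Proof.
move=> g1 g'1 gg' gg'V.
have good h : h != 1%g -> (y * y != h)%g -> (y * y != h^-1)%g ->
    2 <= sdiff h (bump y) y + sdiff h (bump y) y^-1%g.
  move=> h1 /negPf n1 /negPf n2; rewrite sdiff_bumpE // n1 n2 !mulr0n.
  by have := bump_self y; have := bump_ge0 y (h^-1 * y * h)%g; lra.
have [b|] := boolP ((y * y == g)%g || (y * y == g^-1)%g); last first.
  rewrite negb_or => /andP[n1 n2].
  by have := good g g1 n1 n2; have := sdiff_bump_ge0 y g'1; lra.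
have n1 : (y * y != g')%g.
  by case/predU1P: b => [->|/eqP->]; rewrite eq_sym.
have n2 : (y * y != g'^-1)%g.
  case/predU1P: b => [->|/eqP->]; rewrite eq_sym.
    by rewrite -(inj_eq (@invg_inj G)) invgK.
  by rewrite (inj_eq (@invg_inj G)).
by have := good g' g'1 n1 n2; have := sdiff_bump_ge0 y g1; lra.
Qed.

(** The signs are chosen so that the Riesz product detects the second differences
    of [f] at least as well as on average, namely with the value [c T / 2], where
    [c ^ 2 = 1 / (8 T)]. A splitting bounds the same quantity by 24: twice the
    bound [2 * 3 + 2 * 3] of [riesz_bound] for the two parts given by
    [splitting_sdiff]. Two elements [g] and [g'] are used because the second
    difference along [g] of the point mass at [y] can vanish if [y ^ 2] is [g] or
    its inverse. *)
Lemma splitting_fails (w : G -> R) (E : seq G) :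
  (forall x, 0 <= w x <= 1) -> (forall x, w x^-1%g = w x) -> uniq E ->
  32 * 25 ^+ 2 <= \sum_(x <- E) w x ^+ 2 ->
  exists f : G -> R, [/\ symmetric_fun f, forall x, `|f x| <= w x / 2
    & ~ splits (fun x => 1 - f x)].
Proof.
move=> w01 wV uE ET; set T := \sum_(x <- E) _ in ET.
have w2 x : w x ^+ 2 <= 1.
  by have /andP[w0 w1] := w01 x; rewrite exprn_ile1.
have sizeE : 4 <= (size E)%:R :> R.
  apply: (@le_trans _ _ (32 * 25 ^+ 2)); first by lra.
  apply: le_trans ET _; apply: (@le_trans _ _ (\sum_(x <- E) 1)).
    by apply: ler_sum => x _; exact: w2.
  by rewrite big_const_seq count_predT iter_addr_0.
have pick (t : seq G) : (size t < 4)%N -> exists2 x, x \in E & x \notin t.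
  move=> st; apply: contrapT => h.
  have sub : {subset E <= t}.
    by move=> x xE; apply: contrapT => /negP xt; apply: h; exists x.
  have := uniq_leq_size uE sub; move=> le.
  have : (size E)%:R <= (size t)%:R :> R by rewrite ler_nat.
  have : (size t)%:R < 4 :> R by rewrite ltr_nat.
  by move: sizeE; lra.
have [g _] := pick [:: 1%g] isT; rewrite inE => g1.
have [g' _] := pick [:: 1%g; g; g^-1%g] isT.
rewrite !inE !negb_or => /and3P[g'1 gg' gg'V].
(* This makes the sum of the [4 tau y ^ 2] equal to one half. *)
pose c := (Num.sqrt (8 * T))^-1.
have T0 : 0 < T by lra.
have c0 : 0 < c by rewrite invr_gt0 sqrtr_gt0; lra.
have c2 : c ^+ 2 * (8 * T) = 1.
  by rewrite exprVn sqr_sqrtr ?mulVf //; lra.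
pose tau y := c * w y.
pose L y x := w y / 4 * bump y x.
pose M y x := sdiff g (L y) x + sdiff g' (L y) x.
have [s [ss s1 hs]] := sign_avg_ler (size E) (fun s => ev (signed_fun M E s) (riesz tau E s).2).
pose f := signed_fun L E s.
have fsym : symmetric_fun f.
  by move=> x; rewrite /f signed_fun_inv // => y z; rewrite /L bump_inv.
have fw x : `|f x| <= w x / 2.
  have part (z : G) : \sum_(y <- E) w y / 4 * (z == y)%:R <= w z / 4.
    have [zE|zE] := boolP (z \in E).
      rewrite (bigD1_seq z) //= eqxx mulr1 big1 ?addr0 // => y.
      by rewrite eq_sym => /negPf->; rewrite mulr0.
    rewrite big_seq big1 => [|y yE]; first by have /andP[] := w01 z; lra.
    case: eqVneq => [zy|_]; last by rewrite mulr0.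
    by rewrite zy yE in zE.
  have : `|f x| <= \sum_(y <- E) w y / 4 * bump y x.
    apply: (signed_fun_le (L := L)) => // y.
    by rewrite mulr_ge0 // divr_ge0 //; case/andP: (w01 y).
  have -> : \sum_(y <- E) w y / 4 * bump y x =
      \sum_(y <- E) w y / 4 * (x == y)%:R + \sum_(y <- E) w y / 4 * (x^-1 == y)%g%:R.
    rewrite -big_split; apply: eq_bigr => y _ /=; rewrite -mulrDr; congr (_ * (_ + _)).
    by rewrite -[in RHS](inj_eq (@invg_inj G)) invgK.
  by have := part x; have := part x^-1%g; rewrite wV; lra.
exists f; split=> // split.
have fb x : `|f x| <= 2^-1.
  by have := fw x; have /andP[_] := w01 x; lra.
have bound h : `|ev (sdiff h f) (riesz tau E s).2| <= 12.
  have [P [Q [[Pp Ps] [Qp Qs] P1 Q1 PQ]]] := splitting_sdiff h fsym fb split.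
  have sig : \sum_(y <- E) 4 * tau y ^+ 2 <= 2^-1.
    have -> : \sum_(y <- E) 4 * tau y ^+ 2 = 4 * c ^+ 2 * T.
      by rewrite /T mulr_sumr; apply: eq_bigr => y _; rewrite /tau; ring.
    by lra.
  rewrite (eq_ev PQ) evB; apply: le_trans (ler_normB _ _) _.
  by have := riesz_bound Pp Ps s1 sig; have := riesz_bound Qp Qs s1 sig; lra.
have lower : c * T / 2 <= ev (sdiff g f) (riesz tau E s).2 + ev (sdiff g' f) (riesz tau E s).2.
  have -> : ev (sdiff g f) (riesz tau E s).2 + ev (sdiff g' f) (riesz tau E s).2 =
      ev (signed_fun M E s) (riesz tau E s).2.
    by rewrite -evD; apply: eq_ev => x; rewrite /f !sdiff_signed -signed_funD.
  apply: le_trans hs; rewrite riesz_avg /T -mulrA mulr_suml mulr_sumr.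
  apply: ler_sum => y _; rewrite /M.
  have sL h x : sdiff h (L y) x = w y / 4 * sdiff h (bump y) x.
    by rewrite /sdiff /L; ring.
  rewrite !sL.
  have := sdiff_bump_ge2 y g1 g'1 gg' gg'V.
  have k0 : 0 <= c * w y * (w y / 4).
    by have /andP[wy _] := w01 y; rewrite !mulr_ge0 ?divr_ge0 // ltW.
  move=> /(ler_wpM2l k0); rewrite /tau; lra.
have up : c * T / 2 <= 24.
  have := bound g; have := bound g'; rewrite !ler_norml; lra.
have : (c * T / 2) ^+ 2 <= 24 ^+ 2.
  by rewrite ler_sqr ?nnegrE // divr_ge0 // mulr_ge0 // ltW.
have -> : (c * T / 2) ^+ 2 = T / 32 * (c ^+ 2 * (8 * T)) by field.
by rewrite c2; lra.
Qed.

End contradiction.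

Theorem theorem1p5 (R : realType) (G : groupType)
    (countableG : countable [set: G]) :
  amenable R G <->
  (forall phi : G -> R,
    symmetric_fun phi ->
    (forall t : R, 0 < t -> B2norm_le1 (fun x => (expR (- t * phi x))%:C%C)) ->
    exists (psi : G -> R[i]) (H : realHilbertSpace R)
           (pi : G -> {linear H -> H}) (xi : H),
      [/\ cond_neg_def psi,
          psi 1%g = 0,
          orthogonal_rep pi
        & forall x : G,
            (phi x)%:C%C = psi x + (`|xi| ^+ 2 + inner H (pi x xi) xi)%:C%C]).
Proof.
split=> [am phi|cond]; first exact: amenable_splitting.
have [e esurj] := countable_enumeration 1%g countableG.
apply: contrapT => /(nonamenable_gap esurj) [S [rho [Ssym S0 rho0 rho1 decay]]].
have [w [E [w01 wV uE massE schurw]]] :=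
  large_schur_weights Ssym esurj S0 rho0 rho1 decay (32 * 25 ^+ 2).
have [f [fsym fw nosplit]] := splitting_fails w01 wV uE massE.
apply: nosplit; apply: (cond (fun x => 1 - f x)) => [x|t t0].
  by rewrite fsym.
apply: (schur_sections_multiplier esurj).
exact: (schur_sections_exp (ltW t0) (schurw f fw)).
Qed.
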